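(* Let $\mathcal A:H_1\to H_2$ be a Hilbert--Schmidt operator with singular values $\sigma_1\ge\sigma_2\ge\dots\ge0$. Let $y_1,\dots,y_{k+p}$ be i.i.d. random vectors with distribution $\mathcal N_{H_2}(0,\mathcal A\mathcal A^* )$, let $Y=[y_1,\dots,y_{k+p}]$, let $Q$ be an $H_2$-orthonormal basis for $\mathrm{range}(Y)$, and let $\widehat{\mathcal A}=QQ^*\mathcal A$. If $p\ge2$, then $$\mathbb E\|\mathcal A-\widehat{\mathcal A}\|_{\mathrm{HS}}^2\le\Big(1+\frac{k}{p-1}\Big)\sum_{i>k}\sigma_i^2.$$ Furthermore, if $k\ge2$ and $p\ge4$, then for all $u,t\ge1$ the inequality $$\|\mathcal A-\widehat{\mathcal A}\|_{\mathrm{HS}}\le\Big(\sum_{i>k}\sigma_i^2\Big)^{1/2}+\eta,\qquad \eta=t\sqrt{\frac{3k}{p+1}}\Big(\sum_{i>k}\sigma_i^2\Big)^{1/2}+ut\,\frac{e\sqrt{k+p}}{p+1}\,\sigma_{k+1},$$ holds with probability at least $1-2t^{-p}-e^{-u^2/2}$.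
   Context: $H_1,H_2$ are real, separable, infinite-dimensional Hilbert spaces. $\|\cdot\|_{\mathrm{HS}}$ is the Hilbert--Schmidt norm. $\mathcal A$ has a singular value decomposition $\mathcal A=\sum_{i\ge1}\sigma_i\langle v_i,\cdot\rangle_{H_1}u_i$ with orthonormal systems $\{u_i\}\subset H_2$, $\{v_i\}\subset H_1$. $k\ge1$ is an integer (target rank) and $p$ an integer (oversampling parameter). $\mathcal N_{H_2}(0,\mathcal A\mathcal A^* )$ is the centered Gaussian measure on $H_2$ with the (trace-class, self-adjoint positive semi-definite) covariance operator $\mathcal A\mathcal A^*$; equivalently $y_j=\sum_i\omega_{ij}\sigma_iu_i$ with $\omega_{ij}$ i.i.d. $\mathcal N(0,1)$, the series converging almost surely in $H_2$. A quasi-matrix $[f_1,\dots,f_r]$ with columns in a Hilbert space $H$ is identified with the operator $\mathbb R^r\to H$, $\xi\mapsto\sum_i\xi_if_i$; $QQ^*$ is thus the orthogonal projector onto $\mathrm{range}(Y)=\mathrm{span}\{y_1,\dots,y_{k+p}\}$. In the formula for $\eta$, $e$ is Euler's number. *)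

(* Defs.v *)
From HB Require Import structures.
From mathcomp Require Export all_boot all_order all_algebra.
From mathcomp Require Export all_classical all_reals all_analysis.
Export Order.TTheory GRing.Theory Num.Theory.
Export numFieldNormedType.Exports.

Set Implicit Arguments.
Unset Strict Implicit.
Unset Printing Implicit Defensive.

Local Open Scope classical_set_scope.
Local Open Scope ring_scope.

HB.mixin Record NormedModule_isHilbert (R : realType) H
    of CompleteNormedModule R H := {
  inner : H -> H -> R;
  innerC : forall x y : H, inner x y = inner y x;
  innerDl : forall x y z : H, inner (x + y) z = inner x z + inner y z;
  innerZl : forall (a : R) (x y : H), inner (a *: x) y = a * inner x y;
  inner_norm : forall x : H, inner x x = `|x| ^+ 2
}.

(* Real Hilbert spaces: positive definiteness of the inner product comes from
   that of the norm. *)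
#[short(type="hilbertType")]
HB.structure Definition Hilbert (R : realType) :=
  {H of CompleteNormedModule R H & NormedModule_isHilbert R H}.

Definition separable (T : topologicalType) : Prop :=
  exists2 S : set T, countable S & dense S.

Definition orthonormal_family (R : realType) (H : hilbertType R) (I : eqType)
    (f : I -> H) : Prop :=
  forall i j, inner (f i) (f j) = (i == j)%:R.

Definition orthonormal_basis (R : realType) (H : hilbertType R)
    (e : nat -> H) : Prop :=
  orthonormal_family e /\
  forall x : H, series (fun i => inner (e i) x *: e i) @ \oo --> x.

(* A quasi-matrix [f_1, ..., f_r] with columns in H, viewed as an operator from
   R^r (with its Euclidean inner product) to H, and its adjoint. *)
Definition qmx (R : realType) (H : hilbertType R) (r : nat) (f : 'I_r -> H)
    (xi : 'cV[R]_r) : H :=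
  \sum_i xi i 0 *: f i.

Definition qmx_adj (R : realType) (H : hilbertType R) (r : nat) (f : 'I_r -> H)
    (x : H) : 'cV[R]_r :=
  \col_i inner (f i) x.

Definition infinite_dimensional (R : realType) (H : hilbertType R) : Prop :=
  forall (r : nat) (f : 'I_r -> H), range (qmx f) <> [set: H].

(* By Riesz representation, the set below is a singleton for every y as soon as
   A is linear and continuous. *)
Definition adjoint (R : realType) (H1 H2 : hilbertType R) (A : H1 -> H2)
    (y : H2) : H1 :=
  xget 0 [set x : H1 | forall z, inner (A z) y = inner z x].

(* For A linear and continuous, the value is the same for all orthonormal bases
   e of H1, and is +oo when A is not Hilbert-Schmidt. *)
Definition hs_norm (R : realType) (H1 H2 : hilbertType R) (e : nat -> H1)
    (A : H1 -> H2) : \bar R :=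
  sqrte (\sum_(0 <= i <oo) (`|A (e i)| ^+ 2)%:E)%E.

Definition hilbert_schmidt (R : realType) (H1 H2 : hilbertType R)
    (e : nat -> H1) (A : {linear H1 -> H2}) : Prop :=
  continuous A /\ (hs_norm e A < +oo)%E.

(* Indices start at 0: sigma i, u i and v i are the (i+1)-st singular value and
   singular vectors. Some sigma i may vanish, so A may have finite rank. *)
Definition is_svd (R : realType) (H1 H2 : hilbertType R) (A : H1 -> H2)
    (sigma : nat -> R) (u : nat -> H2) (v : nat -> H1) : Prop :=
  [/\ nonincreasing_seq sigma,
      forall i, 0 <= sigma i,
      orthonormal_family u,
      orthonormal_family v &
      forall x, series (fun i => (sigma i * inner (v i) x) *: u i) @ \oo --> A x].

Notation borel T := (g_sigma_algebraType (@open T)).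

(* The normal law N(0, s) of variance s. The library's normal_prob takes the
   standard deviation and is not the Dirac mass when the latter is 0. *)
Definition normal_law (R : realType) (s : R) : set R -> \bar R :=
  if s == 0 then \d_(0 : R) else normal_prob 0 (Num.sqrt s).

(* mu = N_H(0, C): under mu, every functional <h, .> has law N(0, <C h, h>). *)
Definition centered_gaussian (R : realType) (H : hilbertType R) (C : H -> H)
    (mu : probability (borel H) R) : Prop :=
  forall (h : H) (B : set R), measurable B ->
    mu (inner h @^-1` B) = normal_law (inner (C h) h) B.

Definition mutually_independent (d d' : measure_display)
    (T : measurableType d) (T' : measurableType d') (R : realType)
    (P : probability T R) (I : finType) (X : I -> {RV P >-> T'}) : Prop :=
  forall (J : {set I}) (B : I -> set T'), (forall i, measurable (B i)) ->
    P (\bigcap_(i in [set` J]) X i @^-1` B i) =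
    (\prod_(i in J) P (X i @^-1` B i))%E.

(* Main.v *)
(** Proof idea. In the singular bases, [y_j = \sum_i sigma_i g_ij u_i] with a
standard Gaussian array [g].  Let [G] be its first [k] rows, and [N] the right
inverse [G^T (G G^T)^-1].  Comparing the projection with the combinations
[Y N c] of the columns of [Y], where [c_i = <v_i, x>], gives
[error^2 <= \sum_(i >= k) sigma_i^2 (1 + |g_i N|^2)], and the rows [g_i], [i >= k],
are independent of [N].
- Column [i] of [N] has norm at most [1 / |Q g_i|], where [Q] has [p + 1]
  orthonormal rows orthogonal to the other rows of [G]; so [|Q g_i|] is a chi
  variable with [p + 1] degrees of freedom, which gives the mean of [|N|_F^2],
  and its tail by Bernoulli's inequality.
- The operator norm of [N] is estimated by testing [N] on an independent Gaussian
  vector [z]: a large norm makes [|N z|] large with a probability bounded below,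
  whereas for a fixed [z] a rotation turns [N z] into a multiple of a column.
- Given [N], the sum of the [sigma_i^2 |g_i N|^2] is a Gaussian quadratic form:
  its exponential moments and Chernoff's bound give the factor [e^(-u^2/2)].
Gaussian families are characterised by [E cos (\sum_i a_i X_i + th)], which turns
independence and invariance under rotation into algebraic identities. *)

Require Import Defs.
From HB Require Import structures.
From mathcomp Require Import ring lra measurable_realfun.

Set Implicit Arguments.
Unset Strict Implicit.
Unset Printing Implicit Defensive.

Local Open Scope classical_set_scope.
Local Open Scope ring_scope.

(** * Measures with the same integrals *)

(** Two features shape the argument. [A] may have infinitely many nonzero singular values or only
    finitely many, and [<u_i, y_j> / sigma_i] is a standard Gaussian only where [sigma_i > 0]. So
    the estimates are made on finite blocks of rows, with bounds independent of their size, and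
    passed to the limit; when the last retained singular value vanishes, the error is almost surely
    0 and is treated apart. Conditioning on [N] is replaced by resampling: a Gaussian family keeps
    its law when some of its coordinates come from an independent copy, so the integral becomes an
    iterated one in which the other coordinates are constants. Origin of the constants. The 3 in
    [eta] bounds [((p + 3) / (p + 1))^((p + 2) / 2)], which governs a moment of order [-p] of a chi
    variable. The [e] pays twice for [e^(-(p+1)/2)]: in the lower bound of a normal tail at height
    [sqrt (p + 1)], and in a bound of Stirling type for the chi density. The two bad events for [N]
    cost [t^-p] and [t^-(p+1)], whence [2 t^-p]. *)

Section power_step_limits.
Context {R : realType}.

Lemma bernoulli_ineq (a : R) n : 0 <= a <= 1 -> 1 - n%:R * a <= (1 - a) ^+ n.
Proof.
move=> /andP[a0 a1]; elim: n => [|n IH]; first by rewrite mul0r subr0 expr0.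
rewrite exprS; apply: le_trans (_ : (1 - a) * (1 - n%:R * a) <= _).
  by rewrite -natr1; have := ler0n R n; nra.
by rewrite ler_wpM2l// subr_ge0.
Qed.

Lemma cvg_natM_expr (y : R) : 0 <= y < 1 -> n%:R * y ^+ n @[n --> \oo] --> (0 : R).
Proof.
move=> /andP[y0 y1].
have [c c0 key] : exists2 c : R, 0 < c &
    forall n, n%:R * y ^+ n <= 4 / c ^+ 2 * harmonic n.
  move: y0; rewrite le_eqVlt => /predU1P[<-|y0].
    exists 1 => // -[|n]; rewrite ?mul0r// ?expr0n/= ?mulr0.
      by rewrite mulr_ge0// invr_ge0.
    by rewrite mulr_ge0// invr_ge0.
  have c0 : 0 < - ln y by rewrite oppr_gt0 ln_lt0// y0 y1.
  exists (- ln y) => // n; set c := - ln y in c0 *.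
  have -> : y ^+ n = (expR (n%:R * c))^-1.
    by rewrite -expRN /c mulrN opprK expRM_natl lnK.
  have e1 : 1 + (n%:R * c) ^+ 2 / 2 <= expR (n%:R * c).
    by rewrite (expR_ge1Dxn 1) ?mulr_ge0 ?ler0n// ltW.
  rewrite ler_pdivrMr ?expR_gt0// /harmonic mulrAC ler_pdivlMr ?ltr0n//.
  rewrite mulrAC ler_pdivlMr ?exprn_gt0//.
  apply: le_trans (_ : 4 * (1 + (n%:R * c) ^+ 2 / 2) <= _); last by rewrite ler_wpM2l.
  rewrite -natr1; have [->|n0] := posnP n; first by rewrite !mul0r expr0n mul0r addr0 mulr1.
  have : (1 : R) <= n%:R by rewrite ler1n.
  have c2 : 0 < c ^+ 2 by rewrite exprn_gt0.
  rewrite exprMn; move: (c ^+ 2) c2 (n%:R) => C C0 N N1;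
    have : 0 <= C * (N * (N - 1)) by apply: mulr_ge0; [exact: ltW|apply: mulr_ge0; lra].
  nra.
apply: (@squeeze_cvgr _ _ _ _ (cst 0) (fun n => 4 / c ^+ 2 * harmonic n)).
- by apply: nearW => n; rewrite mulr_ge0 ?exprn_ge0 ?ler0n//=.
- exact: cvg_cst.
- rewrite -[X in _ --> X](mulr0 (4 / c ^+ 2)); apply: cvgMr; exact: cvg_harmonic.
Qed.

Lemma expR_le_1BV (a : R) n : 0 <= a <= 1 -> (1 - a) ^+ n <= expR (- (n%:R * a)).
Proof.
move=> /andP[a0 a1]; rewrite -mulrN expRM_natl lerXn2r ?nnegrE ?subr_ge0 ?expR_ge0//.
exact: expR_ge1Dx.
Qed.

(** Bernoulli bounds the power below by [1 - n (2x)^n], and [1 - y <= exp (-y)] bounds it above by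
    [exp (-n (2x)^n)]. The factor [n] in the exponent sends the value at [x = 1/2] itself to 0, so
    that the limit is the indicator of a strict inequality. *)
Lemma cvg_step (x : R) : 0 <= x <= 1 ->
  (1 - x ^+ n) ^+ (n * 2 ^ n) @[n --> \oo] --> ((x < 2^-1)%R%:R : R).
Proof.
move=> /andP[x0 x1].
have xn n : 0 <= x ^+ n <= 1 by rewrite exprn_ge0// exprn_ile1.
have mE n : (n * 2 ^ n)%:R * x ^+ n = n%:R * (2 * x) ^+ n :> R.
  by rewrite natrM natrX exprMn mulrA.
have [xl|xg] := ltP x 2^-1.
  apply: (@squeeze_cvgr _ _ _ _ (fun n => 1 - n%:R * (2 * x) ^+ n) (cst 1)).
  - apply: nearW => n; rewrite -mE bernoulli_ineq//=.
    by rewrite exprn_ile1 ?subr_ge0 ?(andP (xn n)).2// gerBl (andP (xn n)).1.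
  - rewrite -[X in _ --> X]subr0; apply: cvgB; first exact: cvg_cst.
    by apply: cvg_natM_expr; rewrite mulr_ge0//=; lra.
  - exact: cvg_cst.
apply: (@squeeze_cvgr _ _ _ _ (cst 0) (fun n => (expR (-1)) ^+ n)).
- apply: nearW => n; rewrite exprn_ge0 ?subr_ge0 ?(andP (xn n)).2//=.
  apply: le_trans (expR_le_1BV _ (xn n)) _; rewrite -expRM_natl ler_expR mulrN1 lerN2 mE.
  by rewrite ler_peMr// exprn_ege1// mulrC -ler_pdivrMr// mul1r.
- exact: cvg_cst.
- by apply: cvg_expr; rewrite ger0_norm ?expR_ge0// -[ltRHS]expR0 ltr_expR; lra.
Qed.

End power_step_limits.

Section algebra_unique.
Context d (T : measurableType d) (R : realType) (m1 m2 : probability T R).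
Variable B : set (T -> R).
Hypothesis mB : forall f, B f -> measurable_fun setT f.
Hypothesis bB : forall f, B f -> exists M, forall x, `|f x| <= M.
Hypothesis cB : forall c, B (cst c).
Hypothesis DB : forall f g, B f -> B g -> B (f \+ g).
Hypothesis MB : forall f g, B f -> B g -> B (f \* g).
Hypothesis m12 : forall f, B f ->
  (\int[m1]_x (f x)%:E = \int[m2]_x (f x)%:E)%E.

(** The pi-system of the argument: products of approximating sequences approximate intersections,
    and the bound 1 lets dominated convergence carry [m12] over to indicators. *)
Let G := [set S : set T | measurable S /\ exists g : nat -> T -> R,
  [/\ forall n, B (g n), forall n x, `|g n x| <= 1 &
      forall x, g n x @[n --> \oo] --> (\1_S x : R)]].

Let XB f n : B f -> B (fun x => f x ^+ n).
Proof.
move=> Bf; elim: n => [|n IH].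
  rewrite (_ : (fun _ => _) = cst 1); first exact: cB.
  by apply/funext => x; rewrite expr0.
rewrite (_ : (fun _ => _) = f \* (fun x => f x ^+ n)); first exact: MB.
by apply/funext => x; rewrite exprS.
Qed.

Let Glt f c : B f -> G [set x | f x < c].
Proof.
move=> Bf; split.
  rewrite (_ : [set x | _] = setT `&` f @^-1` `]-oo, c[); first exact: mB.
  by rewrite setTI; apply/seteqP; split => x /=; rewrite in_itv.
have [M fM] := bB Bf.
pose L := 1 + `|M| + `|c|.
have L0 : 0 < L by rewrite /L; have := normr_ge0 M; have := normr_ge0 c; lra.
(* An affine copy of [f] with values in [[0, 1]], for which the threshold [c] becomes [1/2]. *)
pose h := fun x => (2 * L)^-1 * (f x - c) + 2^-1.
have Bh : B h.
  rewrite (_ : h = (cst (2 * L)^-1 \* (f \+ cst (- c))) \+ cst 2^-1)//.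
  by do !(apply: DB || apply: MB || apply: cB).
have h01 x : 0 <= h x <= 1.
  have : `|f x - c| <= L.
    apply: (le_trans (ler_normB _ _)); rewrite /L lerD2r.
    by rewrite (le_trans (fM x))// (le_trans (ler_norm M))// lerDr.
  rewrite ler_norml => /andP[l1 l2]; rewrite /h.
  have : -2^-1 <= (2 * L)^-1 * (f x - c) <= 2^-1.
    rewrite mulrC ler_pdivlMr ?mulr_gt0// ler_pdivrMr ?mulr_gt0//.
    by rewrite mulNr !mulrA mulVf// mul1r l1.
  lra.
(* For [0 <= y <= 1], [(1 - y^n)^(n 2^n)] tends to the indicator of [y < 1/2]. *)
exists (fun n x => (1 - h x ^+ n) ^+ (n * 2 ^ n)); split.
- move=> n; apply: (@XB (fun x => 1 - h x ^+ n)).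
  rewrite (_ : (fun _ => _) = cst 1 \+ (cst (-1) \* (fun x => h x ^+ n))).
    by do !(apply: DB || apply: MB || apply: cB || apply: XB).
  by apply/funext => x /=; rewrite mulN1r.
- move=> n x; have /andP[a b] := h01 x.
  have xn : 0 <= h x ^+ n <= 1 by rewrite exprn_ge0// exprn_ile1.
  by rewrite ger0_norm ?exprn_ge0 ?exprn_ile1//; lra.
- move=> x; rewrite indicE.
  have -> : (x \in [set x | f x < c]) = (h x < 2^-1).
    rewrite /h gtrDr pmulr_rlt0 ?invr_gt0 ?mulr_gt0// subr_lt0.
    by apply/idP/idP; rewrite inE.
  exact: cvg_step.
Qed.

Let GI : setI_closed G.
Proof.
move=> S S' [mS [g [Bg g1 gS]]] [mS' [g' [Bg' g1' gS']]]; split.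
  exact: measurableI.
exists (fun n => g n \* g' n); split => [n|n x|x].
- exact: MB.
- by rewrite normrM mulr_ile1.
- by rewrite indicI; apply: cvgM.
Qed.

Let GE S : G S -> m1 S = m2 S.
Proof.
move=> [mS [g [Bg g1 gS]]].
suff lim (m : probability T R) : (\int[m]_x (g n x)%:E @[n --> \oo] --> m S)%E.
  have l1 := lim m1; have l2 := lim m2.
  rewrite -(cvg_lim _ l1)// -(cvg_lim _ l2)//; congr (limn _).
  by apply/funext => n; exact: m12.
have -> : m S = (\int[m]_x (\1_S x)%:E)%E by rewrite integral_indic// setIT.
have [] // := @dominated_convergence _ T R m setT measurableT
  (fun n x => (g n x)%:E) (fun x => (\1_S x)%:E) (cst 1%E).
- by move=> n; apply/measurable_EFinP; exact: mB.
- by apply/measurable_EFinP; exact: measurable_indic.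
- by apply: aeW => x _; apply/fine_cvgP; split; [exact: nearW|exact: gS].
- exact: finite_measure_integrable_cst.
- by apply: aeW => x n _ /=; rewrite lee_fin.
Qed.

(** A functional form of the pi-lambda argument. It serves twice: for cosines of linear forms, and
    for the functions [exp (-n x^2)]. *)
Lemma algebra_measure_unique A :
  <<s [set S | exists2 f, B f & exists c, S = [set x | f x < c]] >> A ->
  m1 A = m2 A.
Proof.
move=> sA.
have sub : G.-sigma.-measurable A.
  apply: smallest_sub sA; first exact: smallest_sigma_algebra.
  by move=> _ [f Bf [c ->]]; apply: sub_sigma_algebra; exact: Glt.
apply: (g_sigma_algebra_measure_unique G _ (fun=> setT)) sub => //.
- by move=> S [].
- move=> _; rewrite (_ : setT = [set x | cst 0 x < (1 : R)]); first exact: Glt.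
  by apply/seteqP; split => // x _ /=.
- by rewrite bigcup_const//; exists 0%N.
- by move=> k /=; rewrite probability_setT ltry.
Qed.

End algebra_unique.

(** * One-dimensional Gaussian integrals *)

Section half_line_calculus.
Context {R : realType}.
Notation mu := (@lebesgue_measure R).

Lemma FTC_itv (F f : R -> R) a b : a < b ->
  (forall x : R, is_derive x 1 F (f x)) -> continuous f ->
  (\int[mu]_(x in `[a, b]) (f x)%:E = (F b - F a)%:E)%E.
Proof.
move=> ab dF cf; have cF : continuous F.
  by move=> x; apply/differentiable_continuous/derivable1_diffP; have [] := dF x.
rewrite (@continuous_FTC2 _ f F)//.
- exact: continuous_subspaceT.
- split.
  + by move=> x _; have [] := dF x.
  + by apply: cvg_at_right_filter; exact: cF.
  + by apply: cvg_at_left_filter; exact: cF.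
- by move=> x _; rewrite derive1E; have [_ ->] := dF x.
Qed.

Lemma FTC_y (F f : R -> R) (a l : R) : (forall x, a <= x -> 0 <= f x) ->
  (forall x : R, is_derive x 1 F (f x)) -> continuous f -> F x @[x --> +oo%R] --> l ->
  (\int[mu]_(x in `[a, +oo[) (f x)%:E = (l - F a)%:E)%E.
Proof.
move=> f0 dF cf Fl; have cF : continuous F.
  by move=> x; apply/differentiable_continuous/derivable1_diffP; have [] := dF x.
rewrite (@ge0_continuous_FTC2y _ f F a l f0 _ Fl)//.
- exact: continuous_subspaceT.
- by apply: cvg_at_right_filter; exact: cF.
- by move=> x _; rewrite derive1E; have [_ ->] := dF x.
Qed.

End half_line_calculus.

Section half_gauss_moments.
Context {R : realType}.
Notation mu := (@lebesgue_measure R).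

Definition gpow (q : nat) (c : R) (x : R) : R := x ^+ q * expR (- (c * (x ^+ 2 / 2))).

Lemma is_derive_gauss (c x : R) :
  is_derive x 1 (fun x => expR (- (c * (x ^+ 2 / 2)))) (- (c * x) * expR (- (c * (x ^+ 2 / 2)))).
Proof.
apply: is_derive_eq; rewrite !scaler0 ?add0r ?addr0 /GRing.scale /=.
by rewrite !mulr1 mulrC; congr (_ * _); lra.
Qed.

Lemma gpow0E c : gpow 0 c = fun x => expR (- (c * (x ^+ 2 / 2))).
Proof. by apply/funext => x; rewrite /gpow mul1r. Qed.

Lemma is_derive_gpow0 c (x : R) : is_derive x 1 (gpow 0 c) (- (c * gpow 1 c x)).
Proof.
rewrite gpow0E; apply: is_derive_eq (is_derive_gauss c x) _.
by rewrite /gpow; ring.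
Qed.

Lemma is_derive_gpow q c (x : R) :
  is_derive x 1 (gpow q.+1 c) (q.+1%:R * gpow q c x - c * gpow q.+2 c x).
Proof.
have dX : is_derive x 1 (fun x : R => x ^+ q.+1) (q.+1%:R * x ^+ q).
  by split; [exact: exprn_derivable|rewrite exp_derive /GRing.scale /= mulr1].
apply: is_derive_eq (is_deriveM dX (is_derive_gauss c x)) _.
rewrite /GRing.scale /= /gpow !exprS; ring.
Qed.

Lemma continuous_gpow q c : continuous (gpow q c).
Proof.
move=> x; apply: cvgM; first exact: exprn_continuous.
have [+ _] := is_derive_gauss c x.
by move/derivable1_diffP/differentiable_continuous.
Qed.

Lemma measurable_gpow q c : measurable_fun setT (gpow q c).
Proof. exact: continuous_measurable_fun (@continuous_gpow q c). Qed.

Lemma gpow_ge0 q c x : 0 <= x -> 0 <= gpow q c x.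
Proof. by move=> x0; rewrite mulr_ge0 ?exprn_ge0 ?expR_ge0. Qed.

Lemma cvg_gpow q : gpow q 1 x @[x --> +oo%R] --> (0 : R).
Proof.
apply: (@squeeze_cvgr _ _ _ _ (cst 0) (fun x => q`!%:R * expR (- x))).
- near=> x; have x4 : 4 <= x by near: x; exact: nbhs_pinfty_ge.
  rewrite gpow_ge0/=; last by lra.
  have e1 : x ^+ q <= q`!%:R * expR x.
    case: q => [|q]; first by rewrite expr0 fact0 mul1r -expR0 ler_expR; lra.
    have := @expR_ge1Dxn _ x q; rewrite (le_trans _ x4)// => /(_ isT) h.
    by rewrite mulrC -ler_pdivrMr ?ltr0n ?fact_gt0//; lra.
  rewrite /gpow mul1r; apply: le_trans (ler_wpM2r (expR_ge0 _) e1) _.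
  by rewrite -mulrA ler_wpM2l ?ler0n// -expRD ler_expR; nra.
- exact: cvg_cst.
- rewrite -[X in _ --> X](mulr0 (q`!%:R : R)); apply: cvgMr; exact: cvgr_expR.
Unshelve. all: by end_near. Qed.

(** Equal to [2^((q-1)/2) Gamma((q+1)/2)], the normalising constant of the chi law with [q + 1]
    degrees of freedom. *)
Definition gmom (q : nat) : \bar R := (\int[mu]_(x in `[0%R, +oo[) (gpow q 1 x)%:E)%E.

Lemma gmom_ge0 q : (0 <= gmom q)%E.
Proof.
by apply: integral_ge0 => x /=; rewrite in_itv/= andbT => x0; rewrite lee_fin gpow_ge0.
Qed.

Lemma gmom1 : gmom 1 = 1%E.
Proof.
have dF (x : R) : is_derive x 1 (fun x => - gpow 0 1 x) (gpow 1 1 x).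
  apply: is_derive_eq (is_deriveN (is_derive_gpow0 1 x)) _.
  by rewrite opprK mul1r.
have Fl : - gpow 0 1 x @[x --> +oo%R] --> (0 : R).
  by rewrite -[X in _ --> X]oppr0; apply: cvgN; exact: cvg_gpow.
rewrite /gmom (FTC_y _ dF _ Fl).
- by rewrite /gpow expr0 expr0n/= mul0r mulr0 oppr0 expR0 mulr1 sub0r opprK.
- by move=> x x0; exact: gpow_ge0.
- exact: continuous_gpow.
Qed.

(** Integration by parts, in the extended reals because finiteness is known only afterwards. The
    derivative of [gpow q.+1 1] changes sign on the half-line only at [a = sqrt (q + 1)]; on each
    side the fundamental theorem is applied to an integrand of constant sign, and the boundary terms
    at [a] cancel. *)
Lemma gmomS q : gmom q.+2 = (q.+1%:R%:E * gmom q)%E.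
Proof.
pose a : R := Num.sqrt q.+1%:R.
have a0 : 0 < a by rewrite sqrtr_gt0 ltr0n.
have a2 : a ^+ 2 = q.+1%:R by rewrite sqr_sqrtr ?ler0n.
pose f x := q.+1%:R * gpow q 1 x - 1 * gpow q.+2 1 x.
have fE x : f x = gpow q 1 x * (a ^+ 2 - x ^+ 2).
  by rewrite a2 /f /gpow !exprS; ring.
have cf : continuous f.
  move=> x; apply: cvgB; apply: cvgMr; exact: continuous_gpow.
have split (g : R -> R) : continuous g -> (forall x, 0 <= x -> 0 <= g x) ->
    (\int[mu]_(x in `[0%R, +oo[) (g x)%:E = 
    \int[mu]_(x in `[0%R, a]) (g x)%:E + \int[mu]_(x in `[a, +oo[) (g x)%:E)%E.
  move=> cg g0.
  have mg : measurable_fun setT (EFin \o g).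
    by apply/measurable_EFinP; exact: continuous_measurable_fun.
  rewrite -[X in _ = (X + _)%E]integral_itv_bndo_bndc; last exact: measurable_funTS.
  rewrite -ge0_integral_setU//.
  - congr (integral _ _ _).
    by rewrite -itv_bndbnd_setU// bnd_simp ltW.
  - exact: measurable_funTS.
  - move=> x /= []; rewrite in_itv/= lee_fin.
      by move=> /andP[? _]; exact: g0.
    by rewrite andbT => ax; apply: g0; rewrite (le_trans _ ax)// ltW.
  - apply/disj_setPS => x []/=; rewrite !in_itv/= andbT => /andP[_ xa] ax.
    by rewrite ltNge ax in xa.
have mgp n (D : set R) : measurable_fun D (EFin \o gpow n 1).
  by apply: measurable_funTS; apply/measurable_EFinP; exact: measurable_gpow.
rewrite /gmom !split; [|exact: continuous_gpow|by move=> x; exact: gpow_ge0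
  |exact: continuous_gpow|by move=> x; exact: gpow_ge0].
have gq_ge0 n x : 0 <= x -> (0 <= (gpow n 1 x)%:E)%E.
  by rewrite lee_fin; exact: gpow_ge0.
have g0a n x : `[0, a]%classic x -> (0 <= (gpow n 1 x)%:E)%E.
  by rewrite /= in_itv/= => /andP[? _]; exact: gq_ge0.
have gay n x : `[a, +oo[%classic x -> (0 <= (gpow n 1 x)%:E)%E.
  by rewrite /= in_itv/= andbT => ax; apply: gq_ge0; rewrite (le_trans _ ax)// ltW.
have e1 : (q.+1%:R%:E * \int[mu]_(x in `[0%R, a]) (gpow q 1 x)%:E =
    (gpow q.+1 1 a)%:E + \int[mu]_(x in `[0%R, a]) (gpow q.+2 1 x)%:E)%E.
  have -> : gpow q.+1 1 a = gpow q.+1 1 a - gpow q.+1 1 0.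
    by rewrite [X in _ - X]/gpow expr0n/= mul0r subr0.
  rewrite -(FTC_itv a0 (is_derive_gpow q 1) cf).
  rewrite -ge0_integralD//; last 4 first.
  - move=> x /=; rewrite in_itv/= => /andP[x0 xa].
    by rewrite lee_fin -/(f x) fE mulr_ge0 ?gpow_ge0// subr_ge0 ler_sqr ?nnegrE// ltW.
  - by apply: measurable_funTS; apply/measurable_EFinP; exact: continuous_measurable_fun cf.
  - exact: g0a.
  - exact: mgp.
  rewrite -ge0_integralZl//; [|exact: mgp|exact: g0a].
  by apply: eq_integral => x _; rewrite -EFinM -EFinD /f mul1r subrK.
have e2 : (\int[mu]_(x in `[a, +oo[) (gpow q.+2 1 x)%:E =
    (gpow q.+1 1 a)%:E + q.+1%:R%:E * \int[mu]_(x in `[a, +oo[) (gpow q 1 x)%:E)%E.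
  rewrite -[gpow q.+1 1 a]opprK -[- - _]add0r.
  have f0 (x : R) : a <= x -> 0 <= - f x.
    move=> ax; rewrite fE -mulrN mulr_ge0 ?gpow_ge0//; first by rewrite (le_trans _ ax)// ltW.
    by rewrite opprB subr_ge0 ler_sqr ?nnegrE ?(le_trans _ ax)// ltW.
  have dF (x : R) : is_derive x 1 (fun x => - gpow q.+1 1 x) (- f x).
    exact: is_deriveN (is_derive_gpow q 1 x).
  have cNf : continuous (fun x => - f x) by move=> x; apply: cvgN; exact: cf.
  have Fl : - gpow q.+1 1 x @[x --> +oo%R] --> (0 : R).
    by rewrite -[X in _ --> X]oppr0; apply: cvgN; exact: cvg_gpow.
  rewrite -(FTC_y f0 dF cNf Fl).
  rewrite -ge0_integralZl//; [|exact: mgp|exact: gay].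
  rewrite -ge0_integralD//.
  - by apply: eq_integral => x _; rewrite -EFinM -EFinD /f mul1r opprB subrK.
  - move=> x /=; rewrite in_itv/= andbT => ax.
    rewrite lee_fin fE -mulrN mulr_ge0 ?gpow_ge0//; first by rewrite (le_trans _ ax)// ltW.
    by rewrite opprB subr_ge0 ler_sqr ?nnegrE ?(le_trans _ ax)// ltW.
  - apply: measurable_funTS; apply/measurable_EFinP; apply: continuous_measurable_fun.
    by move=> x; apply: cvgN; exact: cf.
  - by move=> x ax; rewrite mule_ge0//; exact: gay.
  - by apply: measurable_funeM; exact: mgp.
rewrite ge0_muleDr; [|by apply: integral_ge0; exact: g0a|by apply: integral_ge0; exact: gay].
by rewrite e1 e2 addeCA addeA.
Qed.

End half_gauss_moments.

Section density.
Context d (T : measurableType d) (R : realType).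
Variables (mu nu : {measure set T -> \bar R}) (g : T -> R).
Hypotheses (mg : measurable_fun setT g) (g0 : forall x, 0 <= g x).
Hypothesis nuE : forall A, measurable A -> nu A = (\int[mu]_(x in A) (g x)%:E)%E.
Import HBNNSimple.
Local Open Scope ereal_scope.

Lemma ge0_integral_density (f : T -> \bar R) :
  measurable_fun setT f -> (forall x, 0 <= f x) ->
  \int[nu]_x f x = \int[mu]_x (f x * (g x)%:E).
Proof.
move=> mf f0; pose h := nnsfun_approx measurableT mf.
have hf x : (h n x)%:E @[n --> \oo] --> f x by exact: cvg_nnsfun_approx.
have mEg : measurable_fun setT (EFin \o g) by exact/measurable_EFinP.
have simple n : \int[nu]_x (h n x)%:E = \int[mu]_x ((h n x)%:E * (g x)%:E).
  have hE x : (h n x)%:E = \sum_(y \in range (h n)) (y * \1_(h n @^-1` [set y]) x)%:E.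
    by rewrite fimfunE -fsumEFin.
  have hgE x : (h n x)%:E * (g x)%:E =
      \sum_(y \in range (h n)) ((y * \1_(h n @^-1` [set y]) x)%:E * (g x)%:E).
    by rewrite -ge0_mule_fsuml ?hE// => y; exact: nnfun_muleindic_ge0.
  under eq_integral do rewrite hE.
  under [RHS]eq_integral do rewrite hgE.
  rewrite !ge0_integral_fsum//; last 4 first.
  - move=> y; apply: emeasurable_funM => //; apply/measurable_EFinP.
    exact: measurable_funM.
  - by move=> y x _; rewrite mule_ge0 ?lee_fin// -lee_fin nnfun_muleindic_ge0.
  - by move=> y; apply/measurable_EFinP; exact: measurable_funM.
  - by move=> y x _; exact: nnfun_muleindic_ge0.
  apply: eq_fsbigr => y /set_mem yh.
  have y0 : (0 <= y)%R by case: yh => t _ <-; exact: fun_ge0.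
  have mh : measurable (h n @^-1` [set y]) by exact: measurable_sfunP.
  under eq_integral do rewrite EFinM.
  rewrite integralZl_indic_nnsfun// integral_indic// setIT nuE//.
  under [RHS]eq_integral do rewrite EFinM -muleA.
  rewrite ge0_integralZl_EFin//.
  - rewrite integral_mkcond; congr (_ * _); apply: eq_integral => x _.
    by rewrite epatch_indic muleC.
  - by move=> x _; rewrite mule_ge0 ?lee_fin.
  - by apply: emeasurable_funM => //; exact/measurable_EFinP.
rewrite (_ : (fun x => f x) = fun x => limn (fun n => (h n x)%:E)); last first.
  by apply/funext => x; apply/esym/cvg_lim.
rewrite monotone_convergence//; last 3 first.
- by move=> n; apply/measurable_EFinP.
- by move=> n x _; rewrite lee_fin.
- by move=> x _ a b ab; rewrite lee_fin; exact/lefP/nd_nnsfun_approx.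
rewrite (_ : (fun x => _ * (g x)%:E) = 
    fun x => limn (fun n => (h n x)%:E * (g x)%:E)); last first.
  apply/funext => x; apply/esym/cvg_lim => //; apply: cvgeZr => //.
rewrite monotone_convergence//.
- by under eq_fun do rewrite simple.
- by move=> n; apply: emeasurable_funM => //; exact/measurable_EFinP.
- by move=> n x _; rewrite mule_ge0 ?lee_fin.
- move=> x _ a b ab; rewrite lee_wpmul2r ?lee_fin//.
  exact/lefP/nd_nnsfun_approx.
Qed.

End density.

Section std_normal.
Context {R : realType}.
Notation mu := (@lebesgue_measure R).
Notation gam := (normal_prob (0 : R) 1).

Lemma normal_pdf01 (x : R) : normal_pdf 0 1 x = normal_peak 1 * gpow 0 1 x.
Proof.
rewrite normal_pdfE ?oner_neq0//; congr (_ * _).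
by rewrite /normal_fun /gpow subr0 expr1n mul1r mul1r mulNr.
Qed.

Lemma peak1_gt0 : 0 < normal_peak 1 :> R.
Proof. exact/normal_peak_gt0/oner_neq0. Qed.

Lemma ge0_integral_normal (f : R -> \bar R) :
  measurable_fun setT f -> (forall x, 0 <= f x)%E ->
  (\int[gam]_x f x = \int[mu]_x (f x * (normal_peak 1 * gpow 0 1 x)%:E))%E.
Proof.
move=> mf f0.
rewrite (@ge0_integral_density _ _ R mu _ (normal_pdf 0 1))//.
- by apply: eq_integral => x _; rewrite normal_pdf01.
- exact: measurable_normal_pdf.
- exact: normal_pdf_ge0.
Qed.

Lemma ge0_integral_halves (h : R -> \bar R) :
  measurable_fun setT h -> (forall x, 0 <= h x)%E ->
  (\int[mu]_x h x = \int[mu]_(x in `[0%R, +oo[) h x + 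
    \int[mu]_(x in `[0%R, +oo[) h (- x)%R)%E.
Proof.
move=> mh h0.
have mN : measurable_fun setT (-%R : R -> R) by exact: oppr_measurable.
rewrite (@ge0_integration_by_substitution0 _ (fun x : R => h (- x)%R))//; last exact: measurableT_comp.
under [X in (_ + X)%E]eq_integral do rewrite opprK.
rewrite -[X in (_ + X)%E]integral_itv_bndo_bndc; last exact: measurable_funTS.
have -> : setT = (`[0%R, +oo[%classic `|` `]-oo, 0%R[%classic : set R).
  by rewrite setUC -itv_bndbnd_setU// set_itvE.
rewrite ge0_integral_setU//=; first exact: measurable_funTS.
apply/disj_setPS => x []/=; rewrite !in_itv/= andbT => x0 x1.
by rewrite ltNge x0 in x1.
Qed.

Let nweight (f : R -> \bar R) x := (f x * (normal_peak 1 * gpow 0 1 x)%:E)%E.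

Let nweight_ge0 f : (forall x, 0 <= f x)%E -> forall x, (0 <= nweight f x)%E.
Proof.
by move=> f0 x; rewrite mule_ge0// lee_fin !mulr_ge0// ?(ltW peak1_gt0)// expR_ge0.
Qed.

Let measurable_nweight f : measurable_fun setT f -> measurable_fun setT (nweight f).
Proof.
move=> mf; apply: emeasurable_funM => //; apply/measurable_EFinP.
by apply: measurable_funM => //; exact: measurable_gpow.
Qed.

Lemma ge0_integral_normalN (f : R -> \bar R) :
  measurable_fun setT f -> (forall x, 0 <= f x)%E ->
  (\int[gam]_x f (- x)%R = \int[gam]_x f x)%E.
Proof.
move=> mf f0.
have mN : measurable_fun setT (-%R : R -> R) by exact: oppr_measurable.
have mfN : measurable_fun setT (fun x : R => f (- x)%R) by exact: measurableT_comp.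
rewrite !ge0_integral_normal// -/(nweight f) -/(nweight (fun x : R => f (- x)%R)).
rewrite !ge0_integral_halves//; do ?[exact: measurable_nweight|exact: nweight_ge0].
have gN x : gpow 0 1 (- x) = gpow 0 1 x :> R by rewrite /gpow sqrrN.
rewrite [RHS]addeC; under [X in (_ + X = _)%E]eq_integral do rewrite opprK gN.
by under [X in (_ = X + _)%E]eq_integral do rewrite gN.
Qed.

Lemma ge0_integral_even (f : R -> \bar R) :
  measurable_fun setT f -> (forall x, 0 <= f x)%E -> (forall x, f (- x) = f x) ->
  (\int[gam]_x f x = (2 * normal_peak 1)%R%:E *
     \int[mu]_(x in `[0%R, +oo[) (f x * (gpow 0 1 x)%:E))%E.
Proof.
move=> mf f0 fN; rewrite ge0_integral_normal// -/(nweight f) ge0_integral_halves//; 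
  do ?[exact: measurable_nweight|exact: nweight_ge0].
rewrite [X in (_ + X)%E](_ : _ = \int[mu]_(x in `[0%R, +oo[) (nweight f x))%E; last first.
  by apply: eq_integral => x _; rewrite /nweight /gpow fN sqrrN.
rewrite -mule2n -mule_natl EFinM -muleA; congr (_ * _)%E.
rewrite -ge0_integralZl_EFin ?(ltW peak1_gt0)//.
- by apply: eq_integral => x _; rewrite /nweight EFinM muleCA.
- by move=> x _; rewrite mule_ge0// lee_fin mulr_ge0// expR_ge0.
- apply: emeasurable_funM; first exact: measurable_funTS.
  by apply/measurable_EFinP; apply: measurable_funTS; exact: measurable_gpow.
Qed.

Lemma gmom_normal q : (\int[gam]_x (`|x| ^+ q)%:E = (2 * normal_peak 1)%R%:E * @gmom R q)%E.
Proof.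
rewrite ge0_integral_even.
- congr (_ * _)%E; apply: eq_integral => x; rewrite inE/= in_itv/= andbT => x0.
  by rewrite -EFinM /gpow expr0 mul1r ger0_norm.
- by apply/measurable_EFinP; apply: measurable_funX; exact: normr_measurable.
- by move=> x; rewrite lee_fin exprn_ge0.
- by move=> x; rewrite normrN.
Qed.

(** Read off from the total mass 1 of the normal law, the case [q = 0] of [gmom_normal]; the same
    equation excludes an infinite value. *)
Lemma gmom0 : @gmom R 0 = (2 * normal_peak 1)^-1%:E.
Proof.
have := gmom_normal 0.
under eq_integral do rewrite expr0.
rewrite integral_cst//= mul1e probability_setT => /esym h.
have p0 : 0 < 2 * normal_peak 1 :> R by rewrite mulr_gt0// peak1_gt0.
move: h (gmom_ge0 (R:=R) 0); case: (@gmom R 0) => [r| |]//=.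
  by rewrite -EFinM => -[h] _; congr EFin; apply/(mulfI (lt0r_neq0 p0)); rewrite h divff ?lt0r_neq0.
by rewrite gt0_muley ?lte_fin.
Qed.

Definition gmo q : R := fine (@gmom R q).

Lemma gmom_fin q : @gmom R q = (gmo q)%:E /\ 0 < gmo q.
Proof.
have p0 : 0 < 2 * normal_peak 1 :> R by rewrite mulr_gt0// peak1_gt0.
(* The recursion [gmomS] has step 2, so two consecutive values are carried along, starting from
   [gmom0] and [gmom1]. *)
rewrite /gmo; suff : forall q, (exists2 r : R, @gmom R q = r%:E & 0 < r) /\ (exists2 r : R, @gmom R q.+1 = r%:E & 0 < r).
  by move=> /(_ q)[[r -> r0] _].
elim=> {q}[|q [[r rE r0] IH]].
  by split; [exists (2 * normal_peak 1)^-1; rewrite ?gmom0 ?invr_gt0|exists 1; rewrite ?gmom1].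
split=> //; exists (q.+1%:R * r); last by rewrite mulr_gt0.
by rewrite gmomS rE EFinM.
Qed.

Lemma gmo_gt0 q : 0 < gmo q. Proof. exact: (gmom_fin q).2. Qed.
Lemma gmomE q : @gmom R q = (gmo q)%:E. Proof. exact: (gmom_fin q).1. Qed.
Lemma gmoS q : gmo q.+2 = q.+1%:R * gmo q.
Proof. by rewrite /gmo gmomS gmomE. Qed.
Lemma gmo1 : gmo 1 = 1. Proof. by rewrite /gmo gmom1. Qed.
Lemma gmo0 : gmo 0 = (2 * normal_peak 1)^-1. Proof. by rewrite /gmo gmom0. Qed.

Lemma sqr_gmo0 : gmo 0 ^+ 2 = pi / 2.
Proof.
rewrite gmo0 invfM exprMn /normal_peak invrK sqr_sqrtr ?expr1n ?mul1r; last first.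
  by rewrite mulrn_wge0// pi_ge0.
by rewrite -mulr_natr; lra.
Qed.

End std_normal.

Section std_normal_estimates.
Context {R : realType}.
Notation mu := (@lebesgue_measure R).
Notation gam := (normal_prob (0 : R) 1).

Lemma gmom_scale q (c : R) : 0 < c ->
  (\int[mu]_(x in `[0%R, +oo[) (gpow q c x)%:E = (Num.sqrt c ^- q.+1 * gmo q)%:E)%E.
Proof.
move=> c0; pose s := Num.sqrt c.
have s0 : 0 < s by rewrite sqrtr_gt0.
have s2 : s ^+ 2 = c by rewrite sqr_sqrtr// ltW.
pose F : R -> R := fun x : R => s * x.
have dF (x : R) : is_derive x 1 F s.
  by apply: is_derive_eq; rewrite /GRing.scale /= mulr1.
have F'E : (F^`())%classic = cst s.
  by apply/funext => x; rewrite derive1E; have [_ ->] := dF x.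
have cF : continuous F by move=> x; apply: cvgMr; exact: cvg_id.
have := @increasing_ge0_integration_by_substitutiony R F (gpow q 1) 0.
rewrite [F 0]mulr0 F'E => h.
have {}h : gmom q = (\int[mu]_(x in `[0%R, +oo[) (((gpow q 1 \o F) * cst s) x)%:E)%E.
  apply: h.
  - by move=> x y _ _ xy; rewrite ltr_pM2l.
  - by move=> x _; exact: cvg_cst.
  - exact: is_cvg_cst.
  - exact: is_cvg_cst.
  - split; first by move=> x _; have [] := dF x.
    by apply: cvg_at_right_filter; exact: cF.
  - by apply: gt0_cvgMry => //; exact: cvg_id.
  - by apply: continuous_subspaceT; exact: continuous_gpow.
  - by move=> x; rewrite in_itv/= andbT => x0; rewrite gpow_ge0// ltW.
have gE x : gpow q c x = s ^- q.+1 * (gpow q 1 (s * x) * s).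
  rewrite /gpow !exprMn s2 mul1r -[c * x ^+ 2 / 2]mulrA [s ^+ q.+1]exprS.
  by field; rewrite expf_neq0 ?lt0r_neq0.
under eq_integral do rewrite gE EFinM.
rewrite ge0_integralZl_EFin//.
- by rewrite -h gmomE.
- move=> x /=; rewrite in_itv/= andbT => x0.
  by rewrite lee_fin mulr_ge0 ?gpow_ge0// ?mulr_ge0// ltW.
- apply/measurable_EFinP; apply: measurable_funTS; apply: measurable_funM => //.
  apply: measurableT_comp; [exact: measurable_gpow|exact: measurable_funM].
- by rewrite invr_ge0 exprn_ge0// ltW.
Qed.

Lemma normal_expR_sqr (l : R) : l < 2^-1 ->
  (\int[gam]_x (expR (l * x ^+ 2))%:E = ((Num.sqrt (1 - 2 * l))^-1)%:E)%E.
Proof.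
move=> l12; have c0 : 0 < 1 - 2 * l by lra.
rewrite ge0_integral_even.
- have gE x : ((expR (l * x ^+ 2))%:E * (gpow 0 1 x)%:E = (gpow 0 (1 - 2 * l) x)%:E)%E.
    by rewrite -EFinM /gpow !expr0 !mul1r -expRD; congr (expR _)%:E; lra.
  under eq_integral do rewrite gE.
  rewrite gmom_scale// expr1 -EFinM gmo0 mulrCA mulfV ?mulr1//.
  by rewrite lt0r_neq0// mulr_gt0// peak1_gt0.
- apply/measurable_EFinP; apply: measurableT_comp => //.
  by apply: measurable_funM => //; exact: measurable_funX.
- by move=> x; rewrite lee_fin expR_ge0.
- by move=> x; rewrite sqrrN.
Qed.

Lemma expR_ge_series (y : R) n : 0 <= y -> series (exp_coeff y) n <= expR y.
Proof.
move=> y0; apply: nondecreasing_cvgn_le; last exact: is_cvg_series_exp_coeff.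
apply/nondecreasing_seqP => k; rewrite /series/= big_nat_recr//= lerDl.
by rewrite /exp_coeff/= divr_ge0// exprn_ge0.
Qed.

Lemma cos_partial_bound (y : R) n : `|series (cos_coeff' y) n| <= expR `|y|.
Proof.
apply: le_trans (expR_ge_series n.*2 (normr_ge0 y)).
apply: le_trans (ler_norm_sum _ _ _) _.
elim: n => [|n IH]; first by rewrite /series/= !big_geq.
rewrite /series/= doubleS !big_nat_recr//= -addrA; apply: lerD => //.
rewrite /cos_coeff' /exp_coeff/= (_ : (-1) ^ n = (-1) ^+ n)// !normrM !normrX.
rewrite normrN1 expr1n mul1r normfV normr_nat lerDl divr_ge0// exprn_ge0//.
Qed.

Lemma gmo_even k : gmo k.*2 = k.*2`!%:R / (2 ^+ k * k`!%:R) * gmo 0 :> R.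
Proof.
elim: k => [|k IH]; first by rewrite expr0 mul1r fact0 divr1 mul1r.
rewrite doubleS gmoS IH.
have -> : k.*2.+2`!%:R = (2 * k.+1%:R) * k.*2.+1%:R * k.*2`!%:R :> R.
  by rewrite -!natrM -mulnA -factS mul2n doubleS -factS.
rewrite [k.+1`!]factS natrM exprS.
have k1 : k`!%:R != 0 :> R by rewrite pnatr_eq0 -lt0n fact_gt0.
have k2 : k.+1%:R != 0 :> R by rewrite pnatr_eq0.
move: k1 k2; move: (k`!%:R : R) (k.+1%:R : R) (k.*2.+1%:R : R) (k.*2`!%:R : R) => A B C D A0 B0.
by field; rewrite A0 B0 expf_neq0.
Qed.

Lemma normal_moment_even k :
  (\int[gam]_x (x ^+ k.*2)%:E = (k.*2`!%:R / (2 ^+ k * k`!%:R) : R)%:E)%E.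
Proof.
have aE (x : R) : x ^+ k.*2 = `|x| ^+ k.*2.
  by rewrite -normrX ger0_norm// -muln2 mulnC exprM exprn_ge0// sqr_ge0.
under eq_integral do rewrite aE.
rewrite gmom_normal gmomE gmo_even -EFinM gmo0 mulrCA mulfV ?mulr1//.
by rewrite lt0r_neq0// mulr_gt0// peak1_gt0.
Qed.

Lemma integrable_moment_even k : gam.-integrable setT (fun x : R => (x ^+ k.*2)%:E).
Proof.
apply/integrableP; split; first by apply/measurable_EFinP; exact: measurable_funX.
under eq_integral do rewrite abse_EFin normrX.
by rewrite gmom_normal gmomE -EFinM ltry.
Qed.

Lemma integrable_expR_abs (s : R) : gam.-integrable setT (fun x : R => (expR `|s * x|)%:E).
Proof.
have mE : measurable_fun setT (fun x : R => (expR `|s * x|)%:E).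
  apply/measurable_EFinP; apply: measurableT_comp => //.
  by apply: measurableT_comp => //; exact: measurable_funM.
have m4 : measurable_fun setT (fun x : R => (expR (4^-1 * x ^+ 2))%:E).
  apply/measurable_EFinP; apply: measurableT_comp => //.
  by apply: measurable_funM => //; exact: measurable_funX.
apply/integrableP; split => //.
under eq_integral do rewrite abse_EFin (ger0_norm (expR_ge0 _)).
apply: (@le_lt_trans _ _ (\int[gam]_x ((expR (s ^+ 2))%:E * (expR (4^-1 * x ^+ 2))%:E))%E).
  apply: ge0_le_integral => //.
  - exact: measurable_funeM.
  - move=> x _; rewrite -EFinM lee_fin -expRD ler_expR.
    (* This gives [|s x| <= s^2 + x^2 / 4], and [1/4 < 1/2] keeps the majorant integrable. *)
    have := sqr_ge0 (`|s| - `|x| / 2); rewrite normrM.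
    by rewrite sqrrB exprMn !real_normK ?num_real//; lra.
rewrite ge0_integralZl_EFin ?expR_ge0//.
by rewrite normal_expR_sqr ?ltry//; lra.
Qed.

(** The power series of the cosine is integrated term by term against the even moments
    [(2k)! / (2^k k!)], which yields the exponential series of [- s^2 / 2]; the partial sums are
    dominated by [exp |s x|]. *)
Lemma normal_cos0 (s : R) : (\int[gam]_x (cos (s * x))%:E = (expR (- (s ^+ 2 / 2)))%:E)%E.
Proof.
have mcos (y : R) : measurable_fun setT (fun x : R => cos (y * x)).
  apply: measurableT_comp; last exact: measurable_funM.
  exact: continuous_measurable_fun (@continuous_cos R).
pose f n (x : R) := (series (cos_coeff' (s * x)) n)%:E.
have fE n x : f n x = (\sum_(0 <= i < n) ((-1) ^+ i * s ^+ i.*2 / i.*2`!%:R)%:E * (x ^+ i.*2)%:E)%E.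
  rewrite /f /series/= -sumEFin; apply: eq_bigr => i _; rewrite -EFinM; congr EFin.
  by rewrite /cos_coeff' exprMn (_ : (-1) ^ i = (-1) ^+ i)//; lra.
have intf n : (\int[gam]_x f n x = (series (exp_coeff (- (s ^+ 2 / 2))) n)%:E)%E.
  under eq_integral do rewrite fE.
  rewrite integral_sum//; last first.
    by move=> i; apply: integrableZl => //; exact: integrable_moment_even.
  rewrite /series/= -sumEFin; apply: eq_bigr => i _.
  rewrite integralZl//; last exact: integrable_moment_even.
  rewrite normal_moment_even -EFinM; congr EFin.
  have -> : exp_coeff (- (s ^+ 2 / 2)) i = (-1) ^+ i * s ^+ i.*2 / 2 ^+ i / i`!%:R.
    by rewrite /exp_coeff/= [(- (s ^+ 2 / 2)) ^+ i]exprNn expr_div_n -exprM mul2n mulrA.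
  have k1 : i`!%:R != 0 :> R by rewrite pnatr_eq0 -lt0n fact_gt0.
  have k2 : i.*2`!%:R != 0 :> R by rewrite pnatr_eq0 -lt0n fact_gt0.
  by field; rewrite k1 k2 expf_neq0.
have [] // := @dominated_convergence _ _ R gam setT measurableT f (fun x => (cos (s * x))%:E)
  (fun x : R => (expR `|s * x|)%:E).
- move=> n; rewrite (_ : f n = fun x =>
    (\sum_(0 <= i < n) ((-1) ^+ i * s ^+ i.*2 / i.*2`!%:R)%:E * (x ^+ i.*2)%:E)%E); last exact/funext.
  apply: emeasurable_sum => i; apply: measurable_funeM.
  by apply/measurable_EFinP; exact: measurable_funX.
- by apply/measurable_EFinP; exact: mcos.
- apply: aeW => x _; apply/fine_cvgP; split; first exact: nearW.
  exact: cvg_cos_coeff'.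
- exact: integrable_expR_abs.
- by apply: aeW => x n _; rewrite lee_fin cos_partial_bound.
move=> _ _ /cvg_lim <- //.
rewrite (_ : [sequence _]_n = fun n => (series (exp_coeff (- (s ^+ 2 / 2))) n)%:E); last exact/funext.
apply/cvg_lim => //; apply: cvg_EFin; first exact: nearW.
exact: is_cvg_series_exp_coeff.
Qed.

Lemma integrable_bounded (d : measure_display) (T : measurableType d) (P : probability T R)
    (f : T -> R) (M : R) :
  measurable_fun setT f -> (forall x, `|f x| <= M) -> P.-integrable setT (EFin \o f).
Proof.
move=> mf fM; apply: measurable_bounded_integrable => //.
  by rewrite [X in (X < _)%E]probability_setT ltry.
exists M; split; first exact: num_real.
by move=> N MN x _ /=; rewrite (le_trans (fM x))// ltW.
Qed.

Lemma normal_sin0 (s : R) : (\int[gam]_x (sin (s * x))%:E = 0)%E.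
Proof.
have msin : measurable_fun setT (fun x : R => sin (s * x)).
  apply: measurableT_comp; last exact: measurable_funM.
  exact: continuous_measurable_fun (@continuous_sin R).
have i1 : gam.-integrable setT (fun x : R => (1 : R)%:E) by exact: finite_measure_integrable_cst.
have is_ : gam.-integrable setT (fun x : R => (sin (s * x))%:E).
  apply: (@integrable_bounded _ _ _ _ 1) => // x.
  by rewrite ler_norml sin_geN1 sin_le1.
(* The reflection lemma is for nonnegative functions, hence the detour through [1 - sin], whose mean
   equals that of [1 + sin]. *)
have := @ge0_integral_normalN R (fun x => (1 - sin (s * x))%:E).
have e1 : (\int[gam]_x (1 - sin (s * x))%:E = 1 - \int[gam]_x (sin (s * x))%:E)%E.
  by rewrite integralB_EFin// integral_cst//= mul1e probability_setT.
have e2 : (\int[gam]_x (1 - sin (s * - x))%:E = 1 + \int[gam]_x (sin (s * x))%:E)%E.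
  under eq_integral do rewrite mulrN sinN opprK EFinD.
  by rewrite integralD_EFin// integral_cst//= mul1e probability_setT.
rewrite e1 e2 => /(_ _ _)-/(_ _ _)/=.
have : (\int[gam]_x (sin (s * x))%:E)%E \is a fin_num by exact: integrable_fin_num.
case: (\int[gam]_x (sin (s * x))%:E)%E => // r _ H.
suff : (1 + r%:E = 1 - r%:E)%E by rewrite -EFinD -EFinB => -[]; move=> h; congr EFin; lra.
apply: H; last by move=> x; rewrite lee_fin subr_ge0 sin_le1.
by apply/measurable_EFinP; exact: measurable_funB.
Qed.

Lemma normal_cos (s th : R) :
  (\int[gam]_x (cos (s * x + th))%:E = (expR (- (s ^+ 2 / 2)) * cos th)%:E)%E.
Proof.
have msin : measurable_fun setT (fun x : R => sin (s * x)).
  apply: measurableT_comp; last exact: measurable_funM.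
  exact: continuous_measurable_fun (@continuous_sin R).
have mcos : measurable_fun setT (fun x : R => cos (s * x)).
  apply: measurableT_comp; last exact: measurable_funM.
  exact: continuous_measurable_fun (@continuous_cos R).
have is_ : gam.-integrable setT (fun x : R => (sin (s * x))%:E).
  apply: (@integrable_bounded _ _ _ _ 1) => // x.
  by rewrite ler_norml sin_geN1 sin_le1.
have ic_ : gam.-integrable setT (fun x : R => (cos (s * x))%:E).
  apply: (@integrable_bounded _ _ _ _ 1) => // x.
  by rewrite ler_norml cos_geN1 cos_le1.
have E x : (cos (s * x + th))%:E = ((cos th)%:E * (cos (s * x))%:E + (- sin th)%:E * (sin (s * x))%:E)%E.
  by rewrite cosD -!EFinM -EFinD; congr EFin; lra.
under eq_integral do rewrite E.
rewrite integralD//; [|exact: integrableZl|exact: integrableZl].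
rewrite !integralZl// normal_sin0 normal_cos0 mule0 adde0 -EFinM mulrC.
by [].
Qed.

(** Mills' ratio from below: [F] vanishes at infinity and its derivative is
    [f = gpow 0 1 x (1 - 2 / (1 + x^2)^2)], which is at most [gpow 0 1 x]. For [x >= 1] this [f] is
    also nonnegative, as [FTC_y] requires. *)
Lemma normal_tail (a : R) : 1 <= a ->
  ((2 * normal_peak 1 * (a / (1 + a ^+ 2) * expR (- (a ^+ 2 / 2))))%:E <=
   gam [set x | (a <= `|x|)%R])%E.
Proof.
move=> a1; have a0 : 0 <= a by lra.
set S := [set x | _].
have mS : measurable S.
  rewrite (_ : S = setT `&` (fun x : R => `|x|) @^-1` `[a, +oo[).
    by apply: normr_measurable.
  by rewrite setTI; apply/seteqP; split => x /=; rewrite in_itv/= andbT.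
have -> : gam S = (\int[gam]_x (\1_S x)%:E)%E by rewrite integral_indic// setIT.
rewrite ge0_integral_even//; last 2 first.
- by apply/measurable_EFinP; exact: measurable_indic.
- move=> x; have -> : \1_S (- x) = \1_S x :> R; last by [].
  rewrite !indicE; have -> : ((- x) \in S) = (x \in S); last by [].
  by apply/idP/idP; rewrite !inE /S/= normrN.
rewrite EFinM lee_pmul2l// ?lte_fin ?mulr_gt0 ?peak1_gt0//.
have -> : (\int[mu]_(x in `[0%R, +oo[) ((\1_S x)%:E * (gpow 0 1 x)%:E) =
   \int[mu]_(x in `[a, +oo[) (gpow 0 1 x)%:E)%E.
  rewrite integral_mkcond [RHS]integral_mkcond; apply: eq_integral => x _.
  rewrite /patch; case: ifPn => x0; case: ifPn => xa.
  - rewrite indicE mem_set ?mul1e// /S/=.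
    by move: xa; rewrite inE/= in_itv/= andbT => xa; rewrite (le_trans xa)// ler_norm.
  - rewrite indicE memNset ?mul0e// /S/=.
    move: x0 xa; rewrite inE notin_setE/= !in_itv/= !andbT => x0 /negP xa.
    by rewrite ger0_norm//; exact/negP.
  - exfalso; move: x0 xa; rewrite inE notin_setE/= !in_itv/= !andbT => /negP x0 xa.
    by move/negP: x0; apply; rewrite (le_trans a0).
  - by [].
have p0 (x : R) : 0 < 1 + x ^+ 2 by have := sqr_ge0 x; lra.
pose f (x : R) := gpow 0 1 x * (1 - 2 * ((1 + x ^+ 2) ^+ 2)^-1).
pose F (x : R) := - (x / (1 + x ^+ 2)) * gpow 0 1 x.
have dF (x : R) : is_derive x 1 F (f x).
  have d1 : is_derive x 1 (fun x : R => 1 + x ^+ 2) (2 * x).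
    by apply: is_derive_eq; rewrite /GRing.scale /=; lra.
  have d2 := @is_deriveV R (fun x : R => 1 + x ^+ 2) x _ 1 (lt0r_neq0 (p0 x)) d1.
  have d3 : is_derive x 1 (fun y : R => - (y / (1 + y ^+ 2)))
      (- (x *: (- (1 + x ^+ 2) ^- 2 *: (2 * x)) + (1 + x ^+ 2)^-1 *: 1)).
    exact: is_deriveN (is_deriveM (is_derive_id x 1) d2).
  apply: is_derive_eq (is_deriveM d3 (is_derive_gpow0 1 x)) _.
  have := lt0r_neq0 (p0 x); rewrite /GRing.scale /= /f /gpow expr0 mul1r.
  by move: (expR _) => E ?; field.
have cf : continuous f.
  move=> x; apply: cvgM; first exact: continuous_gpow.
  apply: cvgB; first exact: cvg_cst.
  apply: cvgMr; apply: cvgV; first by rewrite expf_neq0// lt0r_neq0.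
  apply: (@cvg_comp _ _ _ (fun x => 1 + x ^+ 2) (fun x => x ^+ 2)); last exact: exprn_continuous.
  by apply: cvgD; [exact: cvg_cst|exact: exprn_continuous].
have f0 (x : R) : a <= x -> 0 <= f x <= gpow 0 1 x.
  move=> ax; have x1 : 1 <= x by rewrite (le_trans a1).
  have g0 : 0 <= gpow 0 1 x by rewrite gpow_ge0//; lra.
  have x2 : 1 <= x ^+ 2 by rewrite exprn_ege1.
  have : 0 <= 2 * ((1 + x ^+ 2) ^+ 2)^-1 <= 1.
    rewrite mulr_ge0 ?invr_ge0 ?exprn_ge0 ?(ltW (p0 x))//=.
    by rewrite ler_pdivrMr ?exprn_gt0// mul1r; move: (x ^+ 2) x2 => y; nra.
  rewrite /f; move: (2 * _) (gpow 0 1 x) g0 => y g g0 /andP[y0 y1].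
  by apply/andP; split; nra.
have Fl : F x @[x --> +oo%R] --> (0 : R).
  apply: (@squeeze_cvgr _ _ _ _ (fun x => - gpow 0 1 x) (cst 0)).
  - near=> x; have x0 : 0 <= x by near: x; exact: nbhs_pinfty_ge.
    have g0 : 0 <= gpow 0 1 x by rewrite gpow_ge0.
    have : 0 <= x / (1 + x ^+ 2) <= 1.
      rewrite divr_ge0 ?(ltW (p0 x))//= ler_pdivrMr// mul1r.
      by have := sqr_ge0 (x - 1); rewrite sqrrB1; lra.
    by rewrite /F; move: (x / _) => y /andP[y0 y1] /=; nra.
  - by rewrite -[X in _ --> X]oppr0; apply: cvgN; exact: cvg_gpow.
  - exact: cvg_cst.
have := FTC_y (fun x ax => (andP (f0 x ax)).1) dF cf Fl.
have -> : F a = - (a / (1 + a ^+ 2) * expR (- (a ^+ 2 / 2))) by rewrite /F /gpow expr0 !mul1r mulNr.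
rewrite sub0r opprK => <-.
apply: ge0_le_integral => //.
- by move=> x /=; rewrite in_itv/= andbT => ax; rewrite lee_fin (andP (f0 x ax)).1.
- by apply/measurable_EFinP; apply: measurable_funTS; exact: continuous_measurable_fun cf.
- by apply/measurable_EFinP; apply: measurable_funTS; exact: measurable_gpow.
- by move=> x /=; rewrite in_itv/= andbT => ax; rewrite lee_fin (andP (f0 x ax)).2.
Unshelve. all: by end_near. Qed.
End std_normal_estimates.

(** * Finite Gaussian families *)

Section coordinate_space.
Context (R : realType) (I : Type).

Definition cylinders : set (set (I -> R)) :=
  [set A | exists i B, measurable B /\ A = (fun x => x i) @^-1` B].

Definition coords := g_sigma_algebraType cylinders.

Lemma measurable_coord (i : I) : measurable_fun setT (fun x : coords => x i : R).
Proof.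
by move=> _ B mB; rewrite setTI; apply: sub_sigma_algebra; exists i, B.
Qed.

Lemma measurable_coords d (T : measurableType d) (f : T -> coords) :
  (forall i, measurable_fun setT (fun t => f t i : R)) -> measurable_fun setT f.
Proof.
move=> mf; apply: (@measurability _ _ T coords setT f cylinders) => // _ [_ [i [B [mB ->]] <-]].
by have := mf i measurableT B mB; rewrite !setTI.
Qed.

End coordinate_space.

Section prod_prob.
Context d d' (T : measurableType d) (T' : measurableType d') (R : realType).
Variables (P : probability T R) (P' : probability T' R).

Definition prod_prob : set (T * T') -> \bar R := (P \x P')%E.

HB.instance Definition _ := Measure.on prod_prob.

Let prod_probT : prod_prob setT = 1%E.
Proof.
rewrite /prod_prob -setXTT product_measure1E// -[RHS]mule1.
by congr (_ * _)%E; exact: probability_setT.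
Qed.

HB.instance Definition _ := Measure_isProbability.Build _ _ _ prod_prob prod_probT.

End prod_prob.

Section image_prob.
Context d d' (T : measurableType d) (T' : measurableType d') (R : realType).
Variables (P : probability T R) (f : T -> T') (mf : measurable_fun setT f).

(** The vacuous [let] keeps [mf] among the parameters, so that the measure structures declared below
    may depend on it. *)
Definition image_prob : set T' -> \bar R := let _ := mf in fun A => pushforward P f A.

Let mf_mixin := isMeasurableFun.Build _ _ _ _ _ mf.
Let f_pack : {mfun T >-> T'} := HB.pack f mf_mixin.

Let image_prob0 : image_prob set0 = 0%E.
Proof. exact: (measure0 (distribution P f_pack)). Qed.

Let image_prob_ge0 A : (0 <= image_prob A)%E.
Proof. exact: (measure_ge0 (distribution P f_pack)). Qed.

Let image_prob_sigma : semi_sigma_additive image_prob.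
Proof. exact: (@measure_semi_sigma_additive _ _ _ (distribution P f_pack)). Qed.

HB.instance Definition _ := isMeasure.Build _ _ _ image_prob
  image_prob0 image_prob_ge0 image_prob_sigma.

Let image_probT : image_prob setT = 1%E.
Proof. exact: (probability_setT (distribution P f_pack)). Qed.

HB.instance Definition _ := Measure_isProbability.Build _ _ _ image_prob image_probT.

Lemma ge0_integral_image (F : T' -> \bar R) :
  measurable_fun setT F -> (forall x, 0 <= F x)%E ->
  (\int[image_prob]_x F x = \int[P]_w F (f w))%E.
Proof.
move=> mF F0; rewrite -[RHS]/(\int[P]_(w in f @^-1` setT) (F \o f) w)%E.
by rewrite -(ge0_integral_pushforward mf).
Qed.

Lemma integral_image (F : T' -> \bar R) :
  measurable_fun setT F -> P.-integrable setT (F \o f) ->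
  (\int[image_prob]_x F x = \int[P]_w F (f w))%E.
Proof.
move=> mF iF; rewrite -[RHS]/(\int[P]_(w in f @^-1` setT) (F \o f) w)%E.
by rewrite -(integral_pushforward mf).
Qed.

End image_prob.

Section cosine_polynomials.
Context (R : realType) (I : finType).
Implicit Types (f g : coords R I -> R) (a : I -> R).

(** The phase [th] makes sines available, and the product-to-sum formula closes the class under
    products. This is the algebra fed to [algebra_measure_unique]; integrals over it are determined
    by the characteristic function. *)
Inductive cospoly : (coords R I -> R) -> Prop :=
| cospoly_base c a th : cospoly (fun x => c * cos (\sum_i a i * x i + th))
| cospoly_add f g : cospoly f -> cospoly g -> cospoly (f \+ g).

Lemma cospoly_mul f g : cospoly f -> cospoly g -> cospoly (f \* g).
Proof.
move=> cf; elim: cf g => [c a th|f1 f2 _ IH1 _ IH2] g cg; last first.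
  rewrite (_ : _ \* g = (f1 \* g) \+ (f2 \* g)).
    by apply: cospoly_add; [exact: IH1|exact: IH2].
  by apply/funext => x /=; rewrite mulrDl.
elim: cg => [c' a' th'|g1 g2 _ IH1 _ IH2]; last first.
  rewrite (_ : _ \* (_ \+ _) = ((fun x : coords R I => c * cos (\sum_i a i * x i + th)) \* g1) \+
    ((fun x : coords R I => c * cos (\sum_i a i * x i + th)) \* g2)).
    exact: cospoly_add.
  by apply/funext => x /=; rewrite mulrDr.
rewrite (_ : _ \* _ =
  (fun x : coords R I => (c * c' / 2) * cos (\sum_i (a i + a' i) * x i + (th + th'))) \+
  (fun x : coords R I => (c * c' / 2) * cos (\sum_i (a i - a' i) * x i + (th - th')))).
  by apply: cospoly_add; exact: cospoly_base.
apply/funext => x /=.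
have -> : \sum_i (a i + a' i) * x i + (th + th') =
  (\sum_i a i * x i + th) + (\sum_i a' i * x i + th').
  by rewrite addrACA -big_split/=; congr (_ + _); apply: eq_bigr => i _; rewrite mulrDl.
have -> : \sum_i (a i - a' i) * x i + (th - th') =
  (\sum_i a i * x i + th) - (\sum_i a' i * x i + th').
  by rewrite opprD addrACA -sumrB; congr (_ + _); apply: eq_bigr => i _; rewrite mulrBl.
move: (\sum_i _ * _ + th) (\sum_i _ * _ + th') => y z.
by rewrite cosD cosB; field.
Qed.

Lemma measurable_lincomb a : measurable_fun setT (fun x : coords R I => \sum_i a i * x i).
Proof.
apply: measurable_sum => i; apply: measurable_funM => //; exact: measurable_coord.
Qed.

Lemma measurable_cos : measurable_fun setT (@cos R).
Proof. exact: continuous_measurable_fun (@continuous_cos R). Qed.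

Lemma cos_bounded (x : R) : `|cos x| <= 1.
Proof. by rewrite ler_norml cos_geN1 cos_le1. Qed.

Lemma measurable_cospoly f : cospoly f -> measurable_fun setT f.
Proof.
elim=> [c a th|g h _ mg _ mh]; last exact: measurable_funD.
apply: measurable_funM => //; apply: measurableT_comp; first exact: measurable_cos.
apply: measurable_funD => //; exact: measurable_lincomb.
Qed.

Lemma bounded_cospoly f : cospoly f -> exists M, forall x, `|f x| <= M.
Proof.
elim=> [c a th|g h _ [M gM] _ [N hN]].
  by exists `|c| => x; rewrite normrM ler_piMr// cos_bounded.
by exists (M + N) => x; rewrite (le_trans (ler_normD _ _))// lerD.
Qed.

(** Coordinates are unbounded, hence not in the algebra of cosines; this limit recovers them as
    measurable functions. *)
Lemma cvg_Msin (x : R) : n.+1%:R * sin (x / n.+1%:R) @[n --> \oo] --> x.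
Proof.
have [->|x0] := eqVneq x 0.
  by under eq_fun do rewrite mul0r sin0 mulr0; exact: cvg_cst.
have [ds de] := is_derive_sin (0 : R).
have : (fun h : R => h^-1 *: (((@sin R) \o shift 0) (h *: 1) - sin 0)) @ 0^' --> (1 : R).
  by rewrite -[X in _ --> X]cos0 -de.
move=> /cvgr_dnbhsP /(_ (fun n => x / n.+1%:R)) H.
rewrite -[X in _ --> X]mulr1.
rewrite (_ : (fun n => _) = (fun n => x * ((x / n.+1%:R)^-1 *: (((@sin R) \o shift 0) ((x / n.+1%:R) *: 1) - sin 0)))).
  apply: cvgMr; apply: H; split.
    by move=> n; rewrite mulf_neq0// invr_eq0 pnatr_eq0.
  rewrite -[X in _ --> X](mulr0 x); apply: cvgMr; exact: cvg_harmonic.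
apply/funext => n; rewrite /= /GRing.scale /= addr0 mulr1 sin0 subr0 invf_div.
by field; rewrite x0.
Qed.

Lemma coords_generated (A : set (coords R I)) : measurable A ->
  <<s [set S | exists2 f, cospoly f & exists c, S = [set x | f x < c]] >> A.
Proof.
set G := [set S | _] => mA.
pose T' := g_sigma_algebraType G.
have mf f : cospoly f -> measurable_fun setT (f : T' -> R).
  move=> cf; apply: (measurability _ (RGenInftyO.measurableE R)) => // _ [_ [c ->] <-].
  rewrite setTI; apply: sub_sigma_algebra; exists f => //; exists c.
  by apply/seteqP; split => x /=; rewrite in_itv.
apply: smallest_sub mA; first exact: smallest_sigma_algebra.
move=> _ [i [B [mB ->]]].
suff mi : measurable_fun setT (fun x : T' => x i : R) by rewrite -[X in <<s _ >> X]setTI; exact: mi.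
(* The phase [- pi / 2] turns the cosine into the sine of [cvg_Msin]. *)
pose h n (x : T') : R := n.+1%:R * cos (\sum_j ((j == i)%:R / n.+1%:R) * x j + (- (pi / 2))).
apply: (@measurable_fun_cvg _ _ _ _ h) => //.
  by move=> n; apply: mf; exact: (cospoly_base _ (fun j => (j == i)%:R / n.+1%:R)).
move=> x _; rewrite /h.
have E n : n.+1%:R * cos (\sum_j ((j == i)%:R / n.+1%:R) * x j + - (pi / 2)) = 
    n.+1%:R * sin (x i / n.+1%:R).
  rewrite (bigD1 i)//= eqxx big1 ?addr0; last by move=> j /negbTE ->; rewrite !mul0r.
  by rewrite cosBpihalf mulrAC mul1r.
under eq_fun do rewrite E; exact: cvg_Msin.
Qed.

Lemma coords_measure_unique (m1 m2 : probability (coords R I) R) :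
  (forall a th, \int[m1]_x (cos (\sum_i a i * x i + th))%:E =
     \int[m2]_x (cos (\sum_i a i * x i + th))%:E)%E ->
  forall A, measurable A -> m1 A = m2 A.
Proof.
move=> m12 A /coords_generated; apply: algebra_measure_unique.
- exact: measurable_cospoly.
- exact: bounded_cospoly.
- move=> c; rewrite (_ : cst c = fun x : coords R I => c * cos (\sum_i (cst 0 i) * x i + 0)).
    exact: cospoly_base.
  by apply/funext => x; rewrite big1 ?addr0 ?cos0 ?mulr1// => i _; rewrite mul0r.
- exact: cospoly_add.
- exact: cospoly_mul.
- move=> f; have int (m : probability (coords R I) R) g : cospoly g -> m.-integrable setT (EFin \o g).
    move=> cg; have [M gM] := bounded_cospoly cg.
    exact: (@integrable_bounded _ _ _ m g M (measurable_cospoly cg) gM).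
  elim=> [c a th|g h cg IHg ch IHh].
    under eq_integral do rewrite EFinM.
    under [RHS]eq_integral do rewrite EFinM.
    have cb : cospoly (fun x => cos (\sum_i a i * x i + th)).
      have := cospoly_base 1 a th; congr cospoly; apply/funext => x; exact: mul1r.
    by rewrite !integralZl//; [congr (_ * _)%E; exact: m12|exact: int|exact: int].
  under eq_integral do rewrite EFinD.
  under [RHS]eq_integral do rewrite EFinD.
  by rewrite !integralD_EFin//; [rewrite IHg IHh|exact: int..].
Qed.

End cosine_polynomials.

Section gaussian_family.
Context (R : realType).

(* The law N(0, Id): varying [th] gives the real and imaginary parts of the
   characteristic function. *)
Definition gaussian d (T : measurableType d) (P : probability T R) (I : finType)
    (X : I -> T -> R) : Prop :=
  (forall i, measurable_fun setT (X i)) /\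
  forall (a : I -> R) th,
    (\int[P]_w (cos (\sum_i a i * X i w + th))%:E =
     (expR (- ((\sum_i a i ^+ 2) / 2)) * cos th)%:E)%E.

(** The two families may live on different spaces, so a given family can be exchanged for one built
    on a product space, where Fubini's theorem applies. *)
Lemma gaussian_unique d d' (T : measurableType d) (T' : measurableType d')
    (P : probability T R) (P' : probability T' R) (I : finType)
    (X : I -> T -> R) (X' : I -> T' -> R) (F : coords R I -> \bar R) :
  gaussian P X -> gaussian P' X' -> measurable_fun setT F -> (forall x, 0 <= F x)%E ->
  (\int[P]_w F (fun i => X i w) = \int[P']_w F (fun i => X' i w))%E.
Proof.
move=> [mX gX] [mX' gX'] mF F0.
have mf : measurable_fun setT (fun w => (fun i => X i w) : coords R I) by exact: measurable_coords.
have mf' : measurable_fun setT (fun w => (fun i => X' i w) : coords R I) by exact: measurable_coords.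
have mc a th : measurable_fun setT (fun x : coords R I => (cos (\sum_i a i * x i + th))%:E).
  apply/measurable_EFinP; apply: measurableT_comp; first exact: measurable_cos.
  apply: measurable_funD => //; exact: measurable_lincomb.
rewrite -(ge0_integral_image P mf)// -(ge0_integral_image P' mf')//.
apply: eq_measure_integral => A mA _; apply: coords_measure_unique => // a th.
have i1 : P.-integrable setT ((fun x : coords R I => (cos (\sum_i a i * x i + th))%:E) \o (fun w i => X i w)).
  apply: (@integrable_bounded _ _ _ _ (fun w => cos (\sum_i a i * X i w + th)) 1).
    by apply/measurable_EFinP; exact: (measurableT_comp (mc a th) mf).
  by move=> x; exact: cos_bounded.
have i2 : P'.-integrable setT ((fun x : coords R I => (cos (\sum_i a i * x i + th))%:E) \o (fun w i => X' i w)).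
  apply: (@integrable_bounded _ _ _ _ (fun w => cos (\sum_i a i * X' i w + th)) 1).
    by apply/measurable_EFinP; exact: (measurableT_comp (mc a th) mf').
  by move=> x; exact: cos_bounded.
by rewrite (integral_image mf (mc a th) i1) (integral_image mf' (mc a th) i2) gX gX'.
Qed.

(** The rows of [A] are orthonormal but need not form a basis: rotations, projections to fewer
    coordinates and relabellings are all instances. The whole content is
    [sum_i (sum_j a_j A_ji)^2 = sum_j a_j^2]. *)
Lemma gaussian_lin d (T : measurableType d) (P : probability T R) (I J : finType)
    (X : I -> T -> R) (A : J -> I -> R) :
  gaussian P X -> (forall j j', \sum_i A j i * A j' i = (j == j')%:R) ->
  gaussian P (fun j w => \sum_i A j i * X i w).
Proof.
move=> [mX gX] oA; split.
  by move=> j; apply: measurable_sum => i; exact: measurable_funM.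
move=> a th.
have E w : \sum_j a j * (\sum_i A j i * X i w) = \sum_i (\sum_j a j * A j i) * X i w.
  under eq_bigr do rewrite mulr_sumr.
  rewrite exchange_big/=; apply: eq_bigr => i _; rewrite mulr_suml.
  by apply: eq_bigr => j _; rewrite mulrA.
under eq_integral do rewrite E.
rewrite gX; suff -> : \sum_i (\sum_j a j * A j i) ^+ 2 = \sum_j a j ^+ 2 by [].
transitivity (\sum_j \sum_j' a j * a j' * \sum_i A j i * A j' i).
  under eq_bigr do rewrite expr2 mulr_suml.
  rewrite exchange_big/=; apply: eq_bigr => j _.
  under eq_bigr do rewrite mulr_sumr.
  rewrite exchange_big/=; apply: eq_bigr => j' _; rewrite mulr_sumr.
  by apply: eq_bigr => i _; ring.
apply: eq_bigr => j _; rewrite (bigD1 j)//= oA eqxx mulr1 big1 ?addr0//.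
by move=> j' /negbTE j'j; rewrite oA eq_sym j'j mulr0.
Qed.

Lemma gaussian_reindex d (T : measurableType d) (P : probability T R) (I J : finType)
    (X : I -> T -> R) (f : J -> I) :
  gaussian P X -> injective f -> gaussian P (fun j => X (f j)).
Proof.
move=> gX fI; have := @gaussian_lin _ _ _ _ J X (fun j i => (f j == i)%:R) gX.
have E : (fun (j : J) (w : T) => \sum_i (f j == i)%:R * X i w) = fun j => X (f j).
  apply/funext => j; apply/funext => w; rewrite (bigD1 (f j))//= eqxx mul1r big1 ?addr0//.
  by move=> i /negbTE; rewrite eq_sym => ->; rewrite mul0r.
rewrite E; apply => j j'; rewrite (bigD1 (f j))//= eqxx mul1r big1 ?addr0.
  by rewrite eq_sym (inj_eq fI).
by move=> i /negbTE; rewrite eq_sym => ->; rewrite mul0r.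
Qed.

Lemma gaussian_sum d d' (T : measurableType d) (T' : measurableType d')
    (P : probability T R) (P' : probability T' R) (I I' : finType)
    (X : I -> T -> R) (X' : I' -> T' -> R) :
  gaussian P X -> gaussian P' X' ->
  gaussian (prod_prob P P')
    (fun (i : I + I') w => match i with inl i => X i w.1 | inr i => X' i w.2 end).
Proof.
move=> [mX gX] [mX' gX']; set Z := fun _ => _.
have mZ i : measurable_fun setT (Z i).
  by rewrite /Z; case: i => i; exact: measurableT_comp.
split => // a th.
have mc : measurable_fun setT (fun w : T * T' => cos (\sum_i a i * Z i w + th)).
  apply: measurableT_comp; first exact: measurable_cos.
  by apply: measurable_funD => //; apply: measurable_sum => i; apply: measurable_funM.
rewrite /prod_prob -integral12_prod_meas1; last first.
  by apply: (@integrable_bounded _ _ _ (prod_prob P P') _ 1) => // w; exact: cos_bounded.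
(* In the inner integral, over [w2], the combination of the first family is constant and joins the
   phase. *)
have E w1 w2 : \sum_i a i * Z i (w1, w2) + th =
   \sum_i a (inr i) * X' i w2 + (\sum_i a (inl i) * X i w1 + th).
  by rewrite big_sumType/= addrA; congr (_ + _); rewrite addrC.
rewrite /fubini_F/=; under eq_integral do under eq_integral do rewrite E.
under eq_integral do rewrite gX' EFinM.
rewrite integralZl//; last first.
  apply: (@integrable_bounded _ _ _ _ (fun w => cos (\sum_i a (inl i) * X i w + th)) 1).
    apply: measurableT_comp; first exact: measurable_cos.
    by apply: measurable_funD => //; apply: measurable_sum => i; apply: measurable_funM.
  by move=> w; exact: cos_bounded.
rewrite gX -EFinM mulrA -expRD; congr (expR _ * _)%:E.
by rewrite big_sumType/= -opprD -mulrDl addrC.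
Qed.

Lemma gaussian_mix d d' (T : measurableType d) (T' : measurableType d')
    (P : probability T R) (P' : probability T' R) (I : finType)
    (X : I -> T -> R) (X' : I -> T' -> R) (D : pred I) :
  gaussian P X -> gaussian P' X' ->
  gaussian (prod_prob P P') (fun i w => if D i then X i w.1 else X' i w.2).
Proof.
move=> gX gX'.
have fI : injective (fun i => if D i then inl i else inr i : I + I).
  by move=> i j; case: (D i); case: (D j) => // -[].
have := gaussian_reindex (gaussian_sum gX gX') fI.
by congr (gaussian _ _); apply/funext => i; case: (D i).
Qed.

(** The substitute for conditioning: coordinates outside [D] are taken from an independent copy
    [w'], after which those in [D] are constants for the inner integral. *)
Lemma gaussian_decouple d (T : measurableType d) (P : probability T R) (I : finType)
    (X : I -> T -> R) (D : pred I) (F : coords R I -> \bar R) :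
  gaussian P X -> measurable_fun setT F -> (forall x, 0 <= F x)%E ->
  (\int[P]_w F (fun i => X i w) =
   \int[P]_w \int[P]_w' F (fun i => if D i then X i w else X i w'))%E.
Proof.
move=> gX mF F0; have gZ := gaussian_mix D gX gX; have [mZ _] := gZ.
rewrite (gaussian_unique gX gZ)// /prod_prob.
have mFZ : measurable_fun setT (fun w : T * T => F (fun i => if D i then X i w.1 else X i w.2)).
  by apply: (measurableT_comp mF); exact: measurable_coords.
by rewrite fubini_tonelli1.
Qed.

Lemma gaussian_normal : gaussian (normal_prob (0 : R) 1) (fun (_ : unit) => id).
Proof.
split=> [_|a th]; first exact: measurable_id.
have S (f : unit -> R) : \sum_i f i = f tt by rewrite (bigD1 tt)//= big1 ?addr0// => -[].
under eq_integral do rewrite S.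
by rewrite normal_cos S.
Qed.

Lemma gaussian_comb d (T : measurableType d) (P : probability T R) (I : finType)
    (X : I -> T -> R) (a : I -> R) (f : R -> \bar R) :
  gaussian P X -> \sum_i a i ^+ 2 = 1 -> measurable_fun setT f -> (forall x, 0 <= f x)%E ->
  (\int[P]_w f (\sum_i a i * X i w)%R = \int[normal_prob (0 : R) 1]_x f x)%E.
Proof.
move=> gX a1 mf f0.
have g1 : gaussian P (fun (_ : unit) w => \sum_i a i * X i w).
  apply: gaussian_lin => // -[] []; rewrite eqxx; transitivity (\sum_i a i ^+ 2).
rewrite -[LHS](gaussian_unique (F := fun x => f (x tt)) gaussian_normal g1)//.
by apply: measurableT_comp => //; exact: measurable_coord.
Qed.

Lemma gaussian_coord d (T : measurableType d) (P : probability T R) (I : finType)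
    (X : I -> T -> R) i (f : R -> \bar R) :
  gaussian P X -> measurable_fun setT f -> (forall x, 0 <= f x)%E ->
  (\int[P]_w f (X i w) = \int[normal_prob (0 : R) 1]_x f x)%E.
Proof.
move=> gX mf f0.
rewrite -(gaussian_comb (a := fun j => (i == j)%:R) gX)//; last first.
  rewrite (bigD1 i)//= eqxx expr1n big1 ?addr0// => j /negbTE.
  by rewrite eq_sym => ->; rewrite expr0n.
apply: eq_integral => w _; rewrite (bigD1 i)//= eqxx mul1r big1 ?addr0// => j /negbTE.
by rewrite eq_sym => ->; rewrite mul0r.
Qed.

(** Each coordinate of the list is decoupled in turn from the following ones; [uniq s] ensures that
    it does not occur among them. *)
Lemma gaussian_prod d (T : measurableType d) (P : probability T R) (I : finType)
    (X : I -> T -> R) (s : seq I) (f : I -> R -> R) :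
  gaussian P X -> uniq s ->
  (forall i, measurable_fun setT (f i)) -> (forall i x, 0 <= f i x) ->
  (\int[P]_w (\prod_(i <- s) f i (X i w))%:E =
   \prod_(i <- s) \int[normal_prob (0 : R) 1]_x (f i x)%:E)%E.
Proof.
move=> gX + mf f0; elim: s => [_|i s IH /= /andP[is_ us]].
  under eq_integral do rewrite big_nil.
  by rewrite big_nil integral_cst//= mul1e probability_setT.
rewrite big_cons -IH//.
have mfX (s' : seq I) : measurable_fun setT (fun x : coords R I => \prod_(j <- s') f j (x j)).
  by apply: measurable_prod => j _; apply: measurableT_comp => //; exact: measurable_coord.
pose F (x : coords R I) := (\prod_(j <- i :: s) f j (x j))%:E.
rewrite -[LHS]/(\int[P]_w F (fun i => X i w))%E.
rewrite (gaussian_decouple (pred1 i) gX); last 2 first.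
- by apply/measurable_EFinP; exact: mfX.
- by move=> x; rewrite lee_fin prodr_ge0.
have E w w' : F (fun j => if pred1 i j then X j w else X j w') =
  ((f i (X i w))%:E * (\prod_(j <- s) f j (X j w'))%:E)%E.
  rewrite /F big_cons/= eqxx EFinM; congr (_ * _%:E)%E.
  by apply: eq_big_seq => j js; case: eqP => // ji; rewrite -ji js in is_.
under eq_integral do under eq_integral do rewrite E.
have [mX _] := gX.
have m1 : measurable_fun setT (fun w => (\prod_(j <- s) f j (X j w))%:E).
  by apply/measurable_EFinP; apply: measurable_prod => j _; apply: measurableT_comp.
have p0 w : (0 <= (\prod_(j <- s) f j (X j w))%:E)%E by rewrite lee_fin prodr_ge0.
under eq_integral do rewrite ge0_integralZl_EFin//.
rewrite ge0_integralZr//.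
- congr (_ * _)%E; rewrite (gaussian_coord i (f := fun x => (f i x)%:E) gX)//.
  exact/measurable_EFinP.
  by move=> x; rewrite lee_fin.
- by apply/measurable_EFinP; apply: measurableT_comp.
- by move=> w _; rewrite lee_fin.
- exact: integral_ge0.
Qed.

End gaussian_family.

(** * Norms of Gaussian vectors *)

Section density_prob.
Context d (T : measurableType d) (R : realType).
Variables (mu : {measure set T -> \bar R}) (g : T -> R).
Hypotheses (mg : measurable_fun setT g) (g0 : forall x, 0 <= g x).
Hypothesis g1 : (\int[mu]_x (g x)%:E = 1)%E.

(** As in [image_prob], the vacuous [let] keeps the hypotheses on [g] among the parameters. *)
Definition density_prob (A : set T) : \bar R :=
  let _ := (mg, g0, g1) in (\int[mu]_(x in A) (g x)%:E)%E.

Let density_prob0 : density_prob set0 = 0%E.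
Proof. by rewrite /density_prob integral_set0. Qed.

Let density_prob_ge0 A : (0 <= density_prob A)%E.
Proof. by apply: integral_ge0 => x _; rewrite lee_fin. Qed.

Let density_prob_sigma : semi_sigma_additive density_prob.
Proof.
move=> /= F mF tF mUF; rewrite /density_prob ge0_integral_bigcup//=.
- by apply: is_cvg_nneseries => n _ _; apply: integral_ge0 => x _; rewrite lee_fin.
- by apply/measurable_EFinP; exact: measurable_funTS.
- by move=> x _; rewrite lee_fin.
Qed.

HB.instance Definition _ := isMeasure.Build _ _ _ density_prob
  density_prob0 density_prob_ge0 density_prob_sigma.

HB.instance Definition _ := Measure_isProbability.Build _ _ _ density_prob g1.

Lemma ge0_integral_density_prob (f : T -> \bar R) :
  measurable_fun setT f -> (forall x, 0 <= f x)%E ->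
  (\int[density_prob]_x f x = \int[mu]_x (f x * (g x)%:E))%E.
Proof. by move=> mf f0; exact: ge0_integral_density. Qed.

End density_prob.

Section laplace_unique.
Context (R : realType).

(** Natural exponents add up under multiplication, so this is an algebra of bounded functions; all
    of them are even. *)
Inductive gausspoly : (R -> R) -> Prop :=
| gausspoly_base c n : gausspoly (fun x => c * expR (- (n%:R * x ^+ 2)))
| gausspoly_add f g : gausspoly f -> gausspoly g -> gausspoly (f \+ g).

Lemma gausspoly_mul f g : gausspoly f -> gausspoly g -> gausspoly (f \* g).
Proof.
move=> cf; elim: cf g => [c n|f1 f2 _ IH1 _ IH2] g cg; last first.
  rewrite (_ : _ \* g = (f1 \* g) \+ (f2 \* g)).
    by apply: gausspoly_add; [exact: IH1|exact: IH2].
  by apply/funext => x /=; rewrite mulrDl.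
elim: cg => [c' n'|g1 g2 _ IH1 _ IH2]; last first.
  rewrite (_ : _ \* (_ \+ _) = ((fun x : R => c * expR (- (n%:R * x ^+ 2))) \* g1) \+
    ((fun x : R => c * expR (- (n%:R * x ^+ 2))) \* g2)).
    exact: gausspoly_add.
  by apply/funext => x /=; rewrite mulrDr.
rewrite (_ : _ \* _ = (fun x : R => (c * c') * expR (- ((n + n')%N%:R * x ^+ 2)))).
  exact: gausspoly_base.
by apply/funext => x /=; rewrite mulrACA -expRD natrD mulrDl opprD.
Qed.

Lemma bounded_gausspoly f : gausspoly f -> exists M, forall x, `|f x| <= M.
Proof.
elim=> [c n|g h _ [M gM] _ [N hN]].
  exists `|c| => x; rewrite normrM ler_piMr// ger0_norm ?expR_ge0//.
  by rewrite -[leRHS]expR0 ler_expR oppr_le0 mulr_ge0// sqr_ge0.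
by exists (M + N) => x; rewrite (le_trans (ler_normD _ _))// lerD.
Qed.

Lemma measurable_gausspoly f : gausspoly f -> measurable_fun setT f.
Proof.
elim=> [c n|g h _ mg _ mh]; last exact: measurable_funD.
apply: measurable_funM => //; apply: measurableT_comp => //.
by apply: measurable_funN; apply: measurable_funM => //; exact: measurable_funX.
Qed.

(** By [lap] the two laws give the same integrals to the functions of [gausspoly]. Since these are
    even, the conclusion reaches only functions of the absolute value. *)
Lemma laplace_unique d d' (T : measurableType d) (T' : measurableType d')
    (P : probability T R) (P' : probability T' R) (Z : T -> R) (Z' : T' -> R) (F : R -> \bar R) :
  measurable_fun setT Z -> measurable_fun setT Z' ->
  (forall n : nat, \int[P]_w (expR (- (n%:R * Z w ^+ 2)))%:E =
     \int[P']_w (expR (- (n%:R * Z' w ^+ 2)))%:E)%E ->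
  measurable_fun setT F -> (forall x, 0 <= F x)%E ->
  (\int[P]_w F `|Z w|%R = \int[P']_w F `|Z' w|%R)%E.
Proof.
move=> mZ mZ' lap mF F0.
set G : set (set R) := [set S | exists2 f, gausspoly f & exists c, S = [set x | f x < c]].
(* The real line with the sigma-algebra generated by the algebra, which consists of symmetric Borel
   sets. *)
pose U := g_sigma_algebraType G.
have GE f c : [set x : R | f x < c] = f @^-1` `]-oo, c[.
  by apply/seteqP; split => x /=; rewrite in_itv.
have mU d1 (T1 : measurableType d1) (Y : T1 -> R) : measurable_fun setT Y ->
    measurable_fun setT (Y : T1 -> U).
  move=> mY; apply: (@measurability _ _ T1 U setT Y G) => // _ [_ [f cf [c ->]] <-].
  by rewrite GE -comp_preimage; exact: (measurableT_comp (measurable_gausspoly cf) mY).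
have mf f : gausspoly f -> measurable_fun setT (f : U -> R).
  move=> cf; apply: (measurability _ (RGenInftyO.measurableE R)) => // _ [_ [c ->] <-].
  by rewrite setTI -GE; apply: sub_sigma_algebra; exists f => //; exists c.
have mabs : measurable_fun setT (fun x : U => `|x : R| : R).
  have mg : measurable_fun setT (fun x : U => expR (- (x ^+ 2 : R)) : R).
    have := mf _ (gausspoly_base 1 1); congr measurable_fun.
    by apply/funext => x; rewrite !mul1r.
  (* [|x|] is a Borel function of [exp (-x^2)], which is measurable for the coarse sigma-algebra by
     construction. *)
  have -> : (fun x : U => `|x : R| : R) = (fun x : U => (- ln (expR (- (x ^+ 2 : R)))) `^ 2^-1).
    apply/funext => x; rewrite expRK opprK powR12_sqrt ?sqr_ge0//.
    by rewrite sqrtr_sqr.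
  have ml : measurable_fun setT (fun x : R => (- ln x) `^ 2^-1).
    apply: (measurableT_comp (measurable_powR 2^-1)).
    by apply: measurable_funN; exact: measurable_ln.
  exact: (measurableT_comp ml mg).
have mFa : measurable_fun setT (fun x : U => F `|x : R|) by exact: (measurableT_comp mF mabs).
rewrite -(ge0_integral_image P (mU _ _ _ mZ) mFa)//.
rewrite -(ge0_integral_image P' (mU _ _ _ mZ') mFa)//.
apply: eq_measure_integral.
move=> A mA _; apply: (@algebra_measure_unique _ U R _ _ gausspoly) => //.
- exact: bounded_gausspoly.
- move=> c; have := gausspoly_base c 0; congr gausspoly; apply/funext => x.
  by rewrite mul0r oppr0 expR0 mulr1.
- exact: gausspoly_add.
- exact: gausspoly_mul.
- move=> f; have int (m : probability U R) g : gausspoly g -> m.-integrable setT (EFin \o g).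
    move=> cg; have [M gM] := bounded_gausspoly cg.
    exact: (@integrable_bounded _ _ _ m g M (mf _ cg) gM).
  elim=> [c n|g h cg IHg ch IHh].
    have cb : gausspoly (fun x => expR (- (n%:R * x ^+ 2))).
      have := gausspoly_base 1 n; congr gausspoly; apply/funext => x; exact: mul1r.
    under eq_integral do rewrite EFinM.
    under [RHS]eq_integral do rewrite EFinM.
    rewrite !integralZl//; [|exact: int|exact: int].
    have me : measurable_fun setT (fun x : U => (expR (- (n%:R * x ^+ 2)))%:E).
      by apply/measurable_EFinP; exact: mf.
    have e0 (x : U) : (0 <= (expR (- (n%:R * (x : R) ^+ 2)))%:E)%E by rewrite lee_fin expR_ge0.
    by rewrite (ge0_integral_image P (mU _ _ _ mZ) me)// (ge0_integral_image P' (mU _ _ _ mZ') me)// lap.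
  under eq_integral do rewrite EFinD.
  under [RHS]eq_integral do rewrite EFinD.
  by rewrite !integralD_EFin//; [rewrite IHg IHh|exact: int..].
Qed.

End laplace_unique.

Section chi_law.
Context {R : realType}.
Notation mu := (@lebesgue_measure R).

(** The index is the power of [x]: there are [q + 1] degrees of freedom. *)
Definition chi_density q (x : R) : R := (0 <= x)%R%:R * (gpow q 1 x / gmo q).

Lemma chi_density_ge0 q x : 0 <= chi_density q x.
Proof.
rewrite /chi_density; have [x0|x0] := boolP (0 <= x); last by rewrite mul0r.
by rewrite mul1r divr_ge0 ?gpow_ge0 ?(ltW (gmo_gt0 _)).
Qed.

Lemma measurable_chi_density q : measurable_fun setT (chi_density q).
Proof.
apply: measurable_funM; last by apply: measurable_funM => //; exact: measurable_gpow.
rewrite (_ : (fun x : R => _) = \1_(`[0, +oo[%classic : set R)).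
  exact: measurable_indic.
by apply/funext => x; rewrite indicE; congr (_%:R); rewrite mem_setE/= in_itv/= andbT.
Qed.

Lemma chi_densityE q (f : R -> \bar R) :
  (\int[mu]_x (f x * (chi_density q x)%:E) =
   \int[mu]_(x in `[0%R, +oo[) (f x * (gpow q 1 x / gmo q)%:E))%E.
Proof.
rewrite [RHS]integral_mkcond; apply: eq_integral => x _.
rewrite patchE /chi_density mem_setE/= in_itv/= andbT.
by case: (0 <= x); rewrite ?mul1r// mul0r mule0.
Qed.

Lemma chi_density1 q : (\int[mu]_x (chi_density q x)%:E = 1)%E.
Proof.
have := chi_densityE q (cst 1%E).
under eq_integral do rewrite mul1e.
move=> ->.
under eq_integral do rewrite mul1e mulrC EFinM.
rewrite ge0_integralZl_EFin//.
- by rewrite -/(gmom q) gmomE -EFinM mulVf// lt0r_neq0// gmo_gt0.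
- by move=> x /=; rewrite in_itv/= andbT => x0; rewrite lee_fin gpow_ge0.
- by apply/measurable_EFinP; apply: measurable_funTS; exact: measurable_gpow.
- by rewrite invr_ge0 (ltW (gmo_gt0 _)).
Qed.

Definition chi_prob q := @density_prob _ (measurableTypeR R) R mu (chi_density q)
  (measurable_chi_density q) (chi_density_ge0 q) (chi_density1 q).

Lemma ge0_integral_chi q (f : R -> \bar R) : measurable_fun setT f -> (forall x, 0 <= f x)%E ->
  (\int[chi_prob q]_x f x =
   \int[mu]_(x in `[0%R, +oo[) (f x * (gpow q 1 x / gmo q)%:E))%E.
Proof.
by move=> mf f0; rewrite ge0_integral_density_prob// chi_densityE.
Qed.

(** Laplace transforms replace polar coordinates: that of the squared norm at [n] is
    [(1 + 2n)^(-(q+1)/2)] for both laws, by factorisation over the coordinates for the Gaussian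
    vector and by scaling for the chi density. *)
Lemma radial_law d (T : measurableType d) (P : probability T R) (I : finType)
    (X : I -> T -> R) q (f : R -> \bar R) :
  gaussian P X -> #|I| = q.+1 -> measurable_fun setT f -> (forall x, 0 <= f x)%E ->
  (\int[P]_w f (Num.sqrt (\sum_i X i w ^+ 2)) =
   \int[mu]_(x in `[0%R, +oo[) (f x * (gpow q 1 x / gmo q)%:E))%E.
Proof.
move=> gX Iq mf f0; have [mX _] := gX.
have mS : measurable_fun setT (fun w => Num.sqrt (\sum_i X i w ^+ 2)).
  rewrite (_ : (fun w => _) = (fun w => (\sum_i X i w ^+ 2) `^ 2^-1)).
    apply: (measurableT_comp (measurable_powR 2^-1)).
    by apply: measurable_sum => i; exact: measurable_funX.
  by apply/funext => w; rewrite powR12_sqrt// sumr_ge0// => i _; rewrite sqr_ge0.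
have mfa : measurable_fun setT (fun x : R => f `|x|) by exact: (measurableT_comp mf).
transitivity (\int[P]_w f `|Num.sqrt (\sum_i X i w ^+ 2)|%R)%E.
  by apply: eq_integral => w _; rewrite ger0_norm ?sqrtr_ge0.
transitivity (\int[chi_prob q]_x f `|x|%R)%E; last first.
  rewrite ge0_integral_chi//; apply: eq_integral => x.
  by rewrite inE/= in_itv/= andbT => x0; rewrite ger0_norm.
apply: laplace_unique => // n.
have c0 : 0 < 1 + 2 * n%:R :> R by rewrite ltr_wpDr// mulr_ge0.
transitivity ((Num.sqrt (1 + 2 * n%:R : R)) ^- q.+1)%:E.
  have E w : expR (- (n%:R * Num.sqrt (\sum_i X i w ^+ 2) ^+ 2)) =
      \prod_(i <- index_enum I) expR (- n%:R * X i w ^+ 2).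
    rewrite sqr_sqrtr; last by apply: sumr_ge0 => i _; rewrite sqr_ge0.
    by rewrite -mulNr mulr_sumr expR_sum.
  under eq_integral do rewrite E.
  rewrite (gaussian_prod (f := fun _ x => expR (- n%:R * x ^+ 2)) gX)//.
  - rewrite normal_expR_sqr; last first.
      by rewrite (@le_lt_trans _ _ 0)// ?oppr_le0// invr_gt0.
    have -> c : (\prod_(i : I) c = iter q.+1 ( *%E c) 1)%E by rewrite -Iq -big_const.
    by rewrite mulrN opprK -exprVn; elim: q.+1 => //= k ->; rewrite -EFinM exprS.
  - exact: index_enum_uniq.
  - by move=> i; apply: measurableT_comp => //; apply: measurable_funM.
rewrite ge0_integral_chi//.
- under eq_integral => x _.
    have -> : ((expR (- (n%:R * x ^+ 2)))%:E * (gpow q 1 x / gmo q)%:E =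
      (gmo q)^-1%:E * (gpow q (1 + 2 * n%:R) x)%:E)%E.
      rewrite -!EFinM /gpow.
      have -> : expR (- ((1 + 2 * n%:R) * (x ^+ 2 / 2))) =
          expR (- (n%:R * x ^+ 2)) * expR (- (1 * (x ^+ 2 / 2))) :> R.
        by rewrite -expRD; congr expR; lra.
      by congr EFin; ring.
    over.
  rewrite ge0_integralZl_EFin//.
  + rewrite gmom_scale// -EFinM mulrCA mulVf ?mulr1//.
    by rewrite lt0r_neq0// gmo_gt0.
  + by move=> x /=; rewrite in_itv/= andbT => x0; rewrite lee_fin gpow_ge0.
  + by apply/measurable_EFinP; apply: measurable_funTS; exact: measurable_gpow.
  + by rewrite invr_ge0 (ltW (gmo_gt0 _)).
- apply/measurable_EFinP; apply: measurableT_comp => //; apply: measurable_funN.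
  by apply: measurable_funM => //; exact: measurable_funX.
Qed.

Lemma measurable_inv : measurable_fun setT (fun x : R => x^-1).
Proof.
(* The inverse through a power of a nonnegative argument: the factor [x] restores the sign and the
   value 0 at 0. *)
have -> : (fun x : R => x^-1) = fun x => (x ^+ 2) `^ (-1) * x.
  apply/funext => x; have [->|x0] := eqVneq x 0; first by rewrite invr0 mulr0.
  by rewrite powR_inv1 ?sqr_ge0// expr2 invfM -mulrA mulVf ?mulr1.
apply: measurable_funM => //; apply: (measurableT_comp (measurable_powR (-1))).
exact: measurable_funX.
Qed.

(** The probability, up to the factor [gmo q], that a chi variable is at most [rho]; the exponential
    is bounded by 1. *)
Lemma gpow_cut q (rho : R) : 0 < rho ->
  (\int[mu]_(x in `[0%R, +oo[) ((x <= rho)%R%:R * gpow q 1 x)%:E <= (rho ^+ q.+1 / q.+1%:R)%:E)%E.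
Proof.
move=> r0.
have dF (x : R) : is_derive x 1 (fun x : R => x ^+ q.+1 / q.+1%:R) (x ^+ q).
  have dX : is_derive x 1 (fun x : R => x ^+ q.+1) (q.+1%:R * x ^+ q).
    by split; [exact: exprn_derivable|rewrite exp_derive /GRing.scale /= mulr1].
  apply: is_derive_eq; rewrite /GRing.scale /= ?mulr0 ?add0r ?addr0.
  by rewrite mulrA mulVf ?mul1r// pnatr_eq0.
have := FTC_itv r0 dF (@exprn_continuous R q).
rewrite expr0n/= mul0r subr0 => <-.
rewrite integral_mkcond [leRHS]integral_mkcond; apply: ge0_le_integral => //.
- move=> x _; rewrite patchE mem_setE/= in_itv/= andbT; case: ifPn => x0//.
  by rewrite lee_fin mulr_ge0 ?gpow_ge0.
- apply: (iffLR (measurable_restrictT _ _)) => //; apply: measurable_funTS.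
  apply/measurable_EFinP; apply: measurable_funM; last exact: measurable_gpow.
  rewrite (_ : (fun x : R => _) = \1_(`]-oo, rho]%classic : set R)).
    exact: measurable_indic.
  by apply/funext => x; rewrite indicE; congr (_%:R); rewrite mem_setE/= in_itv.
- apply: (iffLR (measurable_restrictT _ _)) => //; apply: measurable_funTS.
  by apply/measurable_EFinP; exact: measurable_funX.
- move=> x _; rewrite !patchE !mem_setE/= !in_itv/= andbT.
  case: (0 <= x) / idP => x0 //=; case: (x <= rho); rewrite ?mul0r// mul1r lee_fin.
  rewrite ler_piMr ?exprn_ge0// -[leRHS]expR0 ler_expR oppr_le0 mul1r.
  by rewrite divr_ge0// sqr_ge0.
Qed.

End chi_law.

(** * Numerical estimates of the chi normalising constants *)

Section moment_bounds.
Context {R : realType}.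
Notation mu := (@lebesgue_measure R).

(** [2 s x <= x^2 + s^2] is integrated against [gpow q 1]; with [s^2 = q + 1] the recursion makes
    the two terms on the right equal. *)
Lemma gmo_ratio1 q : gmo q.+1 <= Num.sqrt q.+1%:R * gmo q :> R.
Proof.
pose s : R := Num.sqrt q.+1%:R.
have s0 : 0 < s by rewrite sqrtr_gt0 ltr0n.
have s2 : s ^+ 2 = q.+1%:R by rewrite sqr_sqrtr ?ler0n.
have : ((2 * s)%:E * gmom q.+1 <= gmom q.+2 + (s ^+ 2)%:E * gmom q)%E.
  have mg n : measurable_fun (`[0%R, +oo[%classic : set R) (fun x : R => (gpow n 1 x)%:E).
    by apply: measurable_funTS; apply/measurable_EFinP; exact: measurable_gpow.
  have g0 n (x : R) : (`[0%R, +oo[%classic : set R) x -> (0 <= (gpow n 1 x)%:E)%E.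
    by rewrite /= in_itv/= andbT => x0; rewrite lee_fin gpow_ge0.
  rewrite /gmom -!ge0_integralZl_EFin//; do ?[exact: mg|exact: g0|exact: sqr_ge0|by rewrite mulr_ge0// ltW].
  rewrite -ge0_integralD//; do ?[exact: mg|exact: g0|by apply: measurable_funeM; exact: mg].
  - apply: ge0_le_integral => //.
    + by move=> x x0; rewrite mule_ge0 ?g0// lee_fin mulr_ge0// ltW.
    + by apply: measurable_funeM; exact: mg.
    + by apply: emeasurable_funD; [exact: mg|apply: measurable_funeM; exact: mg].
    + move=> x /=; rewrite in_itv/= andbT => x0.
      rewrite -!EFinM -EFinD lee_fin.
      have -> : gpow q.+2 1 x + s ^+ 2 * gpow q 1 x = (x ^+ 2 + s ^+ 2) * gpow q 1 x.
        by rewrite /gpow !exprS; ring.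
      have -> : 2 * s * gpow q.+1 1 x = (2 * s * x) * gpow q 1 x.
        by rewrite /gpow !exprS; ring.
      rewrite ler_wpM2r ?gpow_ge0//.
      by have := sqr_ge0 (x - s); nra.
  - by move=> x x0; rewrite mule_ge0 ?g0// lee_fin sqr_ge0.
rewrite !gmomE -!EFinM -EFinD lee_fin gmoS s2.
have -> : q.+1%:R * gmo q + q.+1%:R * gmo q = 2 * s * (s * gmo q) :> R by rewrite -s2; ring.
by rewrite ler_pM2l// mulr_gt0.
Qed.

(** [gmo (q + m) / gmo q] is the moment of order [m] of the norm of a Gaussian vector in dimension
    [q + 1]; it is needed for [m = p + 1]. *)
Lemma gmo_ratio q m : gmo (q + m) <= (Num.sqrt (q + m)%:R) ^+ m * gmo q :> R.
Proof.
elim: m => [|m IH]; first by rewrite addn0 expr0 mul1r.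
rewrite addnS exprS -mulrA; apply: le_trans (gmo_ratio1 _) _.
rewrite ler_wpM2l ?sqrtr_ge0//; apply: le_trans IH _.
rewrite ler_wpM2r ?(ltW (gmo_gt0 _))//.
by rewrite lerXn2r ?nnegrE ?sqrtr_ge0// ler_sqrt ?ler0n// ler_nat.
Qed.

Lemma sinh_ge (t : R) : 0 <= t -> 2 * t <= expR t - expR (- t).
Proof.
move=> t0; rewrite expRN.
have := expR_ge_series 3 t0; rewrite /series/= !big_nat_recr//= big_geq// /exp_coeff/=.
rewrite expr0 expr1 !factS fact0 add0r => h.
have {h} : 1 + t + t ^+ 2 / 2 <= expR t by lra.
move: (expR_gt0 t); move: (expR t) => z z0 h.
rewrite -subr_ge0 -(pmulr_rge0 _ z0).
have -> : z * (z - z^-1 - 2 * t) = (z - t) ^+ 2 - (1 + t ^+ 2).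
  by field; rewrite lt0r_neq0.
have : 1 + t ^+ 2 / 2 <= z - t by lra.
move: (z - t) => y hy; nra.
Qed.

(** The error is of third order at [y = 1]. In the inductions below [y] is [(m + 2) / m] with
    [m = p + 1], and the second-order loss of [ln y <= y - 1] would be too much. *)
Lemma ln_le_half (y : R) : 1 <= y -> ln y <= (y - y^-1) / 2.
Proof.
move=> y1; have y0 : 0 < y by lra.
have := sinh_ge (ln_ge0 y1); rewrite expRN lnK//; lra.
Qed.

Lemma sqrtX_le (y : R) n : 1 <= y -> Num.sqrt y ^+ n <= expR (n%:R / 4 * (y - y^-1)).
Proof.
move=> y1; have y0 : 0 < y by lra.
have -> : Num.sqrt y = expR (ln y / 2).
  apply/eqP; rewrite -(@eqrXn2 _ 2)// ?sqrtr_ge0 ?expR_ge0//.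
  rewrite sqr_sqrtr ?ltW// -expRM_natl.
  have -> : 2%:R * (ln y / 2) = ln y by field.
  by rewrite lnK.
rewrite -expRM_natl ler_expR; have := ln_le_half y1; have := ler0n R n.
by move: (n%:R : R) (ln y) (y - y^-1) => N l z; nra.
Qed.

Lemma expR1_ge : 27 / 10 <= expR 1 :> R.
Proof.
have := @expR_ge_series R 1 5 ler01; rewrite /series/= !big_nat_recr//= big_geq// /exp_coeff/=.
by rewrite !expr1n !factS fact0 add0r; lra.
Qed.

Lemma expR_half_ge : 8 / 5 <= expR (2^-1) :> R.
Proof.
have h0 : 0 <= 2^-1 :> R by rewrite invr_ge0.
have := @expR_ge_series R 2^-1 3 h0; rewrite /series/= !big_nat_recr//= big_geq// /exp_coeff/=.
by rewrite expr0 expr1 expr2 !factS fact0 add0r; lra.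
Qed.

(** [36/35 = 1 + 1/(5.7)], that is [1 + 1/35], is the largest exponent met in the induction of
    [gmo_ge_pow], at [p = 4]. The bound comes from [exp (4/35) <= 35/31] raised to the power 9. *)
Lemma expR_le3 (x : R) : x <= 36 / 35 -> expR x <= 3.
Proof.
move=> hx; apply: le_trans (_ : expR (36 / 35) <= _); first by rewrite ler_expR.
have -> : 36 / 35 = 9%:R * (4 / 35) :> R by field.
rewrite expRM_natl.
have h : expR (4 / 35) * 31 <= 35 :> R.
  have h1 : 31 / 35 <= expR (- (4 / 35)) :> R.
    by have := @expR_ge1Dx R (- (4 / 35)); lra.
  have h2 : expR (4 / 35) * expR (- (4 / 35)) = 1 :> R by rewrite expRN mulfV// lt0r_neq0// expR_gt0.
  have := ler_wpM2l (expR_ge0 (4 / 35 : R)) h1; rewrite h2; lra.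
move: (expR_gt0 (4 / 35 : R)) h; move: (expR _) => z z0 h.
have h2 : (z * z) * 40 <= 51 by nra.
have h3 : (z ^+ 3) * 25 <= 36 by rewrite !exprS expr0 mulr1; nra.
have z3 : 0 < z ^+ 3 by rewrite exprn_gt0.
rewrite (exprM z 3 3); move: (z ^+ 3) z3 h3 => y y0 h3.
have h4 : (y * y) * 12 <= 25 by nra.
by rewrite !exprS expr0 mulr1; nra.
Qed.

Lemma gmo0_le : gmo 0 <= Num.sqrt 2 :> R.
Proof.
rewrite -(@ler_pXn2r _ 2) ?nnegrE ?sqrtr_ge0 ?(ltW (gmo_gt0 _))//.
rewrite sqr_gmo0 sqr_sqrtr//; exact/ltW/pihalf_lt2.
Qed.

Lemma nat_ind2 (Q : nat -> Prop) n0 : Q n0 -> Q n0.+1 ->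
  (forall n, (n0 <= n)%N -> Q n -> Q n.+2) -> forall n, (n0 <= n)%N -> Q n.
Proof.
move=> Q0 Q1 QS n /subnK <-; suff : forall j, Q (j + n0)%N /\ Q (j + n0).+1 by move=> /(_ (n - n0)%N)[].
by elim=> [|j [IH1 IH2]]; split => //; apply: QS => //; rewrite leq_addl.
Qed.

(** [gmo 0 / gmo p] is the moment of order [-p] of a chi variable with [p + 1] degrees of freedom.
    In a step of the induction the right side gains the factor [p + 1], the left side [(p + 1) / 3]
    times a power that [expR_le3] bounds by 3. *)
Lemma gmo_ge_pow p : (4 <= p)%N -> gmo 0 * Num.sqrt (p.+1%:R / 3) ^+ p <= gmo p :> R.
Proof.
move: p; apply: nat_ind2.
- rewrite !gmoS (exprM _ 2 2) sqr_sqrtr ?divr_ge0//.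
  by have := gmo_gt0 (R:=R) 0; move: (gmo 0) => g g0; nra.
- have -> : 6 / 3 = 2 :> R by field.
  rewrite !gmoS gmo1 (_ : 5 = (2 * 2).+1)%N// exprS exprM sqr_sqrtr//.
  have := gmo0_le; have := gmo_gt0 (R:=R) 0; have := @sqr_sqrtr R 2 (ler0n _ _).
  by move: (gmo 0) (Num.sqrt 2) => g s s2 g0 gs; nra.
move=> p p4 IH; rewrite gmoS.
have p1 : (5 : R) <= p.+1%:R by rewrite ler_nat.
have p0 : 0 < p.+1%:R :> R by rewrite ltr0n.
pose y : R := p.+3%:R / p.+1%:R.
have pE : p.+3%:R = p.+1%:R + 2 :> R by rewrite -!natr1; lra.
have y1 : 1 <= y by rewrite /y ler_pdivlMr// pE; lra.
have -> : p.+3%:R / 3 = y * (p.+1%:R / 3) :> R by rewrite /y; field; rewrite lt0r_neq0.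
rewrite sqrtrM ?(le_trans ler01)// exprMn.
have -> : Num.sqrt (p.+1%:R / 3) ^+ p.+2 = Num.sqrt (p.+1%:R / 3) ^+ p * (p.+1%:R / 3) :> R.
  by rewrite -[p.+2]addn2 exprD sqr_sqrtr// divr_ge0// ltW.
have h : Num.sqrt y ^+ p.+2 <= 3.
  apply: le_trans (sqrtX_le _ y1) _; apply: expR_le3.
  have -> : p.+2%:R / 4 * (y - y^-1) = 1 + (p.+1%:R * p.+3%:R)^-1 :> R.
    have -> : p.+2%:R = p.+1%:R + 1 :> R by rewrite -!natr1.
    rewrite /y pE; field; rewrite !lt0r_neq0//; lra.
  rewrite (_ : 36 / 35 = 1 + 35^-1)//; last by field.
  by rewrite lerD2l lef_pV2 ?posrE//; rewrite pE; nra.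
apply: le_trans (_ : p.+1%:R * (gmo 0 * Num.sqrt (p.+1%:R / 3) ^+ p) <= _).
  have := gmo_gt0 (R:=R) 0.
  have := exprn_ge0 p (sqrtr_ge0 (p.+1%:R / 3 : R)).
  move: (_ ^+ p) (gmo 0) (Num.sqrt y ^+ p.+2) h => A g B hB A0 g0.
  have -> : g * (B * (A * (p.+1%:R / 3))) = p.+1%:R * (g * A) * (B / 3) by field.
  rewrite -[leRHS]mulr1 ler_wpM2l//; last by lra.
  by rewrite mulr_ge0 ?(ltW p0)// mulr_ge0// ltW.
by rewrite ler_wpM2l// ltW.
Qed.

(** A bound of Stirling type. The factor [(p + 2) / (p + 1)] is there to match the factor
    [sqrt m / (1 + m)], [m = p + 1], that [normal_tail] contributes to [small_ball_tradeoff]. *)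
Lemma gmo_ge_exp p : (4 <= p)%N ->
  gmo 0 * (p.+2%:R / p.+1%:R) * Num.sqrt p.+1%:R ^+ p * expR (- (p.+1%:R / 2)) <= gmo p :> R.
Proof.
move: p; apply: nat_ind2.
- rewrite !gmoS (exprM _ 2 2) sqr_sqrtr// expRN.
  have e10 : 10 <= expR (5 / 2) :> R.
    have -> : 5 / 2 = 1 + 1 + 2^-1 :> R by field.
    rewrite !expRD; have := expR1_ge; have := expR_half_ge.
    move: (expR 1) (expR _) => a b hb ha; have h2 : 7 <= a * a by nra.
    by nra.
  have e0 : 0 < expR (5 / 2) :> R by exact: expR_gt0.
  rewrite ler_pdivrMr//; have := gmo_gt0 (R:=R) 0.
  by move: (gmo 0) (expR _) e10 e0 => g E E10 E0 g0; nra.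
- have e18 : 19 <= expR 3 :> R.
    have -> : 3 = 1 + 1 + 1 :> R by field.
    rewrite !expRD; have := expR1_ge.
    move: (expR 1) => a ha; have h2 : 36 / 5 <= a * a by nra.
    by nra.
  have -> : 6 / 2 = 3 :> R by field.
  rewrite !gmoS gmo1 (_ : 5 = (2 * 2).+1)%N// exprS exprM sqr_sqrtr// expRN.
  have e0 : 0 < expR 3 :> R by exact: expR_gt0.
  rewrite ler_pdivrMr//.
  have h : gmo 0 * Num.sqrt 6 <= 7 / 2 :> R.
    rewrite -(@ler_pXn2r _ 2) ?nnegrE//; last by rewrite mulr_ge0 ?sqrtr_ge0 ?(ltW (gmo_gt0 _)).
    rewrite exprMn sqr_gmo0 sqr_sqrtr//.
    by have := pihalf_lt2 R; lra.
  move: (gmo 0) (Num.sqrt 6) (expR 3) e18 e0 h => g s E E19 E0 h.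
  have -> : g * (7 / 6) * (s * 6 ^+ 2) = (g * s) * 42 by field.
  by move: (g * s) h => x; lra.
move=> p p4 IH; rewrite gmoS.
set m : R := p.+1%:R in IH *.
have m5 : 5 <= m by rewrite /m ler_nat.
have m0 : 0 < m by lra.
have -> : p.+4%:R = m + 3 :> R by rewrite /m -!natr1; lra.
have -> : p.+3%:R = m + 2 :> R by rewrite /m -!natr1; lra.
have p2E : p.+2%:R = m + 1 :> R by rewrite /m -!natr1.
rewrite p2E in IH.
pose y : R := (m + 2) / m.
have y1 : 1 <= y by rewrite /y ler_pdivlMr//; lra.
have m2E : m + 2 = y * m by rewrite /y; field; rewrite lt0r_neq0.
have -> : Num.sqrt (m + 2) ^+ p.+2 = Num.sqrt y ^+ p * Num.sqrt m ^+ p * (m + 2).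
  rewrite -[p.+2]addn2 exprD sqr_sqrtr; last by lra.
  by rewrite m2E sqrtrM ?exprMn//; lra.
have -> : expR (- ((m + 2) / 2)) = expR (- (m / 2)) * (expR 1)^-1.
  by rewrite -expRN -expRD; congr expR; field.
pose y2 : R := (m + 3) / (m + 1).
have y21 : 1 <= y2 by rewrite /y2 ler_pdivlMr//; lra.
(* The exponential of the bound shrinks by a factor [e] in each step, and the powers may grow by at
   most that; [sqrtX_le] on both factors gives a total exponent of at most 1. *)
have h : Num.sqrt y ^+ p * y2 <= expR 1.
  have -> : y2 = Num.sqrt y2 ^+ 2 by rewrite sqr_sqrtr//; lra.
  apply: le_trans (ler_pM _ _ (sqrtX_le p y1) (sqrtX_le 2 y21)) _; rewrite ?exprn_ge0 ?sqrtr_ge0//.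
  rewrite -expRD ler_expR.
  have -> : p%:R = m - 1 :> R by rewrite /m -natr1; lra.
  have -> : (m - 1) / 4 * (y - y^-1) + 2 / 4 * (y2 - y2^-1) =
      1 - ((2 * m + 1) * (m + 1) * (m + 3) - 2 * (m + 2) ^+ 2 * m) / (m * (m + 1) * (m + 2) * (m + 3)).
    by rewrite /y /y2; field; rewrite !lt0r_neq0//; lra.
  rewrite gerBl divr_ge0//; last by rewrite !mulr_ge0//; lra.
  have -> : (2 * m + 1) * (m + 1) * (m + 3) - 2 * (m + 2) ^+ 2 * m = m ^+ 2 + 2 * m + 3 by ring.
  by nra.
apply: le_trans (_ : m * (gmo 0 * ((m + 1) / m) * Num.sqrt m ^+ p * expR (- (m / 2))) <= _); last first.
  by rewrite ler_wpM2l// ltW.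
have := gmo_gt0 (R:=R) 0; have := expR_gt0 (- (m / 2)); have := exprn_ge0 p (sqrtr_ge0 m).
have := expR_gt0 (1 : R).
move: (Num.sqrt m ^+ p) (gmo 0) (expR (- _)) (expR 1) h => A g E e1 h e0 A0 E0 g0.
have -> : g * ((m + 3) / (m + 2)) * (Num.sqrt y ^+ p * A * (m + 2)) * (E * e1^-1) =
   (g * A * E * (m + 1)) * ((Num.sqrt y ^+ p * y2) / e1).
  by rewrite /y2; field; rewrite !lt0r_neq0//; lra.
have -> : m * (g * ((m + 1) / m) * A * E) = g * A * E * (m + 1).
  by field; rewrite lt0r_neq0.
rewrite -[leRHS]mulr1 ler_wpM2l//; last by rewrite ler_pdivrMr// mul1r.
by rewrite !mulr_ge0//; [exact: ltW|exact: ltW|lra].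
Qed.

(** The left side bounds the probability, over the matrix and an independent [z] of dimension
    [k + 1], that [N z] is large; the right side is [t^-(p+1)] times a lower bound for that
    probability given an [N] of large norm. The power [e^(p+1)] on the left covers one
    [e^(-(p+1)/2)] on the right and another from [gmo_ge_exp]. *)
Lemma small_ball_tradeoff k p (t : R) : (4 <= p)%N -> 0 < t ->
  gmo (k + p.+1) / gmo k / (p.+1%:R * gmo p) *
    (Num.sqrt p.+1%:R * (t * (expR 1 * Num.sqrt (k + p.+1)%:R / p.+1%:R))) ^- p.+1 <=
  (gmo 0)^-1 * (Num.sqrt p.+1%:R / (1 + p.+1%:R) * expR (- (p.+1%:R / 2))) * t ^- p.+1 :> R.
Proof.
move=> p4 t0.
have := gmo_ratio k p.+1; have := gmo_ge_exp p4.
set m : R := p.+1%:R; set s := Num.sqrt m; set K := Num.sqrt (k + p.+1)%:R.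
have m0 : 0 < m by rewrite ltr0n.
have s0 : 0 < s by rewrite sqrtr_gt0.
have K0 : 0 < K by rewrite sqrtr_gt0 ltr0n addnS.
have sm : m = s ^+ 2 by rewrite sqr_sqrtr// ltW.
have -> : p.+2%:R = 1 + m :> R by rewrite /m -!natr1; lra.
have eE : expR 1 ^- p.+1 = expR (- (m / 2)) ^+ 2 :> R.
  by rewrite -exprVn -expRN -!expRM_natl; congr expR; rewrite /m; field.
have E0 : 0 < expR (- (m / 2)) by exact: expR_gt0.
rewrite !exprMn !invfM exprVn invrK eE.
move: (gmo_gt0 (R:=R) 0) (gmo_gt0 (R:=R) k) (gmo_gt0 (R:=R) p) => g0 gk gp.
move: (expR (- (m / 2))) E0 => E E0 hp hk.
have -> : m ^+ p.+1 = m * s ^+ p * s ^+ p by rewrite exprS -mulrA -exprMn -expr2 -sm.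
have -> : s ^- p.+1 = s^-1 * s ^- p by rewrite exprS invfM.
rewrite /= -/s.
have sp0 : 0 < s ^+ p by rewrite exprn_gt0.
have tp0 : 0 < t ^+ p.+1 by rewrite exprn_gt0.
have Kp0 : 0 < K ^+ p.+1 by rewrite exprn_gt0.
have -> : gmo (k + p.+1) / gmo k * (m^-1 / gmo p) *
    (s^-1 * s ^- p * (t ^- p.+1 * (E ^+ 2 * K ^- p.+1 * (m * s ^+ p * s ^+ p)))) =
  t ^- p.+1 * E * (gmo (k + p.+1) / (K ^+ p.+1 * gmo k)) * (E * s ^+ p / s / gmo p).
  by field; rewrite !lt0r_neq0.
have -> : (gmo 0)^-1 * (s / (1 + m) * E) * t ^- p.+1 =
  t ^- p.+1 * E * 1 * (s / (1 + m) / gmo 0) by ring.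
have h1 : gmo (k + p.+1) / (K ^+ p.+1 * gmo k) <= 1.
  by rewrite ler_pdivrMr ?mulr_gt0// mul1r.
have h2 : E * s ^+ p / s / gmo p <= s / (1 + m) / gmo 0.
  rewrite ler_pdivrMr//; have m10 : 0 < 1 + m by lra.
  apply: le_trans (ler_wpM2l _ hp); last by rewrite !divr_ge0// ltW.
  rewrite le_eqVlt; apply/orP; left; apply/eqP.
  by rewrite sm; field; rewrite -sm !lt0r_neq0.
apply: ler_pM => //.
- by rewrite !mulr_ge0 ?invr_ge0 ?mulr_ge0//; apply: ltW => //; exact: gmo_gt0.
- by rewrite !mulr_ge0 ?invr_ge0//; exact: ltW.
- by rewrite ler_wpM2l// mulr_ge0 ?invr_ge0// ltW.
Qed.

End moment_bounds.

(** * Euclidean matrices *)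

Section euclidean_matrices.
Context {R : realType}.

Definition sqn m n (A : 'M[R]_(m, n)) : R := \sum_i \sum_j A i j ^+ 2.

Lemma sqn_ge0 m n (A : 'M[R]_(m, n)) : 0 <= sqn A.
Proof. by do 2 apply: sumr_ge0 => ? _; exact: sqr_ge0. Qed.

Lemma sqnE m n (A : 'M[R]_(m, n)) : sqn A = \tr (A *m A^T).
Proof.
rewrite /mxtrace; apply: eq_bigr => i _; rewrite !mxE; apply: eq_bigr => j _.
by rewrite mxE expr2.
Qed.

Lemma sqn_tr m n (A : 'M[R]_(m, n)) : sqn A^T = sqn A.
Proof. by rewrite !sqnE trmxK mxtrace_mulC. Qed.

Lemma sqn_row n (u : 'rV[R]_n) : sqn u = (u *m u^T) 0 0.
Proof. by rewrite sqnE /mxtrace big_ord1. Qed.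

Lemma sqn_col n (u : 'cV[R]_n) : sqn u = (u^T *m u) 0 0.
Proof. by rewrite -sqn_tr sqn_row trmxK. Qed.

Lemma sqn_eq0 m n (A : 'M[R]_(m, n)) : sqn A = 0 -> A = 0.
Proof.
move=> /eqP; rewrite psumr_eq0; last by move=> i _; apply: sumr_ge0 => j _; exact: sqr_ge0.
move=> /allP h; apply/matrixP => i j; rewrite mxE.
have := h i (mem_index_enum _); rewrite psumr_eq0; last by move=> k _; exact: sqr_ge0.
by move=> /allP /(_ j (mem_index_enum _)); rewrite sqrf_eq0 => /eqP.
Qed.

Lemma sqn_gt0 m n (A : 'M[R]_(m, n)) : A != 0 -> 0 < sqn A.
Proof.
move=> A0; rewrite lt_neqAle sqn_ge0 andbT eq_sym; apply: contra A0 => /eqP h.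
by rewrite (sqn_eq0 h).
Qed.

Lemma sqnZ m n a (A : 'M[R]_(m, n)) : sqn (a *: A) = a ^+ 2 * sqn A.
Proof.
rewrite /sqn mulr_sumr; apply: eq_bigr => i _; rewrite mulr_sumr.
by apply: eq_bigr => j _; rewrite mxE exprMn.
Qed.

Lemma orth_tr n (O : 'M[R]_n) : O *m O^T = 1%:M -> O^T *m O = 1%:M.
Proof. exact: mulmx1C. Qed.

Lemma sqn_lin n (u v : 'rV[R]_n) a b :
  sqn (a *: u + b *: v) = a ^+ 2 * sqn u + 2 * a * b * (u *m v^T) 0 0 + b ^+ 2 * sqn v.
Proof.
rewrite /sqn !big_ord1 mxE !mulr_sumr -!big_split/=; apply: eq_bigr => j _.
by rewrite !mxE; ring.
Qed.

Lemma dot_rowC n (u v : 'rV[R]_n) : (u *m v^T) 0 0 = (v *m u^T) 0 0.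
Proof. by rewrite !mxE; apply: eq_bigr => j _; rewrite !mxE mulrC. Qed.

Lemma cauchy_schwarz_row n (u v : 'rV[R]_n) : (u *m v^T) 0 0 ^+ 2 <= sqn u * sqn v.
Proof.
have [->|v0] := eqVneq v 0; first by rewrite trmx0 mulmx0 mxE expr0n/= mulr_ge0 ?sqn_ge0.
have sv := sqn_gt0 v0.
have := sqn_ge0 (sqn v *: u + - (u *m v^T) 0 0 *: v); rewrite sqn_lin.
move: ((u *m v^T) 0 0) (sqn u) (sqn v) sv => a x y y0 h.
have : 0 <= y * (x * y - a ^+ 2) by apply: le_trans h _; lra.
by rewrite pmulr_rge0// subr_ge0.
Qed.

(** The reflection along [w = v - e] exchanges [v] and the basis vector [e]; if [v = e] the identity
    takes its place. *)
Lemma householder n (v : 'rV[R]_n) (i0 : 'I_n) : sqn v = 1 ->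
  exists2 U : 'M[R]_n, U *m U^T = 1%:M & row i0 U = v.
Proof.
move=> v1; pose e : 'rV[R]_n := delta_mx 0 i0.
have e1 : sqn e = 1.
  by rewrite sqn_row trmx_delta mul_delta_mx mxE !eqxx.
move wE : (v - e) => w.
have [w0|w0] := eqVneq w 0.
  exists 1%:M; first by rewrite trmx1 mulmx1.
  by rewrite row1; apply/esym/eqP; rewrite -subr_eq0 -/e wE w0.
have := sqn_gt0 w0; move sE : (sqn w) => s sw.
have wwT : w *m w^T = s%:M.
  by apply/matrixP => i j; rewrite !ord1 -sqn_row sE mxE mulr1n.
pose U := 1%:M - (2 / s) *: (w^T *m w).
have Usym : U^T = U by rewrite /U linearB linearZ /= trmx1 trmx_mul trmxK.
have UU : U *m U = 1%:M.
  rewrite /U mulmxBl mul1mx mulmxBr mulmx1 -scalemxAl -scalemxAr.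
  rewrite mulmxA -(mulmxA w^T) wwT mul_mx_scalar -scalemxAl !scalerA.
  have -> : 2 / s * (2 / s * s) = 2 / s + 2 / s by field; rewrite lt0r_neq0.
  rewrite scalerDl; move: (_ *: _) => X.
  have aux (V : zmodType) (a b : V) : a - b - (b - (b + b)) = a.
    by rewrite opprB addrK subrK.
  exact: aux.
exists U; first by rewrite Usym.
have -> : row i0 U = e *m U by rewrite rowE.
rewrite /U mulmxBr mulmx1 -scalemxAr mulmxA.
have ewT : e *m w^T = (- (s / 2))%:M.
  apply/matrixP => i j; rewrite !ord1 [RHS]mxE mulr1n.
  have wE' : w = 1 *: v + (-1) *: e by rewrite scale1r scaleN1r wE.
  have := sqn_lin v e 1 (-1); rewrite -wE' sE v1 e1 dot_rowC => ->.
  have -> : (e *m w^T) 0 0 = (e *m v^T) 0 0 - sqn e.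
    by rewrite -wE linearB /= mulmxBr mxE [X in _ + X]mxE -sqn_row.
  by rewrite e1; lra.
rewrite ewT mul_scalar_mx scalerA.
have -> : 2 / s * - (s / 2) = -1 by field; rewrite lt0r_neq0.
by rewrite scaleN1r opprK -wE addrC subrK.
Qed.

Lemma linear_coef_eq0 (b c : R) : (forall t : R, 0 <= t * b + t ^+ 2 * c) -> b = 0.
Proof.
move=> h; apply/eqP; rewrite -sqrf_eq0 eq_le sqr_ge0 andbT.
pose d := `|c| + 1; have d0 : 0 < d by rewrite /d ltr_wpDl.
have := h (- b / d); have cd : c <= d - 1 by rewrite /d addrK ler_norm.
have -> : - b / d * b + (- b / d) ^+ 2 * c = b ^+ 2 / d ^+ 2 * (c - d).
  by field; rewrite lt0r_neq0.
rewrite nmulr_lge0; last by lra.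
by rewrite pmulr_lle0// invr_gt0 exprn_gt0.
Qed.

Lemma sym_form n (M : 'M[R]_n) (u w : 'rV[R]_n) : M^T = M ->
  (u *m M *m w^T) 0 0 = (w *m M *m u^T) 0 0.
Proof.
move=> Msym; have -> : u *m M *m w^T = (w *m M *m u^T)^T.
  by rewrite !trmx_mul trmxK Msym mulmxA.
by rewrite mxE.
Qed.

Lemma quad_lin n (M : 'M[R]_n) (u w : 'rV[R]_n) t : M^T = M ->
  ((u + t *: w) *m M *m (u + t *: w)^T) 0 0 =
  (u *m M *m u^T) 0 0 + 2 * t * (u *m M *m w^T) 0 0 + t ^+ 2 * (w *m M *m w^T) 0 0.
Proof.
move=> Msym; have trD : (u + t *: w)^T = u^T + t *: w^T by apply/matrixP => i j; rewrite !mxE.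
rewrite trD !mulmxDl !mulmxDr -!scalemxAl -!scalemxAr scalerA.
have := sym_form u w Msym; move: (u *m M *m u^T) (u *m M *m w^T) (w *m M *m u^T) (w *m M *m w^T).
by move=> a b c d bc; rewrite !mxE -bc; ring.
Qed.

Lemma continuous_fsum (T : topologicalType) (I : finType) (f : I -> T -> R) :
  (forall i, continuous (f i)) -> continuous (fun x => \sum_i f i x).
Proof.
by move=> cf; apply: (@continuous_big _ _ +%R 0 xpredT) => // x; exact: add_continuous.
Qed.

(** [v] maximises the quadratic form on the compact unit sphere. Varying it along the defect
    [z = v M - q(v) v] produces a first-order term proportional to [|z|^2], which must vanish. *)
Lemma sym_eigenvector n (M : 'M[R]_n.+1) : M^T = M ->
  exists a (v : 'rV[R]_n.+1), sqn v = 1 /\ v *m M = a *: v.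
Proof.
move=> Msym; pose q (x : 'rV[R]_n.+1) := (x *m M *m x^T) 0 0.
pose S : set 'rV[R]_n.+1 := [set x | sqn x = 1].
have cc (j : 'I_n.+1) : continuous (fun x : 'rV[R]_n.+1 => x 0 j) by exact: coord_continuous.
have csqn : continuous (fun x : 'rV[R]_n.+1 => sqn x).
  have -> : (fun x : 'rV[R]_n.+1 => sqn x) = fun x => \sum_j x 0 j ^+ 2.
    by apply/funext => x; rewrite /sqn big_ord1.
  apply: continuous_fsum => j x.
  by apply: (@cvg_comp _ _ _ (fun x : 'rV[R]_n.+1 => x 0 j) (fun y => y ^+ 2)); [exact: cc|exact: exprn_continuous].
have cq : continuous q.
  have -> : q = fun x => \sum_j (\sum_i x 0 i * M i j) * x 0 j.
    by apply/funext => x; rewrite /q !mxE; apply: eq_bigr => j _; rewrite !mxE.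
  have cs j : continuous (fun x : 'rV[R]_n.+1 => \sum_i x 0 i * M i j).
    by apply: continuous_fsum => i x; exact: (cvgM (cc i x) (cvg_cst _)).
  by apply: continuous_fsum => j x; exact: (cvgM (cs j x) (cc j x)).
have S0 : S !=set0.
  by exists (delta_mx 0 0); rewrite /S/= sqn_row trmx_delta mul_delta_mx mxE !eqxx.
have cS : compact S.
  apply: bounded_closed_compact.
    exists 1; split; first exact: num_real.
    move=> y y1 x Sx; rewrite /= /Num.norm/= mx_normrE; apply/bigmax_leP; split; first exact: ltW (lt_trans ltr01 y1).
    move=> [i j] _ /=; rewrite ord1 (le_trans _ (ltW y1))//.
    rewrite -(@ler_pXn2r _ 2) ?nnegrE// expr1n real_normK ?num_real//.
    rewrite -Sx /sqn big_ord1 (bigD1 j)//= lerDl sumr_ge0// => k _; exact: sqr_ge0.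
  rewrite (_ : S = (fun x : 'rV[R]_n.+1 => sqn x) @^-1` [set 1]) //.
  by apply: closed_comp => [x _|]; [exact: csqn|exact: closed_eq].
have [v /set_mem Sv vmax] := compact_EVT_max S0 cS (continuous_subspaceT cq).
have hmax x : q x <= q v * sqn x.
  have [->|x0] := eqVneq x 0.
    by rewrite sqn_row /q !mul0mx !mxE mulr0.
  have sx := sqn_gt0 x0.
  pose c := (Num.sqrt (sqn x))^-1.
  have c2 : c ^+ 2 = (sqn x)^-1 by rewrite /c exprVn sqr_sqrtr// ltW.
  have Scx : S (c *: x) by rewrite /S/= sqnZ c2 mulVf// lt0r_neq0.
  have := vmax (c *: x) (mem_set Scx).
  rewrite /q linearZ/= -!scalemxAl -!scalemxAr scalerA mxE -expr2 c2.
  by rewrite mulrC ler_pdivrMr.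
exists (q v), v; split => //.
pose z : 'rV[R]_n.+1 := v *m M - q v *: v.
suff z0 : z = 0 by apply/eqP; rewrite -subr_eq0; apply/eqP.
apply: sqn_eq0.
have zz : (z *m z^T) 0 0 = (v *m M *m z^T) 0 0 - q v * (v *m z^T) 0 0.
  rewrite {1}/z mulmxBl -scalemxAl; move: (v *m M *m z^T) (v *m z^T) => a b.
  by rewrite !mxE.
suff : - 2 * sqn z = 0 by lra.
apply: (@linear_coef_eq0 _ (q v * sqn z - q z)) => t.
have := hmax (v + t *: z); rewrite -subr_ge0 /q quad_lin//.
have := sqn_lin v z 1 t; rewrite scale1r Sv => ->.
rewrite sqn_row zz -/(q v) -/(q z).
by move=> h; apply: le_trans h _; lra.
Qed.

(** Induction on the dimension: in an orthonormal basis beginning with an eigenvector, row 0 is a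
    multiple of a basis vector, and by symmetry so is column 0. *)
Theorem real_spectral n (M : 'M[R]_n) : M^T = M ->
  exists (O : 'M[R]_n) (d : 'rV[R]_n), O *m O^T = 1%:M /\ M = O^T *m diag_mx d *m O.
Proof.
elim: n M => [|n IH] M Msym.
  by exists 0, 0; split; apply/matrixP => -[].
have [a [v [v1 vM]]] := sym_eigenvector Msym.
have [V1 OO1 rO1] := householder (0 : 'I_n.+1) v1.
pose M1 : 'M[R]_(1 + n) := V1 *m M *m V1^T.
have M1sym : M1^T = M1 by rewrite /M1 !trmx_mul trmxK Msym mulmxA.
have r0 : row 0 M1 = a *: delta_mx 0 0.
  rewrite /M1 !row_mul rO1 vM -scalemxAl -rO1 -row_mul OO1 row1.
  by [].
have ur0 : ursubmx M1 = 0.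
  apply/matrixP => i j; rewrite !ord1 !mxE.
  have := congr1 (fun A : 'rV[R]_(1 + n) => A 0 (rshift 1 j)) r0; rewrite !mxE/=.
  have -> : lshift n (0 : 'I_1) = 0 :> 'I_(1 + n) by apply/val_inj.
  by move=> ->; rewrite mulr0.
have ul0 : ulsubmx M1 = a%:M.
  apply/matrixP => i j; rewrite !ord1 !mxE.
  have := congr1 (fun A : 'rV[R]_(1 + n) => A 0 0) r0; rewrite !mxE/=.
  have -> : lshift n (0 : 'I_1) = 0 :> 'I_(1 + n) by apply/val_inj.
  by move=> ->; rewrite mulr1 mulr1n.
have dl0 : dlsubmx M1 = 0 by rewrite -[dlsubmx M1]trmxK trmx_dlsub M1sym ur0 trmx0.
have drsym : (drsubmx M1)^T = drsubmx M1 by rewrite trmx_drsub M1sym.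
have [V2 [d2 [OO2 dE]]] := IH _ drsym.
pose V3 : 'M[R]_(1 + n) := block_mx 1%:M 0 0 V2.
have OV3 : V3 *m V3^T = 1%:M.
  rewrite /V3 tr_block_mx !trmx0 trmx1 mulmx_block !mulmx0 !mul0mx !mulmx1 !addr0 add0r OO2.
  by rewrite -scalar_mx_block.
have M1E : M1 = V3^T *m diag_mx (row_mx (const_mx a) d2) *m V3.
  rewrite -[LHS]submxK ul0 ur0 dl0 dE /V3 diag_mx_row tr_block_mx !trmx0 trmx1.
  rewrite !mulmx_block !mulmx0 !mul0mx !mulmx1 !mul1mx !addr0 !add0r.
  by rewrite mul0mx; congr (block_mx _ _ _ _); rewrite diag_const_mx.
pose O1 : 'M[R]_(1 + n) := V3 *m V1.
pose d1 : 'rV[R]_(1 + n) := row_mx (const_mx a) d2.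
exists O1, d1; rewrite /O1 /d1; split.
  by rewrite trmx_mul mulmxA -(mulmxA V3) OO1 mulmx1.
rewrite trmx_mul -!mulmxA (mulmxA V3^T) (mulmxA (V3^T *m _)) -M1E /M1.
by rewrite !mulmxA (orth_tr OO1) mul1mx -mulmxA (orth_tr OO1) mulmx1.
Qed.

(** Rows are added one at a time, from the kernel of those already present. The condition is on the
    rank of [B], so its rows may be dependent. *)
Lemma orth_compl m k n (B : 'M[R]_(k, n)) : (\rank B + m <= n)%N ->
  exists2 Q : 'M[R]_(m, n), Q *m Q^T = 1%:M & B *m Q^T = 0.
Proof.
elim: m => [|m IH] Bm.
  by exists 0; [apply/matrixP => -[]|apply/matrixP => i []].
have [|Q QQ BQ] := IH; first by rewrite (leq_trans _ Bm)// addnS.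
have rk : (\rank (col_mx B Q)^T < n)%N.
  rewrite mxrank_tr -addsmxE; apply: leq_ltn_trans (mxrank_adds_leqif _ _) _.
  by rewrite (leq_trans _ Bm)// addnS ltnS leq_add2l rank_leq_row.
have [u u0 uz] : exists2 u : 'rV[R]_n, u != 0 & u *m (col_mx B Q)^T = 0.
  have : kermx (col_mx B Q)^T != 0.
    by rewrite -mxrank_eq0 mxrank_ker subn_eq0 -ltnNge.
  by move=> /rowV0Pn[u /sub_kermxP uz u0]; exists u.
have su := sqn_gt0 u0; pose c := (Num.sqrt (sqn u))^-1.
have c2 : c ^+ 2 * sqn u = 1 by rewrite /c exprVn sqr_sqrtr ?mulVf ?lt0r_neq0// ltW.
have [uB uQ] : u *m B^T = 0 /\ u *m Q^T = 0.
  by move: uz; rewrite tr_col_mx mul_mx_row -[0]row_mx0 => /eq_row_mx.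
pose Q1 : 'M[R]_(1 + m, n) := col_mx (c *: u) Q.
have Q1T : Q1^T = row_mx (c *: u^T) Q^T by rewrite /Q1 tr_col_mx linearZ.
have Qu : Q *m u^T = 0 by rewrite -[Q *m _]trmxK trmx_mul trmxK uQ trmx0.
have Bu : B *m u^T = 0 by rewrite -[B *m _]trmxK trmx_mul trmxK uB trmx0.
have QQ1 : Q1 *m Q1^T = 1%:M.
  rewrite Q1T /Q1 mul_col_row -!scalemxAl -!scalemxAr scalerA -expr2 uQ QQ Qu !scaler0.
  rewrite [RHS](@scalar_mx_block _ 1 m); congr block_mx.
  by apply/matrixP => i j; rewrite !ord1 mxE -sqn_row c2 mxE.
have BQ1 : B *m Q1^T = 0.
  by rewrite Q1T mul_mx_row BQ -scalemxAr Bu scaler0 row_mx0.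
by exists Q1.
Qed.

(* Junk value: [rinv G = 0] when [G G^T] is singular, as [0^-1 = 0]. *)
Definition rinv k n (G : 'M[R]_(k, n)) : 'M[R]_(n, k) :=
  (\det (G *m G^T))^-1 *: (G^T *m \adj (G *m G^T)).

Lemma rinvE k n (G : 'M[R]_(k, n)) : \det (G *m G^T) != 0 ->
  rinv G = G^T *m invmx (G *m G^T).
Proof.
by move=> d0; rewrite /rinv /invmx unitmxE unitfE d0 -scalemxAr.
Qed.

Lemma mul_rinv k n (G : 'M[R]_(k, n)) : \det (G *m G^T) != 0 -> G *m rinv G = 1%:M.
Proof.
by move=> d0; rewrite rinvE// mulmxA mulmxV// unitmxE unitfE.
Qed.

Lemma rinv0 k n (G : 'M[R]_(k, n)) : \det (G *m G^T) = 0 -> rinv G = 0.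
Proof. by move=> d0; rewrite /rinv d0 invr0 scale0r. Qed.

(** [rinv G *m (G *m c)] is the orthogonal projection of [c] to the row space of [G]: the difference
    lies in the kernel of [G]. *)
Lemma rinv_min k n (G : 'M[R]_(k, n)) (c : 'cV[R]_n) :
  \det (G *m G^T) != 0 -> sqn (rinv G *m (G *m c)) <= sqn c.
Proof.
move=> d0; move cE : (rinv G *m (G *m c)) => c'; move rE : (c - c') => r.
have Gr : G *m r = 0 by rewrite -rE mulmxBr -cE (mulmxA G (rinv G)) mul_rinv// mul1mx subrr.
have cr : r^T *m c' = 0.
  by rewrite -cE rinvE// -!mulmxA mulmxA -trmx_mul Gr trmx0 mul0mx.
have rc : c'^T *m r = 0 by rewrite -[LHS]trmxK trmx_mul trmxK cr trmx0.
have -> : c = c' + r by rewrite -rE addrC subrK.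
have trD : (c' + r)^T = c'^T + r^T by apply/matrixP => i j; rewrite !mxE.
rewrite [leRHS]sqn_col trD mulmxDl !mulmxDr cr rc addr0 add0r mxE -!sqn_col.
by rewrite lerDl sqn_ge0.
Qed.

(** A rotation of the rows is moved to the argument of [rinv G]. In the singular case both sides
    have the junk value 0. *)
Lemma rinv_orth k n (O : 'M[R]_k) (G : 'M[R]_(k, n)) : O *m O^T = 1%:M ->
  rinv (O *m G) = rinv G *m O^T.
Proof.
move=> OO; have WE : O *m G *m (O *m G)^T = O *m (G *m G^T) *m O^T.
  by rewrite trmx_mul !mulmxA.
have dO : \det O * \det O^T = 1 by rewrite -det_mulmx OO det1.
have dE : \det (O *m G *m (O *m G)^T) = \det (G *m G^T).
  by rewrite WE !det_mulmx mulrAC dO mul1r.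
have [d0|d0] := eqVneq (\det (G *m G^T)) 0.
  by rewrite !rinv0 ?dE// mul0mx.
have Wu : G *m G^T \in unitmx by rewrite unitmxE unitfE.
rewrite !rinvE ?dE//; have -> : invmx (O *m G *m (O *m G)^T) = O *m invmx (G *m G^T) *m O^T.
  have XY : (O *m G *m (O *m G)^T) *m (O *m invmx (G *m G^T) *m O^T) = 1%:M.
    rewrite WE; move: (G *m G^T) Wu => W Wu.
    by rewrite !mulmxA -(mulmxA _ O^T O) (orth_tr OO) mulmx1 -(mulmxA O W) mulmxV// mulmx1 OO.
  rewrite -[LHS]mulmx1 -XY mulKmx//.
  by rewrite unitmxE unitfE dE.
by rewrite trmx_mul -!mulmxA (mulmxA O^T) (orth_tr OO) mul1mx.
Qed.

(** The column is the solution of [G c = e_i] of least norm, so any solution bounds it. With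
    [h = row i G *m Q^T], the vector [Q^T h^T / |h|^2] is one, because the other rows are orthogonal
    to those of [Q]. *)
Lemma rinv_col_le m k n (G : 'M[R]_(k, n)) (i : 'I_k) (Q : 'M[R]_(m, n)) :
  Q *m Q^T = 1%:M -> (forall i', i' != i -> row i' G *m Q^T = 0) ->
  sqn (row i G *m Q^T) != 0 ->
  sqn (col i (rinv G)) <= (sqn (row i G *m Q^T))^-1.
Proof.
move=> QQ GQ; set D := sqn _ => D0.
have [d0|d0] := eqVneq (\det (G *m G^T)) 0.
  by rewrite rinv0// /sqn big1 ?invr_ge0 ?sqn_ge0// => a _; apply: big1 => b _; rewrite !mxE expr0n.
pose h := row i G *m Q^T.
pose c : 'cV[R]_n := D^-1 *: (Q^T *m h^T).
have Gc : G *m c = delta_mx i 0.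
  apply/colP => i'; rewrite /c -scalemxAr mulmxA.
  have -> : (D^-1 *: (G *m Q^T *m h^T)) i' 0 = D^-1 * ((row i' G *m Q^T) *m h^T) 0 0.
    rewrite [LHS]mxE; congr (_ * _); rewrite !mxE; apply: eq_bigr => j _; congr (_ * _).
    by rewrite -row_mul [RHS]mxE.
  rewrite [RHS]mxE eqxx andbT; case: eqVneq => [->|i'i]/=.
    by rewrite -/h -sqn_row -/D mulVf.
  by rewrite GQ// mul0mx mxE mulr0.
have := rinv_min c d0; rewrite Gc -colE => /le_trans; apply.
rewrite /c sqnZ sqn_col trmx_mul !trmxK mulmxA -(mulmxA h) QQ mulmx1 -sqn_row -/D.
by rewrite expr2 -mulrA mulVf// mulr1.
Qed.

End euclidean_matrices.

(** * Gaussian matrices and their right inverses *)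

Section measurable_matrices.
Context {R : realType} d (T : measurableType d).

Definition measurable_mx m n (M : T -> 'M[R]_(m, n)) : Prop :=
  forall i j, measurable_fun setT (fun t => M t i j).

Lemma measurable_mx_tr m n (M : T -> 'M[R]_(m, n)) : measurable_mx M -> measurable_mx (fun t => (M t)^T).
Proof.
move=> mM i j; rewrite (_ : (fun t => _) = fun t => M t j i)//.
by apply/funext => t; rewrite mxE.
Qed.

Lemma measurable_mx_mul m n q (M : T -> 'M[R]_(m, n)) (M' : T -> 'M[R]_(n, q)) :
  measurable_mx M -> measurable_mx M' -> measurable_mx (fun t => M t *m M' t).
Proof.
move=> mM mM' i j; rewrite (_ : (fun t => _) = fun t => \sum_l M t i l * M' t l j).
  by apply: measurable_sum => l; exact: measurable_funM.
by apply/funext => t; rewrite mxE.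
Qed.

Lemma measurable_mx_cst m n (M : 'M[R]_(m, n)) : measurable_mx (fun=> M).
Proof. by move=> i j; exact: measurable_cst. Qed.

Lemma measurable_det n (M : T -> 'M[R]_n) : measurable_mx M -> measurable_fun setT (fun t => \det (M t)).
Proof.
move=> mM; apply: measurable_sum => s; apply: measurable_funM; first exact: measurable_cst.
by apply: measurable_prod => i _; exact: mM.
Qed.

Lemma measurable_mx_adj n (M : T -> 'M[R]_n) : measurable_mx M -> measurable_mx (fun t => \adj (M t)).
Proof.
move=> mM i j.
rewrite (_ : (fun t => _) = fun t => (-1) ^+ (j + i) * \det (row' j (col' i (M t)))); last first.
  by apply/funext => t; rewrite mxE.
apply: measurable_funM; first exact: measurable_cst.
apply: measurable_det => a b; rewrite (_ : (fun t => _) = fun t => M t (lift j a) (lift i b))//.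
by apply/funext => t; rewrite !mxE.
Qed.

Lemma measurable_sqn m n (M : T -> 'M[R]_(m, n)) : measurable_mx M ->
  measurable_fun setT (fun t => sqn (M t)).
Proof.
move=> mM; apply: measurable_sum => i; apply: measurable_sum => j.
exact: measurable_funX.
Qed.

Lemma measurable_gram_det m n (M : T -> 'M[R]_(m, n)) : measurable_mx M ->
  measurable_fun setT (fun t => \det (M t *m (M t)^T)).
Proof. by move=> mM; apply: measurable_det; apply: measurable_mx_mul => //; exact: measurable_mx_tr. Qed.

(** The determinant and adjugate in [rinv] make its entries quotients of polynomials in the entries
    of [M t]. *)
Lemma measurable_mx_rinv m n (M : T -> 'M[R]_(m, n)) : measurable_mx M -> measurable_mx (fun t => rinv (M t)).
Proof.
move=> mM; have mG : measurable_mx (fun t => M t *m (M t)^T) by apply: measurable_mx_mul => //; exact: measurable_mx_tr.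
move=> i j; rewrite (_ : (fun t => _) = fun t => (\det (M t *m (M t)^T))^-1 *
    ((M t)^T *m \adj (M t *m (M t)^T)) i j); last by apply/funext => t; rewrite !mxE.
apply: measurable_funM.
  by apply: measurableT_comp; [exact: measurable_inv|exact: measurable_det].
by apply: measurable_mx_mul; [exact: measurable_mx_tr|exact: measurable_mx_adj].
Qed.

Lemma measurable_mx_col m n (M : T -> 'M[R]_(m, n)) c : measurable_mx M -> measurable_mx (fun t => col c (M t)).
Proof.
move=> mM i j; rewrite (_ : (fun t => _) = fun t => M t i c)//.
by apply/funext => t; rewrite mxE.
Qed.

Lemma measurable_mx_row' m n (M : T -> 'M[R]_(m, n)) c : measurable_mx M -> measurable_mx (fun t => row' c (M t)).
Proof.
move=> mM i j; rewrite (_ : (fun t => _) = fun t => M t (lift c i) j)//.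
by apply/funext => t; rewrite mxE.
Qed.

Lemma measurable_true (b : T -> bool) : measurable_fun setT b -> measurable [set t | b t].
Proof.
move=> mb; rewrite -[X in measurable X]setTI.
rewrite (_ : [set t | b t] = b @^-1` [set true]); first exact: mb.
by [].
Qed.

Lemma measurable_boolR (b : T -> bool) : measurable_fun setT b ->
  measurable_fun setT (fun t => ((b t)%:R : R)%:E).
Proof.
move=> mb; apply/measurable_EFinP; apply: (measurableT_comp (f := fun c : bool => c%:R : R)) => //.
Qed.

Lemma prob_int (P : probability T R) (b : T -> bool) : measurable_fun setT b ->
  (P [set t | b t] = \int[P]_t ((b t)%:R)%:E)%E.
Proof.
move=> /measurable_true mb; rewrite -[X in P X]setIT -(integral_indic P measurableT mb).
apply: eq_integral => t _; rewrite indicE; congr ((nat_of_bool _)%:R%:E).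
by apply/asboolP/idP.
Qed.
End measurable_matrices.

(** A linear relation between the rows of [M] must involve row 0, since the others are independent;
    hence row 0 lies in their span. *)
Lemma singular_row0 (R : realType) k n m (M : 'M[R]_(k.+1, n)) (Q : 'M[R]_(m, n)) :
  \det (M *m M^T) = 0 -> \det (row' ord0 M *m (row' ord0 M)^T) != 0 ->
  row' ord0 M *m Q^T = 0 -> row ord0 M *m Q^T = 0.
Proof.
move=> /eqP/det0P[x x0 xW] d1 MQ.
have xM : x *m M = 0.
  by apply: sqn_eq0; rewrite sqn_row trmx_mul mulmxA -(mulmxA x) xW mul0mx mxE.
pose x' : 'rV[R]_k := \row_i x 0 (lift ord0 i).
have xME : x *m M = x 0 ord0 *: row ord0 M + x' *m row' ord0 M.
  rewrite !mulmx_sum_row big_ord_recl; congr (_ + _); apply: eq_bigr => i _.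
  by rewrite mxE; congr (_ *: _); apply/rowP => j; rewrite !mxE.
have x00 : x 0 ord0 != 0.
  apply: contra x0 => /eqP x00; move: xME; rewrite xM x00 scale0r add0r => /esym xr.
  have x'0 : x' = 0.
    have W'u : row' ord0 M *m (row' ord0 M)^T \in unitmx by rewrite unitmxE unitfE.
    by rewrite -(mulmxK W'u x') mulmxA xr !mul0mx.
  apply/eqP/rowP => j; rewrite mxE; case: (unliftP ord0 j) => [i ->|->//].
  by have := congr1 (fun v : 'rV[R]_k => v 0 i) x'0; rewrite !mxE.
have : x *m M *m Q^T = 0 by rewrite xM mul0mx.
rewrite xME mulmxDl -scalemxAl -mulmxA MQ mulmx0 addr0 => /eqP.
by rewrite scaler_eq0 (negbTE x00) => /eqP.
Qed.

Lemma measurable_sqrt (R : realType) : measurable_fun setT (@Num.sqrt R).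
Proof. exact: continuous_measurable_fun (@sqrt_continuous R). Qed.

Lemma prob_cst (R : realType) d (T : measurableType d) (P : probability T R) (c : \bar R) :
  (0 <= c)%E -> (\int[P]_t c = c)%E.
Proof.
by move=> _; rewrite integral_cst// [X in (_ * X)%E]probability_setT mule1.
Qed.

Section gaussian_matrices.
Context {R : realType} d (T : measurableType d) (P : probability T R).
Notation mu := (@lebesgue_measure R).
Notation gam := (normal_prob (0 : R) 1).

Definition gaussian_mx k n (G : T -> 'M[R]_(k, n)) : Prop :=
  gaussian P (fun (ij : 'I_k * 'I_n) w => G w ij.1 ij.2).

Lemma gaussian_mx_mmx k n (G : T -> 'M[R]_(k, n)) : gaussian_mx G -> measurable_mx G.
Proof. by move=> [mG _] i j; exact: (mG (i, j)). Qed.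

Definition mx_of_coords k n (x : coords R ('I_k * 'I_n)%type) : 'M[R]_(k, n) :=
  \matrix_(i, j) x (i, j).

Lemma measurable_mx_of_coords k n : measurable_mx (@mx_of_coords k n).
Proof.
move=> i j; rewrite (_ : (fun t => _) = fun x : coords R _ => x (i, j)).
  exact: measurable_coord.
by apply/funext => x; rewrite mxE.
Qed.

Lemma gaussian_mx_decouple k n (G : T -> 'M[R]_(k, n)) (D : pred 'I_k) (F : 'M[R]_(k, n) -> \bar R) :
  gaussian_mx G -> measurable_fun setT (fun x => F (@mx_of_coords k n x)) -> (forall M, 0 <= F M)%E ->
  (\int[P]_w F (G w) =
   \int[P]_w \int[P]_w' F (\matrix_(i, j) if D i then G w i j else G w' i j))%E.
Proof.
move=> gG mF F0.
have := gaussian_decouple (fun ij : 'I_k * 'I_n => D ij.1) gG mF (fun x => F0 _).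
rewrite (eq_integral (fun w => F (G w))); last first.
  by move=> w _; congr F; apply/matrixP => i j; rewrite mxE.
by move=> ->.
Qed.

Lemma gaussian_mx_row k n (G : T -> 'M[R]_(k, n)) i : gaussian_mx G ->
  gaussian P (fun (j : 'I_n) w => G w i j).
Proof.
by move=> gG; apply: (gaussian_reindex (f := fun j : 'I_n => (i, j)) gG) => j j' [].
Qed.

Lemma gaussian_mx_rows k k' n (G : T -> 'M[R]_(k, n)) (f : 'I_k' -> 'I_k) : gaussian_mx G -> injective f ->
  gaussian_mx (fun w => \matrix_(i, j) G w (f i) j).
Proof.
move=> gG fI; have gI : injective (fun ij : 'I_k' * 'I_n => (f ij.1, ij.2)).
  by move=> [a b] [a' b'] [/fI -> ->].
have := gaussian_reindex gG gI; rewrite /gaussian_mx.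
by under [X in _ -> gaussian P X]eq_fun do under eq_fun do rewrite mxE.
Qed.

Lemma gaussian_mx_orth k n (G : T -> 'M[R]_(k, n)) (U : 'M[R]_k) : gaussian_mx G -> U *m U^T = 1%:M ->
  gaussian_mx (fun w => U *m G w).
Proof.
move=> gG UU.
pose A (ij : 'I_k * 'I_n) (ab : 'I_k * 'I_n) : R := U ij.1 ab.1 * (ij.2 == ab.2)%:R.
have := gaussian_lin (A := A) gG; rewrite /gaussian_mx.
rewrite (_ : (fun (j : 'I_k * 'I_n) w => \sum_i A j i * G w i.1 i.2) =
             fun ij w => (U *m G w) ij.1 ij.2).
  apply=> -[i j] [i' j'] /=.
  rewrite -(pair_bigA _ (fun a b => A (i, j) (a, b) * A (i', j') (a, b)))/=.
  rewrite xpair_eqE; have := congr1 (fun M : 'M[R]_k => M i i') UU; rewrite !mxE.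
  rewrite /A/=; have [->|jj'] := eqVneq j j'; last first.
    rewrite andbF => _; rewrite big1// => a _; rewrite big1// => b _.
    by have [<-|jb] := eqVneq j b; rewrite ?mulr0 ?mul0r// eq_sym (negbTE jj') !mulr0.
  rewrite andbT => <-; apply: eq_bigr => a _; rewrite (bigD1 j')//= eqxx !mulr1 big1 ?addr0 ?mxE//.
  by move=> b /negbTE; rewrite eq_sym => ->; rewrite !mulr0.
apply/funext => -[i j]; apply/funext => w; rewrite mxE.
rewrite -(pair_bigA _ (fun a b => A (i, j) (a, b) * G w a b))/=.
apply: eq_bigr => a _; rewrite /A (bigD1 j)//= eqxx mulr1 big1 ?addr0//.
by move=> b /negbTE; rewrite eq_sym => ->; rewrite mulr0 mul0r.
Qed.

Lemma gaussian_comb_sqr (I : finType) (X : I -> T -> R) (a : I -> R) : gaussian P X ->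
  (\int[P]_w ((\sum_i a i * X i w) ^+ 2)%:E = (\sum_i a i ^+ 2)%:E)%E.
Proof.
move=> gX; pose s := \sum_i a i ^+ 2.
have s0 : 0 <= s by apply: sumr_ge0 => i _; exact: sqr_ge0.
have [sE|sN] := eqVneq s 0.
  have a0 i : a i = 0.
    have /psumr_eq0P h : forall i : I, true -> 0 <= a i ^+ 2 by move=> ? _; exact: sqr_ge0.
    by apply/eqP; rewrite -sqrf_eq0; apply/eqP; apply: (h sE).
  rewrite -/s sE (eq_integral (cst 0%E)) ?integral0// => w _.
  by rewrite big1 ?expr0n// => i _; rewrite a0 mul0r.
have sp : 0 < s by rewrite lt_neqAle eq_sym sN.
pose c := Num.sqrt s; have c0 : 0 < c by rewrite sqrtr_gt0.
have c2 : c ^+ 2 = s by rewrite sqr_sqrtr.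
have := @gaussian_comb _ _ _ P _ X (fun i => a i / c) (fun x => (s * x ^+ 2)%:E) gX.
have -> : \sum_i (a i / c) ^+ 2 = 1.
  under eq_bigr do rewrite exprMn exprVn c2.
  by rewrite -mulr_suml divff.
move=> /(_ erefl) h.
transitivity (\int[P]_w (s * (\sum_i a i / c * X i w) ^+ 2)%:E)%E.
  apply: eq_integral => w _; congr EFin.
  rewrite (_ : \sum_i a i / c * X i w = (\sum_i a i * X i w) / c).
    by rewrite exprMn exprVn c2 mulrCA divff// mulr1.
  by rewrite mulr_suml; apply: eq_bigr => i _; rewrite mulrAC.
rewrite h; last first.
- by move=> x; rewrite lee_fin mulr_ge0// sqr_ge0.
- by apply/measurable_EFinP; apply: measurable_funM => //; exact: measurable_funX.
under eq_integral do rewrite EFinM.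
rewrite ge0_integralZl//; last 2 first.
- by apply/measurable_EFinP; exact: measurable_funX.
- by move=> x _; rewrite lee_fin sqr_ge0.
have -> : (\int[gam]_x (x ^+ 2)%:E = 1)%E; last by rewrite mule1.
transitivity (\int[gam]_x (`|x| ^+ 2)%:E)%E.
  by apply: eq_integral => x _; rewrite real_normK ?num_real.
rewrite gmom_normal gmomE gmoS mul1r gmo0 -EFinM divff//.
by rewrite lt0r_neq0// mulr_gt0// peak1_gt0.
Qed.

Lemma normal_set0 : gam [set (0 : R)] = 0%E.
Proof.
by have /null_content_dominatesP := @normal_prob_dominates R 0 1; apply => //; exact: lebesgue_measure_set1.
Qed.

Lemma measurable_mx_comp k n (F : 'M[R]_(k, n) -> \bar R) d' (T' : measurableType d')
    (M : T' -> 'M[R]_(k, n)) :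
  measurable_fun setT (fun x => F (@mx_of_coords k n x)) -> measurable_mx M -> measurable_fun setT (fun t => F (M t)).
Proof.
move=> mF mM; rewrite (_ : (fun t => _) = (fun x => F (@mx_of_coords k n x)) \o (fun t ij => M t ij.1 ij.2)).
  by apply: (measurableT_comp mF); apply: measurable_coords => -[i j]; exact: mM.
by apply/funext => t /=; congr F; apply/matrixP => i j; rewrite mxE.
Qed.

Lemma gaussian_mx_decouple_le k n (G : T -> 'M[R]_(k, n)) (D : pred 'I_k) (F : 'M[R]_(k, n) -> \bar R) c :
  gaussian_mx G -> measurable_fun setT (fun x => F (@mx_of_coords k n x)) -> (forall M, 0 <= F M)%E -> (0 <= c)%E ->
  (forall w, \int[P]_w' F (\matrix_(i, j) if D i then G w i j else G w' i j) <= c)%E ->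
  (\int[P]_w F (G w) <= c)%E.
Proof.
move=> gG mF F0 c0 H; rewrite (gaussian_mx_decouple D gG mF F0) -[leRHS](prob_cst P c0).
apply: ge0_le_integral => //.
- by move=> w _; exact: integral_ge0.
- have mG := gaussian_mx_mmx gG.
  have := @measurable_fun_fubini_tonelli_F _ _ T T R P
    (fun ww => F (\matrix_(i, j) if D i then G ww.1 i j else G ww.2 i j)).
  apply => //; apply: measurable_mx_comp => // i j.
  rewrite (_ : (fun t => _) = fun ww : T * T => if D i then G ww.1 i j else G ww.2 i j); last first.
    by apply/funext => t; rewrite mxE.
  by case: (D i); [exact: (measurableT_comp (mG i j) measurable_fst)|
    exact: (measurableT_comp (mG i j) measurable_snd)].
Qed.

(** With the other rows fixed, [Q] is fixed and its product with the resampled row [i] is standard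
    Gaussian in dimension [p + 1]. Then [rinv_col_le] and the monotonicity of [h] compare the column
    with an inverse chi variable. *)
Lemma col_bound k p (G : T -> 'M[R]_(k, k + p)) (i : 'I_k) (h : R -> \bar R) :
  gaussian_mx G -> (0 < p)%N -> measurable_fun setT h ->
  (forall x, 0 <= h x)%E -> (forall x y : R, (0 <= x)%R -> (x <= y)%R -> (h x <= h y)%E) ->
  (\int[P]_w h (sqn (col i (rinv (G w)))) <=
   \int[mu]_(r in `[0%R, +oo[) (h (r ^- 2) * (gpow p 1 r / gmo p)%:E))%E.
Proof.
move=> gG p0 mh h0 hmon.
(* At [r = 0] the comparison gives no bound, hence the value [+oo]; it has no weight, since
   [gpow p 1] vanishes at 0 for [p > 0]. *)
pose f (r : R) : \bar R := if r == 0 then +oo%E else h (r ^- 2).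
have mhi : measurable_fun setT (fun r : R => h (r ^- 2)).
  apply: (measurableT_comp mh); apply: measurableT_comp; first exact: measurable_inv.
  exact: measurable_funX.
have mf : measurable_fun setT f.
  by apply: measurable_fun_if => //; [exact: measurable_fun_eqr|exact: measurable_funTS].
have f0 r : (0 <= f r)%E by rewrite /f; case: ifP.
set B := (X in (_ <= X)%E).
have BE : B = (\int[mu]_(r in `[0%R, +oo[) (f r * (gpow p 1 r / gmo p)%:E))%E.
  apply: eq_integral => r _; rewrite /f; case: eqP => // ->.
  have -> : gpow p 1 (0 : R) = 0 by rewrite /gpow expr0n gtn_eqF// mul0r.
  by rewrite mul0r !mule0.
have mF : measurable_fun setT (fun x => h (sqn (col i (rinv (@mx_of_coords k (k + p) x))))).
  apply: (measurableT_comp mh); apply: measurable_sqn; apply: measurable_mx_col; apply: measurable_mx_rinv.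
  exact: measurable_mx_of_coords.
apply: (gaussian_mx_decouple_le (D := fun i' => i' != i) (F := fun M => h (sqn (col i (rinv M)))) gG mF) => //.
  apply: integral_ge0 => r; rewrite /= in_itv/= andbT => r0.
  by rewrite mule_ge0// lee_fin divr_ge0 ?gpow_ge0// ltW// gmo_gt0.
move=> w; rewrite BE.
(* The other [k - 1] rows leave room for [p + 1] orthonormal vectors in dimension [k + p]. *)
have [Q QQ GQ] : exists2 Q : 'M[R]_(p.+1, k + p), Q *m Q^T = 1%:M & row' i (G w) *m Q^T = 0.
  apply: orth_compl; have k0 : (0 < k)%N := leq_ltn_trans (leq0n i) (ltn_ord i).
  rewrite -[X in (_ <= X + p)%N](prednK k0) addSn -addnS leq_add2r; exact: rank_leq_row.
pose X (j : 'I_p.+1) w' := \sum_l Q j l * G w' i l.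
have gX : gaussian P X.
  apply: gaussian_lin; first exact: gaussian_mx_row.
  move=> j j'; have := congr1 (fun M : 'M[R]_p.+1 => M j j') QQ; rewrite !mxE => <-.
  by apply: eq_bigr => l _; rewrite mxE.
have := radial_law gX (card_ord _) mf f0 => <-.
apply: ge0_le_integral => //.
- apply: (measurable_mx_comp (F := fun M => h (sqn (col i (rinv M))))) => // i' j'.
  rewrite (_ : (fun t => _) = fun w' => if i' != i then G w i' j' else G w' i' j'); last first.
    by apply/funext => t; rewrite mxE.
  by case: (i' != i); [exact: measurable_cst|exact: (gaussian_mx_mmx gG)].
- apply: (measurableT_comp mf); apply: measurableT_comp; first exact: measurable_sqrt.
  by apply: measurable_sum => j; apply: measurable_funX; case: gX.
move=> w' _; set M := \matrix_(_, _) _.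
have rM : row i M = row i (G w') by apply/rowP => j; rewrite !mxE eqxx.
have XE : \sum_j X j w' ^+ 2 = sqn (row i M *m Q^T).
  rewrite /sqn big_ord1; apply: eq_bigr => j _; rewrite mxE rM; congr (_ ^+ 2).
  by apply: eq_bigr => l _; rewrite !mxE mulrC.
rewrite XE /f; case: eqP => [_|/eqP s0]; first by rewrite leey.
have D0 : sqn (row i M *m Q^T) != 0.
  by apply: contra s0 => /eqP ->; rewrite sqrtr0.
rewrite sqr_sqrtr ?sqn_ge0//; apply: hmon; first exact: sqn_ge0.
apply: rinv_col_le => // i' i'i.
have i'i2 : i != i' by rewrite eq_sym.
have [a ia _] := unlift_some i'i2.
have -> : row i' M = row a (row' i (G w)).
  by apply/rowP => j; rewrite !mxE i'i ia.
by rewrite -row_mul GQ row0.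
Qed.

(** Induction on the rows. If the Gram determinant vanishes while that of the rows other than row 0
    does not, row 0 is orthogonal to a unit vector depending only on those rows; after resampling
    row 0 this has probability 0. *)
Lemma gaussian_mx_det k n (G : T -> 'M[R]_(k, n)) : gaussian_mx G -> (k <= n)%N ->
  P [set w | \det (G w *m (G w)^T) == 0] = 0%E.
Proof.
elim: k G => [|k IH] G gG kn.
  rewrite (_ : [set w | _] = set0) ?measure0//.
  by apply/seteqP; split => w //=; rewrite det_mx00 oner_eq0.
have mb k' (M : T -> 'M[R]_(k', n)) : measurable_mx M ->
    measurable_fun setT (fun t => \det (M t *m (M t)^T) == 0).
  by move=> mM; apply: measurable_fun_eqr => //; exact: measurable_gram_det.
have mG := gaussian_mx_mmx gG.
have gG' : gaussian_mx (fun w => row' ord0 (G w)).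
  have := gaussian_mx_rows (f := lift ord0) gG (@lift_inj _ ord0).
  by congr (gaussian_mx _); apply/funext => w; apply/matrixP => i j; rewrite !mxE.
have IHw := IH _ gG' (ltnW kn).
pose b (M : 'M[R]_(k.+1, n)) :=
  (\det (M *m M^T) == 0) && (\det (row' ord0 M *m (row' ord0 M)^T) != 0).
have mbM d' (T' : measurableType d') (M : T' -> 'M[R]_(k.+1, n)) : measurable_mx M ->
    measurable_fun setT (fun t => b (M t)).
  move=> mM; apply: measurable_and.
    by apply: measurable_fun_eqr => //; exact: measurable_gram_det.
  apply: measurable_neg; apply: measurable_fun_eqr => //.
  by apply: measurable_gram_det; exact: measurable_mx_row'.
have b0 : P [set w | b (G w)] = 0%E.
  apply/eqP; rewrite eq_le measure_ge0 andbT prob_int; last exact: mbM.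
  apply: (gaussian_mx_decouple_le (D := fun i' => i' != ord0) (F := fun M => ((b M)%:R)%:E) gG) => //.
  - by apply: measurable_boolR; apply: mbM; exact: measurable_mx_of_coords.
  - move=> w; pose M (w' : T) : 'M[R]_(k.+1, n) := \matrix_(i, j) if i != ord0 then G w i j else G w' i j.
    have [Q QQ GQ] : exists2 Q : 'M[R]_(1, n), Q *m Q^T = 1%:M & row' ord0 (G w) *m Q^T = 0.
      by apply: orth_compl; rewrite addn1 (leq_trans _ kn)// ltnS; exact: rank_leq_row.
    have mM : measurable_mx M.
      move=> i j; rewrite /M (_ : (fun t => _) = fun w' => if i != ord0 then G w i j else G w' i j).
        by case: (i != ord0); [exact: measurable_cst|exact: mG].
      by apply/funext => t; rewrite mxE.
    apply: (@le_trans _ _ (\int[P]_w' (((\sum_j Q 0 j * G w' 0 j) == 0)%:R)%:E)%E).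
      apply: ge0_le_integral => //.
      - by apply: measurable_boolR; exact: mbM.
      - apply: measurable_boolR; apply: measurable_fun_eqr => //.
        by apply: measurable_sum => j; exact: measurable_funM.
      move=> w' _; rewrite -/(M w') lee_fin ler_nat; case: (boolP (b _)) => // /andP[/eqP d0 d1].
      have rM : row' ord0 (M w') = row' ord0 (G w) by apply/matrixP => i j; rewrite !mxE.
      have := singular_row0 (Q := Q) d0 d1; rewrite rM => /(_ GQ) /matrixP /(_ 0 0).
      rewrite !mxE (_ : \sum_j _ = \sum_j Q 0 j * G w' 0 j) => [->|]; first by rewrite eqxx.
      by apply: eq_bigr => j _; rewrite !mxE eqxx mulrC.
    rewrite (gaussian_comb (a := fun j => Q 0 j) (f := fun x => ((x == 0)%:R)%:E) (gaussian_mx_row 0 gG)).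
    - rewrite -(@prob_int _ _ _ gam (fun x : R => x == 0)); last exact: measurable_fun_eqr.
      have -> : [set t : R | t == 0] = [set 0] by apply/seteqP; split => x /= /eqP.
      by rewrite [X in (X <= _)%E]normal_set0.
    - have : sqn Q = 1 by rewrite sqn_row QQ mxE.
      by rewrite /sqn big_ord1.
    - by apply: measurable_boolR; exact: measurable_fun_eqr.
    - by move=> x; rewrite lee_fin.
apply/eqP; rewrite eq_le measure_ge0 andbT.
have mB1 := measurable_true (mb _ _ mG).
have mB2 := measurable_true (mb _ _ (gaussian_mx_mmx gG')).
have mB3 := measurable_true (mbM _ _ _ mG).
apply: (@le_trans _ _ (P ([set w | \det (row' ord0 (G w) *m (row' ord0 (G w))^T) == 0] `|`
   [set w | b (G w)]))).
  apply: le_measure; rewrite ?inE//; first exact: measurableU.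
  by move=> w /= h; rewrite /b h/=; case: eqP; [left|right].
have h1 : (P [set w | \det (row' ord0 (G w) *m (row' ord0 (G w))^T) == 0%R] + P [set w | b (G w)] <= 0)%E.
  by rewrite IHw b0 adde0.
exact: le_trans (measureU2 P mB2 mB3) h1.
Qed.

Lemma gpow_integral_le q (c : R) (f : R -> R) : 0 < c -> measurable_fun setT f ->
  (forall r, 0 <= r -> 0 <= f r <= gpow q 1 r / c) ->
  (\int[mu]_(r in `[0%R, +oo[) (f r)%:E <= (gmo q / c)%:E)%E.
Proof.
move=> c0 mf H.
apply: (@le_trans _ _ (\int[mu]_(r in `[0%R, +oo[) (c^-1%:E * (gpow q 1 r)%:E))%E).
  apply: ge0_le_integral => //.
  - by move=> r; rewrite /= in_itv/= andbT lee_fin => /H /andP[].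
  - by apply/measurable_EFinP; exact: measurable_funTS.
  - by apply/measurable_EFinP; apply: measurable_funM => //; apply: measurable_funTS; exact: measurable_gpow.
  - by move=> r; rewrite /= in_itv/= andbT -EFinM lee_fin mulrC => /H /andP[].
rewrite ge0_integralZl//; last 3 first.
- by apply/measurable_EFinP; apply: measurable_funTS; exact: measurable_gpow.
- by move=> r; rewrite /= in_itv/= andbT => r0; rewrite lee_fin gpow_ge0.
- by rewrite lee_fin invr_ge0 ltW.
by rewrite -/(gmom q) gmomE -EFinM mulrC.
Qed.

Lemma rinv_col_sqn_mean k p (G : T -> 'M[R]_(k, k + p)) i : gaussian_mx G -> (2 <= p)%N ->
  (\int[P]_w (sqn (col i (rinv (G w))))%:E <= ((p%:R - 1)^-1)%:E)%E.
Proof.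
move=> gG p2; have p0 := ltnW p2.
have := @col_bound _ p _ i (fun x => `|x|%:E) gG p0 => H.
under eq_integral => w _ do rewrite -[sqn _]ger0_norm ?sqn_ge0//.
apply: le_trans (H _ _ _) _.
- by apply/measurable_EFinP; exact: normr_measurable.
- by move=> x; rewrite lee_fin.
- by move=> x y x0 xy; rewrite lee_fin !ger0_norm// (le_trans x0).
case: p p2 {p0 H} G gG => [|[|p]]// _ G gG.
(* The mean of the inverse square of a chi variable with [p + 3] degrees of freedom, [p] having been
   shifted by 2. *)
have -> : ((p.+2%:R - 1)^-1 : R) = gmo p / gmo p.+2.
  rewrite gmoS invfM mulrCA divff ?lt0r_neq0 ?gmo_gt0// mulr1; congr (_^-1).
  by rewrite -natr1 addrK.
under eq_integral do rewrite -EFinM.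
apply: gpow_integral_le; first exact: gmo_gt0.
  apply: measurable_funM; last by apply: measurable_funM => //; exact: measurable_gpow.
  apply: measurableT_comp; first exact: normr_measurable.
  by apply: measurableT_comp; [exact: measurable_inv|exact: measurable_funX].
move=> r r0; apply/andP; split.
  by rewrite mulr_ge0// divr_ge0 ?gpow_ge0// ltW// gmo_gt0.
rewrite mulrA ler_pM2r ?invr_gt0 ?gmo_gt0//.
rewrite ger0_norm ?invr_ge0 ?sqr_ge0// /gpow (_ : r ^+ p.+2 = r ^+ 2 * r ^+ p); last first.
  by rewrite -exprD add2n.
set e := expR _; rewrite (_ : _ * _ = (r ^- 2 * r ^+ 2) * (r ^+ p * e)); last by rewrite !mulrA.
have [->|rN] := eqVneq r 0; last by rewrite mulVf ?mul1r// expf_neq0.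
rewrite [0 ^+ 2]expr0n/= mulr0 mul0r.
by rewrite mulr_ge0 ?expR_ge0// exprn_ge0.
Qed.

Lemma rinv_col_moment k p (G : T -> 'M[R]_(k, k + p)) i : gaussian_mx G -> (4 <= p)%N ->
  (\int[P]_w (Num.sqrt (sqn (col i (rinv (G w)))) ^+ p)%:E <=
    ((Num.sqrt (p.+1%:R / 3))^-1 ^+ p)%:E)%E.
Proof.
move=> gG p4; have p0 : (0 < p)%N by apply: leq_trans p4.
have := @col_bound _ p _ i (fun x => (Num.sqrt x ^+ p)%:E) gG p0 => H.
apply: le_trans (H _ _ _) _.
- by apply/measurable_EFinP; apply: measurable_funX; exact: measurable_sqrt.
- by move=> x; rewrite lee_fin exprn_ge0.
- by move=> x y x0 xy; rewrite lee_fin lerXn2r ?nnegrE ?sqrtr_ge0// ler_wsqrtr.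
apply: (@le_trans _ _ (gmo 0 / gmo p)%:E).
  under eq_integral do rewrite -EFinM.
  apply: gpow_integral_le; first exact: gmo_gt0.
    apply: measurable_funM; last by apply: measurable_funM => //; exact: measurable_gpow.
    apply: measurable_funX; apply: measurableT_comp; first exact: measurable_sqrt.
    by apply: measurableT_comp; [exact: measurable_inv|exact: measurable_funX].
  move=> r r0; apply/andP; split.
    by rewrite mulr_ge0 ?exprn_ge0// divr_ge0 ?gpow_ge0// ltW// gmo_gt0.
  rewrite mulrA ler_pM2r ?invr_gt0 ?gmo_gt0//.
  rewrite -exprVn sqrtr_sqr ger0_norm ?invr_ge0// /gpow expr0 [leLHS]mulrA.
  rewrite ler_pM2r ?expR_gt0// -exprMn.
  have [->|rN] := eqVneq r 0; last by rewrite mulVf// expr1n.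
  by rewrite mulr0 expr0n gtn_eqF.
have s0 : 0 < Num.sqrt (p.+1%:R / 3) :> R by rewrite sqrtr_gt0 divr_gt0.
rewrite lee_fin ler_pdivrMr ?gmo_gt0// exprVn mulrC ler_pdivlMr ?exprn_gt0//.
exact: gmo_ge_pow.
Qed.

(** Bernoulli's inequality for [z^2] with exponent [p / 2]. Summed over the columns of a right
    inverse it turns [sum z_i^2 >= k] into [sum z_i^p >= k]. *)
Lemma bernoulli_half (z : R) p : 0 <= z -> (2 <= p)%N -> 1 + p%:R / 2 * (z ^+ 2 - 1) <= z ^+ p.
Proof.
move=> z0; move: p; apply: nat_ind2.
- by lra.
- have : 0 <= (z - 1) ^+ 2 * (2 * z + 1) by rewrite mulr_ge0 ?sqr_ge0//; lra.
  by rewrite !exprS expr0; lra.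
move=> p p2 IH; rewrite -addn2 exprD natrD.
set s := z ^+ 2 - 1 in IH *; have -> : z ^+ 2 = 1 + s by rewrite /s addrC subrK.
have s1 : 0 <= 1 + s by rewrite /s addrC subrK sqr_ge0.
have pp : 0 <= p%:R :> R by [].
apply: le_trans (ler_wpM2r s1 IH).
have : 0 <= p%:R * s ^+ 2 by rewrite mulr_ge0// sqr_ge0.
by rewrite expr2; lra.
Qed.

Lemma markov_bool (b : T -> bool) (f : T -> R) (c C : R) : measurable_fun setT b ->
  measurable_fun setT f -> (forall w, 0 <= f w) -> 0 < c -> (forall w, b w -> c <= f w) ->
  (\int[P]_w (f w)%:E <= C%:E)%E -> (P [set w | b w] <= (C / c)%:E)%E.
Proof.
move=> mb mf f0 c0 H fC; rewrite (prob_int P mb).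
have c0' : (0 <= (c^-1)%:E)%E by rewrite lee_fin invr_ge0 ltW.
apply: (@le_trans _ _ (\int[P]_w ((c^-1)%:E * (f w)%:E))%E).
  apply: ge0_le_integral => //.
  - exact: measurable_boolR.
  - by apply/measurable_EFinP; exact: measurable_funM.
  move=> w _; rewrite -EFinM lee_fin mulrC ler_pdivlMr//.
  by case: (boolP (b w)) => [/H|_]; rewrite ?mul1r// mul0r.
rewrite ge0_integralZl//; last 2 first.
- by apply/measurable_EFinP.
- by move=> w _; rewrite lee_fin.
by rewrite EFinM muleC lee_wpmul2r.
Qed.

(** With [z_i = sqrt al |col i| / t], the event forces [sum z_i^2 >= k] and so [sum z_i^p >= k],
    while each [z_i^p] has mean at most [t^-p] by [rinv_col_moment]. Markov's inequality divides the
    [k] means by [k], which avoids the factor [k] of a union bound. *)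
Lemma rinv_sqn_tail k p (G : T -> 'M[R]_(k, k + p)) (t : R) : gaussian_mx G -> (4 <= p)%N ->
  (0 < k)%N -> 0 < t ->
  (P [set w | (t ^+ 2 * (3 * k%:R / p.+1%:R) < sqn (rinv (G w)))%R] <= (t ^- p)%:E)%E.
Proof.
move=> gG p4 k0 t0; have mN := measurable_mx_rinv (gaussian_mx_mmx gG).
set al : R := p.+1%:R / 3; have al0 : 0 < al by rewrite divr_gt0.
have kR : 0 < k%:R :> R by rewrite ltr0n.
pose f w := \sum_i (Num.sqrt al * Num.sqrt (sqn (col i (rinv (G w)))) / t) ^+ p.
have sal : 0 < Num.sqrt al by rewrite sqrtr_gt0.
have g0 i w : 0 <= Num.sqrt al * Num.sqrt (sqn (col i (rinv (G w)))) / t.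
  by rewrite divr_ge0 ?(ltW t0)// mulr_ge0.
have f0 w : 0 <= f w.
  by apply: sumr_ge0 => i _; rewrite exprn_ge0.
have mfi i : measurable_fun setT (fun w => Num.sqrt (sqn (col i (rinv (G w))))).
  apply: measurableT_comp; first exact: measurable_sqrt.
  by apply: measurable_sqn; exact: measurable_mx_col.
have mf : measurable_fun setT f.
  apply: measurable_sum => i; apply: measurable_funX; apply: measurable_funM => //.
  exact: measurable_funM.
have -> : t ^- p = (k%:R * t ^- p) / k%:R by rewrite mulrC mulrA mulVf ?mul1r ?lt0r_neq0.
apply: (@markov_bool _ f) => //.
- apply: measurable_fun_ltr => //; exact: measurable_sqn.
- move=> w; have -> : sqn (rinv (G w)) = \sum_i sqn (col i (rinv (G w))).
    rewrite -sqn_tr /sqn; apply: eq_bigr => i _; rewrite exchange_big big_ord1.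
    by apply: eq_bigr => j _; rewrite !mxE.
  rewrite /f => h.
  apply: (@le_trans _ _ (\sum_(i < k) (1 + p%:R / 2 * (al * sqn (col i (rinv (G w))) / t ^+ 2 - 1)))); last first.
    apply: ler_sum => i _; apply: le_trans (bernoulli_half _ _); last 2 first.
    - exact: g0.
    - by apply: leq_trans p4.
    by rewrite exprMn exprMn !sqr_sqrtr ?sqn_ge0 ?(ltW al0)// exprVn.
  rewrite big_split/= sumr_const card_ord lerDl -mulr_sumr mulr_ge0//.
  rewrite sumrB sumr_const card_ord -mulr_suml -mulr_sumr subr_ge0.
  rewrite ler_pdivlMr ?exprn_gt0// mulrC.
  move: h; move: (\sum_i _) => S; rewrite /al => /ltW h.
  have := ler_wpM2l (ltW al0) h; rewrite /al; congr (_ <= _); field.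
  by rewrite addrC natr1 pnatr_eq0.
- rewrite /f; under eq_integral do rewrite -sumEFin.
  rewrite ge0_integral_sum//; last 2 first.
  - move=> i; apply/measurable_EFinP; apply: measurable_funX; apply: measurable_funM => //.
    exact: measurable_funM.
  - by move=> i w _; rewrite lee_fin exprn_ge0.
  have -> : ((k%:R * t ^- p)%:E = \sum_(i < k) (t ^- p)%:E)%E.
    by rewrite sumEFin sumr_const card_ord mulr_natl.
  apply: lee_sum => i _.
  have c0 : (0 <= ((Num.sqrt al / t) ^+ p)%:E)%E by rewrite lee_fin exprn_ge0// divr_ge0// ltW.
  under eq_integral do rewrite mulrAC exprMn EFinM.
  rewrite ge0_integralZl//; last by apply/measurable_EFinP; exact: measurable_funX.
  apply: le_trans (lee_wpmul2l c0 (rinv_col_moment i gG p4)) _.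
  rewrite -EFinM lee_fin -/al -exprMn mulrAC divff ?mul1r ?exprVn// lt0r_neq0//.
Qed.

End gaussian_matrices.

(** * Tail of the operator norm of the right inverse *)

Section operator_norm.
Context {R : realType} d (T : measurableType d) (P : probability T R).
Notation mu := (@lebesgue_measure R).
Notation gam := (normal_prob (0 : R) 1).

Lemma cauchy_schwarz_col n (u v : 'cV[R]_n) : (u^T *m v) 0 0 ^+ 2 <= sqn u * sqn v.
Proof. by have := cauchy_schwarz_row u^T v^T; rewrite trmxK !sqn_tr. Qed.

(** Let [U] be orthogonal with row [i0] along [z]. Then [N z] is [|z|] times column [i0] of
    [rinv (U G)], and [U G] has the law of [G]. So [col_bound] applies, with an indicator, and
    [gpow_cut] bounds the probability that a chi variable is small. *)
Lemma rinv_fixed_small k p (G : T -> 'M[R]_(k, k + p)) (i0 : 'I_k) (z : 'cV[R]_k) (th : R) :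
  gaussian_mx P G -> (0 < p)%N -> 0 < th ->
  (\int[P]_w ((th <= sqn (rinv (G w) *m z))%R%:R)%:E <=
   ((Num.sqrt (sqn z) / Num.sqrt th) ^+ p.+1 / (p.+1%:R * gmo p))%:E)%E.
Proof.
move=> gG p0 th0; have [->|z0] := eqVneq z 0.
  rewrite (eq_integral (cst 0%E)); last first.
    move=> w _; rewrite mulmx0 (_ : sqn 0 = 0); first by rewrite leNgt th0.
    by rewrite sqn_col mulmx0 mxE.
  by rewrite integral0 lee_fin divr_ge0 ?exprn_ge0 ?divr_ge0// mulr_ge0// ltW// gmo_gt0.
have sz := sqn_gt0 z0; pose c := Num.sqrt (sqn z); have c0 : 0 < c by rewrite sqrtr_gt0.
have c2 : c ^+ 2 = sqn z by rewrite sqr_sqrtr// ltW.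
pose v := c^-1 *: z^T.
have v1 : sqn v = 1 by rewrite sqnZ sqn_tr exprVn c2 mulVf// lt0r_neq0.
have [U UU rU] := householder i0 v1.
have zE : z = c *: (row i0 U)^T.
  by rewrite rU /v linearZ/= trmxK scalerA divff ?scale1r// lt0r_neq0.
have Uz : U *m z = c *: delta_mx i0 0.
  have e : U *m (row i0 U)^T = delta_mx i0 0.
    by rewrite -[LHS]trmxK trmx_mul trmxK -row_mul UU row1 trmx_delta.
  by rewrite zE -scalemxAr e.
have Nz w : rinv (G w) *m z = c *: col i0 (rinv (U *m G w)).
  by rewrite colE scalemxAr -Uz rinv_orth// mulmxA -(mulmxA _ U^T) (orth_tr UU) mulmx1.
pose rho := c / Num.sqrt th; have rho0 : 0 < rho by rewrite divr_gt0// sqrtr_gt0.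
have rho2 : rho ^+ 2 = c ^+ 2 / th by rewrite exprMn exprVn (sqr_sqrtr (ltW th0)).
have mb : measurable_fun setT (fun x : R => (th <= c ^+ 2 * x)%R).
  by apply: measurable_fun_ler => //; exact: measurable_funM.
have := @col_bound _ _ _ P k p _ i0 (fun x => ((th <= c ^+ 2 * x)%R%:R)%:E) (gaussian_mx_orth gG UU) p0.
move=> /(_ (measurable_boolR mb)) H.
under eq_integral do rewrite Nz sqnZ.
apply: le_trans (H _ _) _.
- by move=> x; rewrite lee_fin.
- move=> x y x0 xy; rewrite lee_fin ler_nat; case: leP => // h.
  by rewrite (le_trans h)// ler_wpM2l// sqr_ge0.
apply: (@le_trans _ _ (\int[mu]_(r in `[0%R, +oo[) ((gmo p)^-1%:E * ((r <= rho)%R%:R * gpow p 1 r)%:E))%E).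
  apply: ge0_le_integral => //.
  - move=> r; rewrite /= in_itv/= andbT => r0.
    by rewrite -EFinM lee_fin mulr_ge0// divr_ge0 ?gpow_ge0// ltW// gmo_gt0.
  - apply: measurable_funTS; apply: emeasurable_funM.
      apply: measurable_boolR; apply: measurable_fun_ler => //; apply: measurable_funM => //.
      by apply: measurableT_comp; [exact: measurable_inv|exact: measurable_funX].
    by apply/measurable_EFinP; apply: measurable_funM => //; exact: measurable_gpow.
  - apply: measurable_funTS; apply/measurable_EFinP; apply: measurable_funM => //.
    apply: measurable_funM; last exact: measurable_gpow.
    by apply/measurable_EFinP; apply: measurable_boolR; exact: measurable_fun_ler.
  move=> r; rewrite /= in_itv/= andbT => r0; rewrite -!EFinM lee_fin.
  have imp : (th <= c ^+ 2 * r ^- 2) -> r <= rho.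
    have [->|rN] := eqVneq r 0; first by rewrite [0 ^+ 2]expr0n/= invr0 mulr0 leNgt th0.
    have rp : 0 < r by rewrite lt_neqAle eq_sym rN.
    move=> h; rewrite -(@ler_pXn2r _ 2) ?nnegrE// ?(ltW rho0)// rho2.
    by move: h; rewrite !ler_pdivlMr ?exprn_gt0// mulrC.
  case: (boolP (th <= _)) => [/imp ->|_]; first by rewrite !mul1r mulrC.
  by rewrite mul0r mulr_ge0 ?invr_ge0 ?(ltW (gmo_gt0 _))// mulr_ge0// gpow_ge0.
rewrite ge0_integralZl//; last 3 first.
- apply/measurable_EFinP; apply: measurable_funTS; apply: measurable_funM; last exact: measurable_gpow.
  by apply/measurable_EFinP; apply: measurable_boolR; exact: measurable_fun_ler.
- by move=> r; rewrite /= in_itv/= andbT => r0; rewrite lee_fin mulr_ge0// gpow_ge0.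
- by rewrite lee_fin invr_ge0 ltW// gmo_gt0.
apply: le_trans (lee_wpmul2l _ (gpow_cut _ rho0)) _; first by rewrite lee_fin invr_ge0 ltW// gmo_gt0.
by rewrite -EFinM lee_fin -/c -/rho invfM mulrC -mulrA.
Qed.

(* [N Z] is tested against [N v]: its inner product with [N v] is that of [Z] with
   [N^T N v]. *)
Lemma small_ball_lower k n (N : 'M[R]_(n, k)) (Z : T -> 'cV[R]_k) (v : 'cV[R]_k) (s m : R) :
  gaussian P (fun i w => Z w i 0) -> 1 <= m -> s ^+ 2 * sqn v < sqn (N *m v) ->
  ((2 * normal_peak 1 * (Num.sqrt m / (1 + m) * expR (- (m / 2))))%:E <=
   \int[P]_w ((m * s ^+ 2 <= sqn (N *m Z w))%R%:R)%:E)%E.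
Proof.
move=> gZ m1; set A := sqn (N *m v) => sA.
have m0 : 0 <= m by lra.
have mmZ : measurable_mx Z by move=> i j; rewrite ord1; case: gZ.
pose q := N^T *m (N *m v).
have A0 : 0 < A by apply: le_lt_trans sA; rewrite mulr_ge0 ?sqr_ge0 ?sqn_ge0.
have vq : (v^T *m q) 0 0 = A by rewrite /q mulmxA -trmx_mul -sqn_col.
have Aq : A ^+ 2 <= sqn v * sqn q by rewrite -vq; exact: cauchy_schwarz_col.
have q0 : 0 < sqn q.
  rewrite lt_neqAle sqn_ge0 andbT eq_sym; apply/eqP => q0; move: Aq; rewrite q0 mulr0.
  by rewrite leNgt exprn_gt0.
have sAq : s ^+ 2 * A <= sqn q.
  rewrite -(ler_pM2r A0) -mulrA -expr2.
  apply: le_trans (ler_wpM2l (sqr_ge0 s) Aq) _; rewrite mulrA mulrC ler_pM2l// ltW//.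
pose c := Num.sqrt (sqn q); have c0 : 0 < c by rewrite sqrtr_gt0.
have c2 : c ^+ 2 = sqn q by rewrite sqr_sqrtr// ltW.
have a1 : \sum_i (q i 0 / c) ^+ 2 = 1.
  under eq_bigr do rewrite exprMn exprVn c2.
  rewrite -mulr_suml; have -> : \sum_i q i 0 ^+ 2 = sqn q.
    by rewrite /sqn; apply: eq_bigr => i _; rewrite big_ord1.
  by rewrite divff// lt0r_neq0.
have mb : measurable_fun setT (fun x : R => (Num.sqrt m <= `|x|)%R).
  by apply: measurable_fun_ler.
have sm1 : 1 <= Num.sqrt m by rewrite -sqrtr1 ler_wsqrtr.
have := normal_tail sm1; rewrite sqr_sqrtr// => /le_trans; apply.
rewrite (prob_int gam mb).
rewrite -(gaussian_comb (f := fun x => ((Num.sqrt m <= `|x|)%R%:R)%:E) gZ a1); last 2 first.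
- exact: measurable_boolR.
- by move=> x; rewrite lee_fin.
apply: ge0_le_integral => //.
- apply: (measurableT_comp (measurable_boolR mb)).
  by apply: measurable_sum => i; apply: measurable_funM => //; case: gZ.
- apply: measurable_boolR; apply: measurable_fun_ler => //; apply: measurable_sqn.
  by apply: measurable_mx_mul => //; exact: measurable_mx_cst.
move=> w _; rewrite lee_fin ler_nat; set x := \sum_i _.
have xE : x = (q^T *m Z w) 0 0 / c.
  rewrite /x [X in _ = X / _]mxE mulr_suml; apply: eq_bigr => i _.
  by rewrite (_ : q^T 0 i = q i 0) 1?mulrAC// [LHS]mxE.
case: leP => //= h; rewrite lt0b.
have h2 : m <= x ^+ 2.
  by rewrite -[leLHS](sqr_sqrtr m0) -[leRHS]real_normK ?num_real// lerXn2r ?nnegrE.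
have h3 : (q^T *m Z w) 0 0 ^+ 2 <= A * sqn (N *m Z w).
  have -> : q^T *m Z w = (N *m v)^T *m (N *m Z w).
    by rewrite /q trmx_mul trmxK -!mulmxA.
  exact: cauchy_schwarz_col.
(* The chain is [|N Z|^2 >= <q, Z>^2 / A >= m |q|^2 / A >= m s^2], with [A = |N v|^2]. *)
have h4 : m * sqn q <= A * sqn (N *m Z w).
  apply: le_trans h3; rewrite -c2 -ler_pdivlMr ?exprn_gt0// -exprVn -exprMn -xE.
  exact: h2.
rewrite -(ler_pM2l A0); apply: le_trans h4; rewrite mulrCA ler_wpM2l//.
by rewrite mulrC.
Qed.

(* [B] is a measurable event containing the event, defined by an uncountable
   quantifier, that [rinv (G w)] has a large operator norm. *)
Lemma rinv_op_tail k p (G : T -> 'M[R]_(k.+1, k.+1 + p)) (t : R) : gaussian_mx P G -> (4 <= p)%N -> 0 < t ->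
  exists B : 'M[R]_(k.+1, k.+1 + p) -> bool,
  [/\ measurable_fun setT (fun x => B (@mx_of_coords R k.+1 (k.+1 + p) x)),
    (P [set w | B (G w)] <= (t ^- p.+1)%:E)%E &
    forall M, ~~ B M -> forall v : 'cV[R]_k.+1, sqn (rinv M *m v) <=
      (t * (expR 1 * Num.sqrt (k + p.+1)%:R / p.+1%:R)) ^+ 2 * sqn v].
Proof.
move=> gG p4 t0; pose s := t * (expR 1 * Num.sqrt (k + p.+1)%:R / p.+1%:R).
have s0 : 0 < s.
  by rewrite mulr_gt0// divr_gt0// mulr_gt0 ?expR_gt0// sqrtr_gt0 ltr0n addnS.
(* Testing at height [sqrt m] gains [m^((p+1)/2)] in the upper bound and costs [e^(-m/2)] in the
   lower one; the product is largest at [m = p + 1]. *)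
pose m : R := p.+1%:R; have m1 : 1 <= m by rewrite ler1n.
have m0 : 0 < m by rewrite ltr0n.
pose th := m * s ^+ 2; have th0 : 0 < th by rewrite mulr_gt0// exprn_gt0.
have sth : Num.sqrt th = Num.sqrt m * s.
  by rewrite sqrtrM ?(ltW m0)// sqrtr_sqr gtr0_norm.
pose c : R := 2 * normal_peak 1 * (Num.sqrt m / (1 + m) * expR (- (m / 2))).
have c0 : 0 < c.
  have h1 : 0 < 1 + m by lra.
  have pk := @peak1_gt0 R.
  by rewrite /c mulr_gt0 ?mulr_gt0 ?expR_gt0 ?pk ?invr_gt0 ?sqrtr_gt0.
pose j0 : 'I_(k.+1 + p) := lshift p ord0.
(* The first column of [G] serves as a standard Gaussian vector. It is independent of the argument
   of [Phi], which integrates it over a separate variable [w']. *)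
pose Z w : 'cV[R]_k.+1 := \col_i G w i j0.
have gZ : gaussian P (fun i w => Z w i 0).
  have := gaussian_reindex (f := fun i : 'I_k.+1 => (i, j0)) gG.
  rewrite /gaussian_mx; under [X in _ -> gaussian P X]eq_fun do under eq_fun do rewrite mxE.
  by apply => a b [].
have mG := gaussian_mx_mmx gG.
have mZ : measurable_mx Z by move=> i j; rewrite ord1; case: gZ.
pose Phi (M : 'M[R]_(k.+1, k.+1 + p)) := (\int[P]_w' ((th <= sqn (rinv M *m Z w'))%R%:R)%:E)%E.
have mb d' (T' : measurableType d') (M : T' -> 'M[R]_(k.+1, k.+1 + p)) : measurable_mx M ->
    measurable_fun setT (fun w : T' * T => ((th <= sqn (rinv (M w.1) *m Z w.2))%R%:R : R)%:E).
  move=> mM; apply: measurable_boolR; apply: measurable_fun_ler => //; apply: measurable_sqn.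
  apply: measurable_mx_mul.
    by move=> i j; exact: (measurableT_comp (measurable_mx_rinv mM i j) measurable_fst).
  by move=> i j; exact: (measurableT_comp (mZ i j) measurable_snd).
have b0 x : (0 <= ((th <= x)%R%:R : R)%:E)%E by rewrite lee_fin.
have mPhi d' (T' : measurableType d') (M : T' -> 'M[R]_(k.+1, k.+1 + p)) : measurable_mx M ->
    measurable_fun setT (fun w => Phi (M w)).
  move=> mM; have := @measurable_fun_fubini_tonelli_F _ _ T' T R P _ (mb _ _ _ mM).
  by apply.
have mB d' (T' : measurableType d') (M : T' -> 'M[R]_(k.+1, k.+1 + p)) : measurable_mx M ->
    measurable_fun setT (fun w => (c%:E <= Phi (M w))%E).
  move=> mM; have -> : (fun w => (c%:E <= Phi (M w))%E) = fun w => ~~ (Phi (M w) < c%:E)%E.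
    by apply/funext => w; rewrite leNgt.
  by apply: measurable_neg; apply: measurable_fun_lte => //; exact: mPhi.
(* By Fubini's theorem [z] may be fixed first and [G] averaged, which leaves the moment of order
   [p + 1] of [|z|]. *)
have EPhi : (\int[P]_w Phi (G w) <= (c * t ^- p.+1)%:E)%E.
  rewrite /Phi (@fubini_tonelli _ _ T T R P P _ (mb _ _ _ mG))//.
  apply: (@le_trans _ _ (\int[P]_w' ((Num.sqrt (\sum_i Z w' i 0 ^+ 2) ^+ p.+1 /
      (Num.sqrt th ^+ p.+1 * (p.+1%:R * gmo p)))%:E))%E).
    apply: ge0_le_integral => //.
    - by move=> w' _; apply: integral_ge0.
    - have := @measurable_fun_fubini_tonelli_G _ _ T T R P _ (mb _ _ _ mG).
      by apply.
    - apply/measurable_EFinP; apply: measurable_funM => //; apply: measurable_funX.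
      apply: measurableT_comp; first exact: measurable_sqrt.
      by apply: measurable_sum => i; exact: measurable_funX.
    move=> w' _; apply: le_trans (rinv_fixed_small ord0 (Z w') gG _ th0) _; first exact: ltn_trans p4.
    rewrite lee_fin exprMn exprVn -mulrA -invfM (_ : sqn _ = \sum_i Z w' i 0 ^+ 2)//.
    by apply: eq_bigr => i _; rewrite big_ord1.
  pose C : R := (Num.sqrt th ^+ p.+1 * (p.+1%:R * gmo p))^-1.
  have C0 : 0 < C by rewrite invr_gt0 mulr_gt0 ?exprn_gt0 ?sqrtr_gt0// mulr_gt0// gmo_gt0.
  under eq_integral => w _ do rewrite -/C -[Num.sqrt (\sum_i _)]ger0_norm//.
  rewrite (radial_law (f := fun x => (`|x| ^+ p.+1 * C)%:E) gZ (card_ord _)); last 2 first.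
  - apply/measurable_EFinP; apply: measurable_funM => //; apply: measurable_funX.
    exact: normr_measurable.
  - by move=> x; rewrite lee_fin mulr_ge0 ?exprn_ge0// ltW.
  apply: (@le_trans _ _ (gmo (k + p.+1) / (gmo k / C))%:E).
    under eq_integral do rewrite -EFinM.
    apply: gpow_integral_le; first by rewrite divr_gt0// gmo_gt0.
      apply: measurable_funM; last by apply: measurable_funM => //; exact: measurable_gpow.
      by apply: measurable_funM => //; apply: measurable_funX; exact: normr_measurable.
    move=> r r0; have h1 : 0 <= `|r| ^+ p.+1 * C by rewrite mulr_ge0 ?exprn_ge0 ?(ltW C0).
    have h2 : 0 <= gpow k 1 r / gmo k by rewrite divr_ge0 ?gpow_ge0// ltW// gmo_gt0.
    rewrite (mulr_ge0 h1 h2)/=.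
    rewrite ger0_norm// invfM invrK /gpow exprD le_eqVlt; apply/orP; left; apply/eqP.
    by ring.
  have -> : gmo (k + p.+1) / (gmo k / C) =
      gmo (k + p.+1) / gmo k / (p.+1%:R * gmo p) * (Num.sqrt m * s) ^- p.+1.
    by rewrite /C -sth [X in _ / X = _]mulrC invfM !invrK invfM; ring.
  rewrite lee_fin; apply: le_trans (small_ball_tradeoff k p4 t0) _.
  by rewrite /c -/m gmo0 invrK.
exists (fun M => (c%:E <= Phi M)%E); split.
- by apply: mB; exact: measurable_mx_of_coords.
- have mBG := mB _ _ _ mG.
  rewrite (prob_int P mBG).
  have : (\int[P]_w (c%:E * ((c%:E <= Phi (G w))%E%:R)%:E) <= (c * t ^- p.+1)%:E)%E.
    apply: le_trans EPhi; apply: ge0_le_integral => //.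
    - by move=> w _; rewrite -EFinM lee_fin mulr_ge0// ltW.
    - by apply: emeasurable_funM => //; exact: measurable_boolR.
    - exact: mPhi.
    move=> w _; case: (boolP (c%:E <= _)%E) => h; first by rewrite mule1.
    by rewrite mule0; exact: integral_ge0.
  rewrite ge0_integralZl//; last 2 first.
  - exact: measurable_boolR.
  - by rewrite lee_fin ltW.
  by move=> h; rewrite -(@lee_pmul2l _ c%:E)// -EFinM.
- move=> M; rewrite -ltNge => BM v; rewrite leNgt; apply/negP => h.
  by move: BM; rewrite ltNge (small_ball_lower gZ m1 h).
Qed.

End operator_norm.

(** * Exponential moments and tails of Gaussian quadratic forms *)

Section gaussian_concentration.
Context {R : realType} d (T : measurableType d) (P : probability T R).

Lemma sqn_rowE m n (M : 'M[R]_(m, n)) j : sqn (row j M) = (M *m M^T) j j.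
Proof. by rewrite /sqn big_ord1 mxE; apply: eq_bigr => l _; rewrite !mxE expr2. Qed.

Lemma row_diag_mul m n (e : 'rV[R]_m) (M : 'M[R]_(m, n)) j :
  row j (diag_mx e *m M) = e 0 j *: row j M.
Proof. by rewrite mul_diag_mx; apply/rowP => l; rewrite !mxE. Qed.

Lemma gaussian_mx_tr k n (G : T -> 'M[R]_(k, n)) : gaussian_mx P G -> gaussian_mx P (fun w => (G w)^T).
Proof.
move=> gG.
have := gaussian_reindex (f := fun ji : 'I_n * 'I_k => (ji.2, ji.1)) gG.
rewrite /gaussian_mx; under [X in _ -> gaussian P X]eq_fun do under eq_fun do rewrite mxE.
by apply => -[a b] [a' b'] [-> ->].
Qed.

Lemma gaussian_mx_orthr k n (G : T -> 'M[R]_(k, n)) (U : 'M[R]_n) : gaussian_mx P G -> U *m U^T = 1%:M ->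
  gaussian_mx P (fun w => G w *m U^T).
Proof.
move=> gG UU; have := gaussian_mx_tr (gaussian_mx_orth (gaussian_mx_tr gG) UU); congr (gaussian_mx P _).
by apply/funext => w; rewrite trmx_mul trmxK.
Qed.

(** At [y = 1 - 2 l] one has [1 / y = 1 + 2 l / y <= exp (2 l / y)], and [y >= 1 - q]; then take
    square roots. *)
Lemma inv_sqrt_le_expR (l q : R) : 0 <= l -> 2 * l <= q -> q < 1 ->
  (Num.sqrt (1 - 2 * l))^-1 <= expR (l / (1 - q)).
Proof.
move=> l0 lq q1; pose y := 1 - 2 * l; have y0 : 0 < y by rewrite /y; lra.
have q0 : 0 < 1 - q by lra.
have h : y^-1 <= expR (l / (1 - q)) ^+ 2.
  apply: (@le_trans _ _ (1 + 2 * l / y)).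
    have -> : 1 + 2 * l / y = (y + 2 * l) / y by field; rewrite lt0r_neq0.
    by rewrite /y subrK mul1r.
  apply: le_trans (expR_ge1Dx _) _; rewrite -expRM_natl ler_expR -mulrA ler_pM2l// ler_wpM2l//.
  by rewrite lef_pV2 ?posrE// /y; lra.
rewrite -[leRHS]ger0_norm ?expR_ge0// -sqrtr_sqr -sqrtrV ?(ltW y0)//.
exact: ler_wsqrtr.
Qed.

(** Diagonalising [N N^T] by [U] turns the exponent into a weighted sum of squares of the entries of
    [W U^T], again a Gaussian matrix, whose exponential moments factor. The eigenvalues add up to
    [sqn N] and are at most [b^2]. *)
Lemma gaussian_quad_exp L n k (W : T -> 'M[R]_(L, n)) (N : 'M[R]_(n, k)) (s : 'I_L -> R) (sg b l : R) :
  gaussian_mx P W -> (forall i, 0 <= s i <= sg) -> 0 <= l ->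
  (forall v : 'cV[R]_k, sqn (N *m v) <= b ^+ 2 * sqn v) -> 2 * l * (sg * b) ^+ 2 < 1 ->
  (\int[P]_w (expR (l * \sum_i s i ^+ 2 * sqn (row i (W w) *m N)))%:E <=
   (expR (l * (\sum_i s i ^+ 2) * sqn N / (1 - 2 * l * (sg * b) ^+ 2)))%:E)%E.
Proof.
move=> gW s0 l0 Nb lb.
have Nsym : (N *m N^T)^T = N *m N^T by rewrite trmx_mul trmxK.
have [U [e [UU NE]]] := real_spectral Nsym.
have UtU := orth_tr UU.
pose B := U *m N.
have BB : B *m B^T = diag_mx e.
  rewrite /B trmx_mul mulmxA -(mulmxA U N) NE !mulmxA UU mul1mx -mulmxA UU mulmx1//.
have rB j : row j U *m N = row j B by rewrite /B row_mul.
have eE j : e 0 j = sqn (row j B).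
  by rewrite sqn_rowE BB mxE eqxx mulr1n.
(* As [e_j = |row j B|^2], the hypothesis [Nb] at that row reads [e_j^2 <= b^2 e_j]. *)
have eb j : 0 <= e 0 j <= b ^+ 2.
  rewrite [in X in X && _]eE sqn_ge0/=.
  have [->|ej] := eqVneq (e 0 j) 0; first exact: sqr_ge0.
  have ep : 0 < e 0 j by rewrite lt_neqAle eq_sym ej eE sqn_ge0.
  have := Nb (row j B)^T; rewrite sqn_tr -eE.
  have -> : N *m (row j B)^T = e 0 j *: (row j U)^T.
    rewrite -[LHS]trmxK trmx_mul trmxK -rB -mulmxA NE -row_mul !mulmxA UU mul1mx.
    by rewrite row_diag_mul linearZ.
  rewrite sqnZ sqn_tr; have -> : sqn (row j U) = 1.
    by rewrite sqn_rowE UU mxE eqxx.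
  by rewrite mulr1 expr2 ler_pM2r.
have trE : \sum_j e 0 j = sqn N.
  by rewrite sqnE NE mxtrace_mulC mulmxA UU mul1mx mxtrace_diag.
have gZ := gaussian_mx_orthr gW UU.
have qE w i : sqn (row i (W w) *m N) = \sum_j e 0 j * (W w *m U^T) i j ^+ 2.
  pose z := row i (W w *m U^T).
  have -> : row i (W w) *m N = z *m B by rewrite /z /B row_mul mulmxA -(mulmxA _ U^T) UtU mulmx1.
  rewrite sqn_row trmx_mul mulmxA -(mulmxA z) BB mul_mx_diag [LHS]mxE.
  by apply: eq_bigr => j _; rewrite !mxE expr2 mulrAC mulrC.
pose q := 2 * l * (sg * b) ^+ 2.
have q0 : 0 < 1 - q by rewrite /q; lra.
have lij i j : 2 * (l * (s i ^+ 2 * e 0 j)) <= q.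
  rewrite mulrA /q exprMn ler_wpM2l ?mulr_ge0//.
  have /andP[s1 s2] := s0 i; have /andP[e1 e2] := eb j.
  by rewrite ler_pM ?sqr_ge0// lerXn2r ?nnegrE// (le_trans s1).
have lij0 i j : 0 <= l * (s i ^+ 2 * e 0 j).
  by have /andP[e1 e2] := eb j; rewrite mulr_ge0// mulr_ge0// sqr_ge0.
pose f (ij : 'I_L * 'I_n) (x : R) := expR (l * (s ij.1 ^+ 2 * e 0 ij.2) * x ^+ 2).
have := @gaussian_prod _ _ _ P _ _ (index_enum _) f gZ (index_enum_uniq _).
have mf ij : measurable_fun setT (f ij).
  by apply: measurableT_comp => //; apply: measurable_funM => //; exact: measurable_funX.
have f0 ij x : 0 <= f ij x by exact: expR_ge0.
move=> /(_ mf f0) H.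
under eq_integral => w _.
  rewrite (_ : expR _ = \prod_ij f ij ((W w *m U^T) ij.1 ij.2)); last first.
    rewrite -expR_sum -(pair_bigA _ (fun i j => l * (s i ^+ 2 * e 0 j) * (W w *m U^T) i j ^+ 2))/=.
    rewrite mulr_sumr; congr expR; apply: eq_bigr => i _; rewrite qE !mulr_sumr.
    by apply: eq_bigr => j _; rewrite !mulrA.
  over.
rewrite H {H}.
under eq_bigr => ij _.
  rewrite /f normal_expR_sqr; last by have := lij ij.1 ij.2; lra.
  over.
rewrite prodEFin lee_fin.
apply: (@le_trans _ _ (\prod_(ij : 'I_L * 'I_n) expR (l * (s ij.1 ^+ 2 * e 0 ij.2) / (1 - q)))).
  apply: ler_prod => ij _; rewrite invr_ge0 sqrtr_ge0/=.
  by apply: inv_sqrt_le_expR => //; rewrite -subr_gt0.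
rewrite -expR_sum ler_expR -mulr_suml -/q ler_pM2r ?invr_gt0// -trE -mulr_sumr -mulrA ler_wpM2l//.
rewrite -(pair_bigA _ (fun i j => s i ^+ 2 * e 0 j))/= mulr_suml le_eqVlt; apply/orP; left; apply/eqP.
by apply: eq_bigr => i _; rewrite mulr_sumr.
Qed.

Lemma gaussian_quad_tail L n k (W : T -> 'M[R]_(L, n)) (N : 'M[R]_(n, k)) (s : 'I_L -> R)
    (sg tau a b u : R) :
  gaussian_mx P W -> (forall i, 0 <= s i <= sg) -> 0 <= sg -> 0 <= tau -> 0 <= a -> 0 <= b -> 0 < u ->
  \sum_i s i ^+ 2 <= tau ^+ 2 -> sqn N <= a ^+ 2 ->
  (forall v : 'cV[R]_k, sqn (N *m v) <= b ^+ 2 * sqn v) ->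
  (P [set w | ((tau * a + u * (sg * b)) ^+ 2 < \sum_i s i ^+ 2 * sqn (row i (W w) *m N))%R] <=
   (expR (- (u ^+ 2 / 2)))%:E)%E.
Proof.
move=> gW s0 sg0 tau0 a0 b0 u0 stau Na Nb.
pose A := tau * a; pose be := sg * b.
have A0 : 0 <= A by rewrite mulr_ge0.
have be0 : 0 <= be by rewrite mulr_ge0.
pose S w := \sum_i s i ^+ 2 * sqn (row i (W w) *m N).
have sS0 : (forall i, s i = 0) -> forall w, S w = 0.
  by move=> h w; apply: big1 => i _; rewrite h expr0n mul0r.
have NS0 : N = 0 -> forall w, S w = 0.
  move=> h w; apply: big1 => i _; rewrite h mulmx0 (_ : sqn 0 = 0) ?mulr0//.
  by rewrite sqn_row mul0mx mxE.
have S_triv : (forall w, S w = 0) -> (P [set w | ((A + u * be) ^+ 2 < S w)%R] <= (expR (- (u ^+ 2 / 2)))%:E)%E.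
  move=> h; rewrite (_ : [set w | _] = set0) ?measure0 ?lee_fin ?expR_ge0//.
  by apply/seteqP; split => w //=; rewrite h ltNge sqr_ge0.
(* If [tau], [a], [sg] or [b] vanishes, so does the sum. These cases are removed because [l] and
   [A / D] below need [be] and [A] positive. *)
have [t0|tN] := eqVneq tau 0.
  apply: S_triv; apply: sS0 => i; move: stau; rewrite t0 expr0n/= => h.
  have /psumr_eq0P H : forall i : 'I_L, true -> 0 <= s i ^+ 2 by move=> ? _; exact: sqr_ge0.
  apply/eqP; rewrite -sqrf_eq0; apply/eqP; apply: H => //; apply/eqP.
  by rewrite eq_le h/= sumr_ge0// => j _; exact: sqr_ge0.
have [a0'|aN] := eqVneq a 0.
  by apply: S_triv; apply: NS0; apply: sqn_eq0; apply/eqP; rewrite eq_le sqn_ge0 andbT (le_trans Na)// a0' expr0n.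
have [sg0'|sgN] := eqVneq sg 0.
  by apply: S_triv; apply: sS0 => i; have := s0 i; rewrite sg0'; lra.
have [b0'|bN] := eqVneq b 0.
  apply: S_triv; apply: NS0; apply/matrixP => i j; rewrite mxE.
  have := Nb (delta_mx j 0); rewrite b0' expr0n/= mul0r => h.
  have /matrixP /(_ i 0) : N *m delta_mx j 0 = 0 :> 'cV[R]_n.
    by apply: sqn_eq0; apply/eqP; rewrite eq_le sqn_ge0 andbT.
  by rewrite -colE !mxE.
have Ap : 0 < A by rewrite lt_neqAle A0 eq_sym mulf_neq0.
have bp : 0 < be by rewrite lt_neqAle be0 eq_sym mulf_neq0.
pose D := A + u * be; have D0 : 0 < D by rewrite addr_gt0// mulr_gt0.
(* Chernoff's parameter, chosen so that [l D (D - A) = u^2 / 2]. *)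
pose l := u / (2 * be * D).
have l0 : 0 <= l by rewrite divr_ge0 ?(ltW u0)// mulr_ge0 ?(ltW D0)// mulr_ge0.
have DN : D != 0 by rewrite lt0r_neq0.
have bN' : be != 0 by rewrite lt0r_neq0.
have lE : 2 * l * be ^+ 2 = 1 - A / D.
  rewrite /l (_ : 1 - A / D = (u * be) / D); last by rewrite /D; field.
  by field; rewrite DN.
have l1 : 2 * l * be ^+ 2 < 1 by rewrite lE ltrBlDr ltrDl divr_gt0.
have mS : measurable_fun setT S.
  apply: measurable_sum => i; apply: measurable_funM => //; apply: measurable_sqn.
  apply: measurable_mx_mul; last exact: measurable_mx_cst.
  move=> a' b'; rewrite (_ : (fun t => _) = fun t => W t i b'); first exact: (gaussian_mx_mmx gW).
  by apply/funext => t; rewrite mxE.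
have -> : expR (- (u ^+ 2 / 2)) = expR (l * A * D) / expR (l * D ^+ 2).
  rewrite -expRN -expRD; congr expR; rewrite /l.
  transitivity (u * (A - D) / (2 * be)); first by rewrite /D; field.
  by field; rewrite DN.
apply: (@markov_bool _ _ _ P _ (fun w => expR (l * S w))).
- by apply: measurable_fun_ltr => //; exact: measurable_cst.
- by apply: measurableT_comp => //; exact: measurable_funM.
- by move=> w; exact: expR_ge0.
- exact: expR_gt0.
- by move=> w /ltW h; rewrite ler_expR ler_wpM2l.
apply: le_trans (gaussian_quad_exp gW s0 l0 Nb l1) _; rewrite lee_fin ler_expR.
have -> : 1 - 2 * l * (sg * b) ^+ 2 = A / D by rewrite -/be lE opprB addrC subrK.
suff h : (\sum_i s i ^+ 2) * sqn N / (A / D) <= A * D by have := ler_wpM2l l0 h; rewrite !mulrA.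
have -> : A * D = A ^+ 2 / (A / D) by field; rewrite DN lt0r_neq0.
rewrite ler_pM2r ?invr_gt0 ?divr_gt0// /A exprMn ler_pM ?sqn_ge0//.
by apply: sumr_ge0 => i _; exact: sqr_ge0.
Qed.

End gaussian_concentration.

(** * The weighted sum of a Gaussian matrix: mean and tail *)

Section residual.
Context {R : realType} d (T : measurableType d) (P : probability T R).

(** With the singular values after the first [k] as weights, this is the part of the squared error
    bound in excess of the tail, cut off after [L] terms. *)
Definition weighted k L n (s : 'I_L -> R) (M : 'M[R]_(k + L, n)) : R :=
  \sum_i s i ^+ 2 * sqn (row i (dsubmx M) *m rinv (usubmx M)).

Lemma weighted_ge0 k L n (s : 'I_L -> R) (M : 'M[R]_(k + L, n)) : 0 <= weighted s M.
Proof. by apply: sumr_ge0 => i _; rewrite mulr_ge0 ?sqr_ge0 ?sqn_ge0. Qed.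

Lemma measurable_weighted k L n (s : 'I_L -> R) d' (T' : measurableType d')
    (M : T' -> 'M[R]_(k + L, n)) : measurable_mx M -> measurable_fun setT (fun t => weighted s (M t)).
Proof.
move=> mM; apply: measurable_sum => i; apply: measurable_funM => //; apply: measurable_sqn.
apply: measurable_mx_mul.
  move=> a b; rewrite (_ : (fun t => _) = fun t => M t (rshift k i) b); first exact: mM.
  by apply/funext => t; rewrite !mxE.
apply: measurable_mx_rinv => a b; rewrite (_ : (fun t => _) = fun t => M t (lshift L a) b); first exact: mM.
by apply/funext => t; rewrite !mxE.
Qed.

Lemma usubmx_mix k L n (A B : 'M[R]_(k + L, n)) :
  usubmx (\matrix_(i, j) if (i < k)%N then A i j else B i j) = usubmx A.
Proof. by apply/matrixP => i j; rewrite !mxE /= ltn_ord. Qed.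

Lemma dsubmx_mix k L n (A B : 'M[R]_(k + L, n)) :
  dsubmx (\matrix_(i, j) if (i < k)%N then A i j else B i j) = dsubmx B.
Proof. by apply/matrixP => i j; rewrite !mxE /= ltnNge leq_addr. Qed.

Lemma gaussian_mx_usubmx k L n (M : T -> 'M[R]_(k + L, n)) : gaussian_mx P M -> gaussian_mx P (fun w => usubmx (M w)).
Proof.
move=> gM; have := gaussian_mx_rows (f := @lshift k L) gM (@lshift_inj k L).
by congr (gaussian_mx _ _); apply/funext => w; apply/matrixP => i j; rewrite !mxE.
Qed.

Lemma gaussian_mx_dsubmx k L n (M : T -> 'M[R]_(k + L, n)) : gaussian_mx P M -> gaussian_mx P (fun w => dsubmx (M w)).
Proof.
move=> gM; have := gaussian_mx_rows (f := @rshift k L) gM (@rshift_inj k L).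
by congr (gaussian_mx _ _); apply/funext => w; apply/matrixP => i j; rewrite !mxE.
Qed.

Lemma gaussian_row_sqn L n k (W : T -> 'M[R]_(L, n)) (N : 'M[R]_(n, k)) i : gaussian_mx P W ->
  (\int[P]_w (sqn (row i (W w) *m N))%:E = (sqn N)%:E)%E.
Proof.
move=> gW; have gi := gaussian_mx_row i gW.
transitivity (\int[P]_w (\sum_c ((\sum_j N j c * W w i j) ^+ 2)%:E))%E.
  apply: eq_integral => w _; rewrite sumEFin /sqn big_ord1; congr EFin; apply: eq_bigr => c _.
  by rewrite mxE; congr (_ ^+ 2); apply: eq_bigr => j _; rewrite mxE mulrC.
rewrite ge0_integral_sum//; last 2 first.
- move=> c; apply/measurable_EFinP; apply: measurable_funX; apply: measurable_sum => j.
  by apply: measurable_funM => //; case: gi.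
- by move=> c w _; rewrite lee_fin sqr_ge0.
under eq_bigr => c _ do rewrite (gaussian_comb_sqr (fun j => N j c) gi).
by rewrite sumEFin /sqn exchange_big.
Qed.

(** With the top rows fixed, each lower row contributes [sqn N] on average, and the mean of [sqn N]
    is a sum of [k] column means. *)
Lemma weighted_mean k p L (s : 'I_L -> R) (M : T -> 'M[R]_(k + L, k + p)) : gaussian_mx P M -> (2 <= p)%N ->
  (\int[P]_w (weighted s (M w))%:E <= ((\sum_i s i ^+ 2) * (k%:R / (p%:R - 1)))%:E)%E.
Proof.
move=> gM p2; have mM := gaussian_mx_mmx gM.
have mF : measurable_fun setT (fun x => (weighted s (@mx_of_coords R (k + L) (k + p) x))%:E).
  by apply/measurable_EFinP; apply: measurable_weighted; exact: measurable_mx_of_coords.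
have gN := gaussian_mx_usubmx gM; have mN := measurable_mx_rinv (gaussian_mx_mmx gN).
rewrite (gaussian_mx_decouple (F := fun M => (weighted s M)%:E) (fun i => (i < k)%N) gM mF); last first.
  by move=> A; rewrite lee_fin weighted_ge0.
under eq_integral => w _.
  under eq_integral => w' _.
    rewrite /weighted usubmx_mix dsubmx_mix -sumEFin.
    under eq_bigr do rewrite EFinM.
    over.
  rewrite ge0_integral_sum//; last 2 first.
  - move=> i; apply: emeasurable_funM => //; apply/measurable_EFinP; apply: measurable_sqn.
    apply: measurable_mx_mul; last exact: measurable_mx_cst.
    move=> a b; rewrite (_ : (fun t => _) = fun t => M t (rshift k i) b); first exact: mM.
    by apply/funext => t; rewrite !mxE.
  - by move=> i w' _; rewrite -EFinM lee_fin mulr_ge0 ?sqr_ge0 ?sqn_ge0.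
  under eq_bigr => i _.
    rewrite ge0_integralZl//; last 3 first.
    - apply/measurable_EFinP; apply: measurable_sqn; apply: measurable_mx_mul; last exact: measurable_mx_cst.
      move=> a b; rewrite (_ : (fun t => _) = fun t => M t (rshift k i) b); first exact: mM.
      by apply/funext => t; rewrite !mxE.
    - by move=> w' _; rewrite lee_fin sqn_ge0.
    - by rewrite lee_fin sqr_ge0.
    rewrite (gaussian_row_sqn _ i (gaussian_mx_dsubmx gM)) -EFinM.
    over.
  rewrite sumEFin -mulr_suml.
  have -> : sqn (rinv (usubmx (M w))) = \sum_i sqn (col i (rinv (usubmx (M w)))).
    rewrite -sqn_tr /sqn; apply: eq_bigr => i _; rewrite exchange_big big_ord1.
    by apply: eq_bigr => j _; rewrite !mxE.
  rewrite EFinM.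
  over.
have s0 : (0 <= (\sum_i s i ^+ 2)%:E)%E by rewrite lee_fin sumr_ge0// => i _; exact: sqr_ge0.
rewrite ge0_integralZl//; last 2 first.
- by apply/measurable_EFinP; apply: measurable_sum => i; apply: measurable_sqn; exact: measurable_mx_col.
- by move=> w _; rewrite lee_fin sumr_ge0// => i _; exact: sqn_ge0.
under eq_integral do rewrite -sumEFin.
rewrite EFinM lee_wpmul2l// ge0_integral_sum//; last 2 first.
- by move=> i; apply/measurable_EFinP; apply: measurable_sqn; exact: measurable_mx_col.
- by move=> i w _; rewrite lee_fin sqn_ge0.
apply: (@le_trans _ _ (\sum_(i < k) ((p%:R - 1)^-1)%:E)%E).
  by apply: lee_sum => i _; exact: (rinv_col_sqn_mean i gN p2).
by rewrite sumEFin sumr_const card_ord mulr_natl.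
Qed.

(** The three probabilities are those of a large Frobenius norm of [N], of a large operator norm,
    and of a large quadratic form while [N] is good. The last is estimated with the top rows fixed,
    uniformly over the good ones. *)
Lemma weighted_tail k p L (s : 'I_L -> R) (M : T -> 'M[R]_(k.+1 + L, k.+1 + p)) (sg tau t u : R) :
  gaussian_mx P M -> (4 <= p)%N -> 0 < t -> 0 < u -> (forall i, 0 <= s i <= sg) -> 0 <= sg -> 0 <= tau ->
  \sum_i s i ^+ 2 <= tau ^+ 2 ->
  (P [set w | ((tau * (t * Num.sqrt (3 * k.+1%:R / p.+1%:R)) +
      u * (sg * (t * (expR 1 * Num.sqrt (k + p.+1)%:R / p.+1%:R)))) ^+ 2 < weighted s (M w))%R] <=
   (t ^- p + t ^- p.+1 + expR (- (u ^+ 2 / 2)))%:E)%E.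
Proof.
move=> gM p4 t0 u0 s0 sg0 tau0 stau; have mM := gaussian_mx_mmx gM.
set a := t * _; set b := t * _; set c := (_ + _) ^+ 2.
have gG := gaussian_mx_usubmx gM; have mG := gaussian_mx_mmx gG; have mN := measurable_mx_rinv mG.
have [B [mB PB BM]] := rinv_op_tail gG p4 t0.
have a0 : 0 <= a by rewrite mulr_ge0 ?(ltW t0).
have b0 : 0 <= b by rewrite mulr_ge0 ?(ltW t0)// divr_ge0// mulr_ge0// expR_ge0.
have a2 : a ^+ 2 = t ^+ 2 * (3 * k.+1%:R / p.+1%:R).
  by rewrite exprMn sqr_sqrtr// divr_ge0// mulr_ge0.
have mBG d' (T' : measurableType d') (A : T' -> 'M[R]_(k.+1, k.+1 + p)) : measurable_mx A ->
    measurable_fun setT (fun w => B (A w)).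
  move=> mA; have := @measurable_mx_comp R _ _ (fun A => ((B A)%:R)%:E) _ T' A.
  move=> /(_ (measurable_boolR mB) mA) /measurable_EFinP h.
  rewrite (_ : (fun w => _) = fun w => (0 < ((B (A w))%:R : R))%R).
    by apply: measurable_fun_ltr.
  by apply/funext => w; case: (B _); rewrite ?ltr01 ?ltxx.
pose N w := rinv (usubmx (M w)).
pose E (A : 'M[R]_(k.+1 + L, k.+1 + p)) :=
  [&& (c < weighted s A)%R, (sqn (rinv (usubmx A)) <= a ^+ 2)%R & ~~ B (usubmx A)].
have mus d' (T' : measurableType d') (A : T' -> 'M[R]_(k.+1 + L, k.+1 + p)) : measurable_mx A ->
    measurable_mx (fun w => usubmx (A w)).
  move=> mA i j; rewrite (_ : (fun t => _) = fun t => A t (lshift L i) j); first exact: mA.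
  by apply/funext => x; rewrite !mxE.
have mE d' (T' : measurableType d') (A : T' -> 'M[R]_(k.+1 + L, k.+1 + p)) : measurable_mx A ->
    measurable_fun setT (fun w => E (A w)).
  move=> mA; apply: measurable_and.
    by apply: measurable_fun_ltr => //; exact: measurable_weighted.
  apply: measurable_and; last by apply: measurable_neg; apply: mBG; exact: mus.
  by apply: measurable_fun_ler => //; apply: measurable_sqn; apply: measurable_mx_rinv; exact: mus.
have PE : (P [set w | E (M w)] <= (expR (- (u ^+ 2 / 2)))%:E)%E.
  rewrite (prob_int P (mE _ _ _ mM)).
  apply: (gaussian_mx_decouple_le (D := fun i => (i < k.+1)%N) (F := fun M => ((E M)%:R)%:E) gM) => //.
  - by apply: measurable_boolR; apply: mE; exact: measurable_mx_of_coords.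
  move=> w; under eq_integral do rewrite /E /weighted usubmx_mix dsubmx_mix.
  set G := usubmx (M w).
  have [/andP[Na Nb]|h] := boolP ((sqn (rinv G) <= a ^+ 2)%R && ~~ B G); last first.
    rewrite (eq_integral (cst 0%E)) ?integral0 ?lee_fin ?expR_ge0// => w' _.
    by rewrite /= andbF.
  have := gaussian_quad_tail (gaussian_mx_dsubmx gM) s0 sg0 tau0 a0 b0 u0 stau Na (BM _ Nb).
  rewrite -/c prob_int.
    move=> h; apply: le_trans h; rewrite le_eqVlt; apply/orP; left; apply/eqP.
    by apply: eq_integral => w' _; rewrite andbT.
  have mW := gaussian_mx_mmx (gaussian_mx_dsubmx gM).
  apply: measurable_fun_ltr => //; apply: measurable_sum => i; apply: measurable_funM => //.
  apply: measurable_sqn; apply: measurable_mx_mul; last exact: measurable_mx_cst.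
  move=> i' j; rewrite (_ : (fun t => _) = fun t => dsubmx (M t) i j); first exact: mW.
  by apply/funext => x; rewrite !mxE.
have m1 : measurable [set w | (a ^+ 2 < sqn (N w))%R].
  by apply: measurable_true; apply: measurable_fun_ltr => //; exact: measurable_sqn.
have m2 : measurable [set w | B (usubmx (M w))] by apply: measurable_true; exact: mBG.
have m3 : measurable [set w | E (M w)] by apply: measurable_true; exact: mE.
apply: (@le_trans _ _ (P ([set w | (a ^+ 2 < sqn (N w))%R] `|` ([set w | B (usubmx (M w))] `|` [set w | E (M w)])))).
  apply: le_measure; rewrite ?inE.
  - by apply: measurable_true; apply: measurable_fun_ltr => //; exact: measurable_weighted.
  - by apply: measurableU => //; exact: measurableU.
  move=> w /= h; rewrite /E h/= /N; case: leP => h1; last by left.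
  by right; case: (B _); [left|right].
apply: le_trans (measureU2 P m1 (measurableU _ _ m2 m3)) _.
rewrite -addrA EFinD; apply: leeD; first by rewrite a2; exact: rinv_sqn_tail.
by apply: le_trans (measureU2 P m2 m3) _; rewrite EFinD; exact: leeD.
Qed.

End residual.

(** * Independent normal variables *)

Section independent_normals.
Context (R : realType).
Notation gam := (normal_prob (0 : R) 1).

(** A reference family, with which [independent_gaussian] compares a given one. *)
Lemma gaussian_exists n : exists (d : measure_display) (T : measurableType d)
  (P : probability T R) (X : 'I_n -> T -> R), gaussian P X.
Proof.
elim: n => [|n [d [T [P [X gX]]]]].
  exists _, _, gam, (fun _ => id).
  by apply: (gaussian_reindex (f := fun _ : 'I_0 => tt) (gaussian_normal R)) => -[].
have g1 : gaussian gam (fun _ : 'I_1 => id).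
  by apply: (gaussian_reindex (f := fun _ : 'I_1 => tt) (gaussian_normal R)) => i j _; rewrite !ord1.
have gs := gaussian_sum g1 gX.
have sI : injective (@fintype.split 1 n) by move=> i j ij; rewrite -[i]splitK -[j]splitK ij.
by eexists _, _, _, _; exact: (gaussian_reindex gs sI).
Qed.

Definition boxes n : set (set ('I_n -> R)) :=
  [set A | exists B : 'I_n -> set R, (forall i, measurable (B i)) /\ A = [set x | forall i, B i (x i)]].

Lemma boxes_measurable n : @boxes n `<=` (@measurable _ (coords R 'I_n)).
Proof.
move=> _ [B [mB ->]].
have -> : [set x : 'I_n -> R | forall i, B i (x i)] = \bigcap_(i in setT) ((fun x => x i) @^-1` B i).
  by apply/seteqP; split => x h i => [_|]; exact: h.
apply: fin_bigcap_measurable => // i _.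
by have := @measurable_coord R 'I_n i measurableT (B i) (mB i); rewrite setTI.
Qed.

Lemma boxes_unique n (m1 m2 : probability (coords R 'I_n) R) :
  (forall A, @boxes n A -> m1 A = m2 A) -> forall A, measurable A -> m1 A = m2 A.
Proof.
move=> m12 A mA.
have sA : <<s @boxes n >> A.
  move: A mA; apply: smallest_sub; first exact: smallest_sigma_algebra.
  move=> _ [i [B [mB ->]]]; apply: sub_sigma_algebra.
  exists (fun j => if j == i then B else setT); split => [j|].
    by case: ifP.
  apply/seteqP; split => x /= h; last by have := h i; rewrite eqxx.
  by move=> j; case: eqP => // ->.
have bT : @boxes n setT.
  by exists (fun=> setT); split => //; apply/seteqP; split.
have bi : setI_closed (@boxes n).
  move=> _ _ [B [mB ->]] [C [mC ->]]; exists (fun i => B i `&` C i); split.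
    by move=> i; exact: measurableI.
  by apply/seteqP; split => x /= => [[h1 h2] i|h]; [split|split => i; have [] := h i].
have bU : \bigcup_(k : nat) (fun=> [set: coords R 'I_n]) k = setT.
  by rewrite bigcup_const//; exists 0%N.
have bf (k : nat) : (m1 ((fun=> setT) k) < +oo)%E by rewrite /= probability_setT ltry.
refine (@g_sigma_algebra_measure_unique _ R (coords R 'I_n) (@boxes n) (@boxes_measurable n) (fun=> setT) (fun=> bT) bU m1 m2 bi m12 bf A sA).
Qed.

(** On boxes the law of [X] is a product by independence, and [gaussian_prod], applied to
    indicators, gives the same product for a reference family. Boxes form a pi-system, so the two
    laws agree. *)
Lemma independent_gaussian n d (T : measurableType d) (P : probability T R) (X : 'I_n -> T -> R) :
  (forall i, measurable_fun setT (X i)) ->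
  (forall i B, measurable B -> P (X i @^-1` B) = gam B) ->
  (forall B : 'I_n -> set R, (forall i, measurable (B i)) ->
    P (\bigcap_(i in setT) (X i @^-1` B i)) = (\prod_i P (X i @^-1` B i))%E) ->
  gaussian P X.
Proof.
move=> mX lX iX; split=> // a th.
have [d' [T' [P' [Z gZ]]]] := gaussian_exists n; have [mZ _] := gZ.
have mfX : measurable_fun setT (fun w => (fun i => X i w) : coords R 'I_n) by exact: measurable_coords.
have mfZ : measurable_fun setT (fun w => (fun i => Z i w) : coords R 'I_n) by exact: measurable_coords.
have mc : measurable_fun setT (fun x : coords R 'I_n => (cos (\sum_i a i * x i + th))%:E).
  apply/measurable_EFinP; apply: measurableT_comp; first exact: measurable_cos.
  apply: measurable_funD => //; exact: measurable_lincomb.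
have [_ /(_ a th) <-] := gZ.
rewrite -[LHS](integral_image mfX mc); last first.
  apply: (@integrable_bounded _ _ _ _ (fun w => cos (\sum_i a i * X i w + th)) 1).
    by apply/measurable_EFinP; exact: (measurableT_comp mc mfX).
  by move=> x; exact: cos_bounded.
rewrite -[RHS](integral_image mfZ mc); last first.
  apply: (@integrable_bounded _ _ _ _ (fun w => cos (\sum_i a i * Z i w + th)) 1).
    by apply/measurable_EFinP; exact: (measurableT_comp mc mfZ).
  by move=> x; exact: cos_bounded.
apply: eq_measure_integral => A mA _; move: A mA.
apply: boxes_unique => _ [B [mB ->]].
transitivity (\prod_i gam (B i))%E.
  transitivity (P (\bigcap_(i in setT) (X i @^-1` B i))).
    congr (P _); apply/seteqP; split => w /= h i => [_|]; exact: h.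
  by rewrite iX//; apply: eq_bigr => i _; rewrite lX.
have mf i : measurable_fun setT (\1_(B i) : R -> R) by exact: measurable_indic.
have f0 i x : 0 <= (\1_(B i) x : R) by rewrite indicE.
have := @gaussian_prod _ _ _ P' _ Z (index_enum _) (fun i => \1_(B i)) gZ (index_enum_uniq _) mf f0.
move=> H; transitivity (\prod_i \int[gam]_x (\1_(B i) x)%:E)%E.
  by apply: eq_bigr => i _; rewrite (integral_indic gam measurableT (mB i)); congr (gam _); rewrite setIT.
rewrite -{}H.
have mC : measurable [set w : T' | forall i, B i (Z i w)].
  have := boxes_measurable (ex_intro _ B (conj mB erefl)) => h.
  by have := mfZ measurableT _ h; rewrite setTI.
transitivity (\int[P']_w (\1_[set w : T' | forall i, B i (Z i w)] w)%:E)%E; last first.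
  by rewrite (integral_indic P' measurableT mC) setIT.
apply: eq_integral => w _; congr EFin; rewrite indicE.
have [h|h] := pselect (forall i, B i (Z i w)).
  by rewrite mem_set//= big1// => i _; rewrite indicE mem_set.
rewrite memNset//=; have [i hi] : exists i, ~ B i (Z i w) by apply/existsNP.
by rewrite (bigD1 i)//= indicE memNset// mul0r.
Qed.

End independent_normals.

(** * Hilbert spaces *)

Section hilbert.
Context {R : realType} {H : hilbertType R}.
Implicit Types (x y z h : H).

Lemma innerDr x y z : inner x (y + z) = inner x y + inner x z.
Proof. by rewrite innerC innerDl !(innerC x). Qed.

Lemma innerZr a x y : inner x (a *: y) = a * inner x y.
Proof. by rewrite innerC innerZl innerC. Qed.

Lemma inner0l x : inner 0 x = 0 :> R.
Proof. by rewrite -[X in inner X _](scale0r (0 : H)) innerZl mul0r. Qed.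

Lemma innerNl x y : inner (- x) y = - inner x y.
Proof. by rewrite -scaleN1r innerZl mulN1r. Qed.

Lemma innerNr x y : inner x (- y) = - inner x y.
Proof. by rewrite innerC innerNl innerC. Qed.

Lemma innerBl x y z : inner (x - y) z = inner x z - inner y z.
Proof. by rewrite innerDl innerNl. Qed.

Lemma innerBr x y z : inner z (x - y) = inner z x - inner z y.
Proof. by rewrite innerDr innerNr. Qed.

Lemma inner_suml (I : Type) (r : seq I) (F : I -> H) x :
  inner (\sum_(i <- r) F i) x = \sum_(i <- r) inner (F i) x.
Proof.
elim: r => [|i r IH]; first by rewrite !big_nil inner0l.
by rewrite !big_cons innerDl IH.
Qed.

Lemma inner_sumr (I : Type) (r : seq I) (F : I -> H) x :
  inner x (\sum_(i <- r) F i) = \sum_(i <- r) inner x (F i).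
Proof. by rewrite innerC inner_suml; apply: eq_bigr => i _; rewrite innerC. Qed.

Lemma sqr_normB x y : `|x - y| ^+ 2 = `|x| ^+ 2 - 2 * inner x y + `|y| ^+ 2.
Proof.
rewrite -!inner_norm innerBl !innerBr (innerC y x).
by move: (inner x x) (inner x y) (inner y y) => a b c; ring.
Qed.

Lemma inner_cauchy_schwarz x y : `|inner x y| <= `|x| * `|y|.
Proof.
have [->|x0] := eqVneq x 0; first by rewrite inner0l normr0 normr0 mul0r.
have nx : 0 < `|x| ^+ 2 by rewrite exprn_gt0// normr_gt0.
rewrite -(@ler_pXn2r _ 2) ?nnegrE ?mulr_ge0// real_normK ?num_real// exprMn.
have := sqr_ge0 (`|inner x y *: x - `|x| ^+ 2 *: y|).
rewrite sqr_normB !normrZ !exprMn innerZl innerZr !real_normK ?num_real//.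
rewrite ?normrX ?normr_id.
move: (`|x| ^+ 2) (`|y| ^+ 2) (inner x y) nx => a b c a0 h.
have : 0 <= a * (a * b - c ^+ 2) by apply: le_trans h _; lra.
by rewrite pmulr_rge0// subr_ge0.
Qed.

Lemma inner_continuous h : continuous (inner h : H -> R).
Proof.
move=> x; apply/cvgrPdist_le => e e0.
have h1 : 0 < `|h| + 1 by rewrite ltr_wpDl.
have : \forall y \near x, `|x - y| < e / (`|h| + 1).
  by apply: cvgr_dist_lt; [exact: cvg_id|exact: divr_gt0].
apply: filterS => y /= xy; rewrite -innerBr (le_trans (inner_cauchy_schwarz _ _))//.
rewrite (le_trans (ler_wpM2r (normr_ge0 _) (_ : _ <= `|h| + 1)))// ?lerDl//.
by rewrite mulrC -ler_pdivlMr// ltW.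
Qed.

Lemma cvg_inner h (f : nat -> H) x : f @ \oo --> x -> inner h (f n) @[n --> \oo] --> inner h x.
Proof. by move=> fx; apply: (cvg_comp _ _ fx); exact: inner_continuous. Qed.

Lemma inner_series h (f : nat -> H) x : series f @ \oo --> x ->
  series (fun i => inner h (f i)) @ \oo --> inner h x.
Proof.
move=> /(@cvg_inner h _ _); rewrite (_ : (fun n => inner h (series f n)) = series (fun i => inner h (f i)))//.
by apply/funext => n; rewrite /series/= inner_sumr.
Qed.

Section orthonormal.
Variables (u : nat -> H) (ou : orthonormal_family u).

Lemma inner_orth_sum (a : nat -> R) n i :
  inner (u i) (\sum_(0 <= j < n) a j *: u j) = (i < n)%N%:R * a i.
Proof.
rewrite inner_sumr; under eq_bigr do rewrite innerZr ou.
have [ilt|ige] := ltnP i n.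
  rewrite mul1r big_mkord (bigD1 (Ordinal ilt))//= eqxx mulr1 big1 ?addr0// => j ji.
  by rewrite (negbTE (_ : i != j)) ?mulr0// eq_sym; exact: ji.
rewrite mul0r big_mkord big1// => j _; rewrite gtn_eqF ?mulr0//.
exact: leq_trans (ltn_ord j) ige.
Qed.

Lemma sqr_norm_orth_sum (a : nat -> R) m n : 
  `|\sum_(m <= j < n) a j *: u j| ^+ 2 = \sum_(m <= j < n) a j ^+ 2.
Proof.
rewrite -inner_norm inner_suml; apply: eq_big_nat => i /andP[mi ilt].
rewrite innerZl expr2; congr (_ * _); rewrite inner_sumr.
under eq_bigr do rewrite innerZr ou.
rewrite (bigD1_seq i)//= ?mem_index_iota ?mi ?iota_uniq// eqxx mulr1 big1 ?addr0// => j ji.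
by rewrite eq_sym (negbTE ji) mulr0.
Qed.

Lemma orth_series_coef (a : nat -> R) x i : series (fun j => a j *: u j) @ \oo --> x ->
  inner (u i) x = a i.
Proof.
move=> /(@cvg_inner (u i) _ _) ax.
have := cvg_unique _ ax; apply => //.
apply: cvg_near_cst; near=> n; rewrite /series/= inner_orth_sum (_ : (i < n)%N) ?mul1r//.
by near: n; exact: nbhs_infty_gt.
Unshelve. all: by end_near. Qed.

Lemma orth_series_sqr (a : nat -> R) x : series (fun j => a j *: u j) @ \oo --> x ->
  series (fun j => a j ^+ 2) @ \oo --> `|x| ^+ 2.
Proof.
move=> ax; have h : `|series (fun j => a j *: u j) n| @[n --> \oo] --> `|x| by exact: cvg_norm.
have hh : `|series (fun j => a j *: u j) n| * `|series (fun j => a j *: u j) n| @[n --> \oo] --> `|x| * `|x|.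
  exact: cvgM.
rewrite expr2; apply: cvg_trans hh.
rewrite (_ : series (fun j => a j ^+ 2) = fun n => `|series (fun j => a j *: u j) n| * `|series (fun j => a j *: u j) n|)//.
by apply/funext => n; rewrite -expr2 /series/= sqr_norm_orth_sum.
Qed.

Lemma orth_series_sqrE (a : nat -> R) x : series (fun j => a j *: u j) @ \oo --> x ->
  (\sum_(0 <= j <oo) (a j ^+ 2)%:E = (`|x| ^+ 2)%:E)%E.
Proof.
move=> /orth_series_sqr h; apply/cvg_lim => //.
rewrite (_ : (fun n => _) = EFin \o series (fun j => a j ^+ 2)); last first.
  by apply/funext => n; rewrite sumEFin.
by apply: cvg_EFin; first exact: nearW.
Qed.

Lemma bessel x n : \sum_(0 <= i < n) inner (u i) x ^+ 2 <= `|x| ^+ 2.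
Proof.
have := sqr_ge0 (`|x - \sum_(0 <= i < n) inner (u i) x *: u i|).
rewrite sqr_normB sqr_norm_orth_sum inner_sumr.
under eq_bigr do rewrite innerZr (innerC x) -expr2.
by lra.
Qed.

(** By Pythagoras the series is Cauchy as soon as that of the squares is, and [H] is complete. *)
Lemma riesz_fischer (a : nat -> R) M : (forall n, \sum_(0 <= i < n) a i ^+ 2 <= M) ->
  exists x, series (fun j => a j *: u j) @ \oo --> x.
Proof.
move=> aM.
have cs : cvgn (series (fun j => a j ^+ 2)).
  apply: nondecreasing_is_cvgn.
    by apply: nondecreasing_series => i _ _; exact: sqr_ge0.
  by exists M => _ [n _ <-]; exact: aM.
suff : cvgn (series (fun j => a j *: u j)) by move=> /cvg_ex[x]; exists x.
apply: cauchy_cvg; apply/cauchy_seriesP => e e0.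
have cc : cauchy (series (fun j => a j ^+ 2) @ \oo) by exact: cvg_cauchy.
have := (cauchy_seriesP _).1 cc (e ^+ 2) (exprn_gt0 _ e0).
apply: filterS => -[m n] /= h.
rewrite -(@ltr_pXn2r _ 2) ?nnegrE// ?(ltW e0)// sqr_norm_orth_sum.
by apply: le_lt_trans h; exact: ler_norm.
Qed.

Lemma orth_proj x : exists y, series (fun j => inner (u j) x *: u j) @ \oo --> y.
Proof. exact: riesz_fischer (bessel x). Qed.

End orthonormal.

Lemma qmx_proj_min r (Q : 'I_r -> H) x xi : orthonormal_family Q ->
  `|x - qmx Q (qmx_adj Q x)| <= `|x - qmx Q xi|.
Proof.
move=> oQ; rewrite -(@ler_pXn2r _ 2) ?nnegrE// !sqr_normB.
have nQ (c : 'cV[R]_r) : `|qmx Q c| ^+ 2 = \sum_i c i 0 ^+ 2.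
  rewrite -inner_norm inner_suml; apply: eq_bigr => i _.
  rewrite innerZl expr2; congr (_ * _); rewrite inner_sumr (bigD1 i)//= innerZr oQ eqxx mulr1.
  by rewrite big1 ?addr0// => j ji; rewrite innerZr oQ eq_sym (negbTE ji) mulr0.
have iQ (c : 'cV[R]_r) : inner x (qmx Q c) = \sum_i c i 0 * qmx_adj Q x i 0.
  by rewrite inner_sumr; apply: eq_bigr => i _; rewrite innerZr mxE innerC.
rewrite !nQ !iQ -!addrA lerD2l !mulr_sumr -!sumrN -!big_split/=; apply: ler_sum => i _.
move: (qmx_adj Q x i 0) (xi i 0) => a b.
by have := sqr_ge0 (a - b); rewrite !expr2; lra.
Qed.

End hilbert.

(** * Singular coordinates and the deterministic error bound *)

Section svd.
Context {R : realType} {H1 H2 : hilbertType R}.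
Variables (A : {linear H1 -> H2}) (sigma : nat -> R) (u : nat -> H2) (v : nat -> H1).
Hypothesis A_svd : is_svd A sigma u v.

Let ou : orthonormal_family u. Proof. by case: A_svd. Qed.
Let ov : orthonormal_family v. Proof. by case: A_svd. Qed.
Let sg0 i : 0 <= sigma i. Proof. by case: A_svd. Qed.
Let Aser x : series (fun i => (sigma i * inner (v i) x) *: u i) @ \oo --> A x.
Proof. by case: A_svd. Qed.

Lemma svd_v i h : inner (A (v i)) h = sigma i * inner (u i) h.
Proof.
suff -> : A (v i) = sigma i *: u i by rewrite innerZl.
apply: cvg_unique (@Aser (v i)) _ => //; apply: cvg_near_cst; near=> n.
have ilt : (i < n)%N by near: n; exact: nbhs_infty_gt.
rewrite /series/= big_mkord (bigD1 (Ordinal ilt))//= ov eqxx mulr1 big1 ?addr0// => j ji.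
have : (j : nat) != i by exact: ji.
by rewrite ov => /negbTE ->; rewrite mulr0 scale0r.
Unshelve. all: by end_near. Qed.

(** The candidate is [sum_i sigma_i <u_i, h> v_i]; its coefficients are square summable by Bessel's
    inequality and [sigma_i <= sigma_0]. *)
Lemma adjoint_ex h : exists x : H1, forall z, inner (A z) h = inner z x.
Proof.
have aM n : \sum_(0 <= i < n) (sigma i * inner (u i) h) ^+ 2 <= sigma 0%N ^+ 2 * `|h| ^+ 2.
  apply: (@le_trans _ _ (sigma 0%N ^+ 2 * \sum_(0 <= i < n) inner (u i) h ^+ 2)); last first.
    by rewrite ler_wpM2l ?sqr_ge0// bessel.
  rewrite mulr_sumr; apply: ler_sum => i _; rewrite exprMn ler_wpM2r ?sqr_ge0//.
  by rewrite lerXn2r ?nnegrE//; case: A_svd => + _ _ _ _; apply.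
have [x hx] := riesz_fischer ov aM.
exists x => z.
have h1 := @inner_series _ _ z _ _ hx; have h2 := @inner_series _ _ h _ _ (@Aser z).
rewrite innerC; apply: cvg_unique h2 _ => //; apply: cvg_trans h1.
rewrite (_ : series (fun i => inner h _) = series (fun i => inner z ((sigma i * inner (u i) h) *: v i)))//.
congr series; apply/funext => i; rewrite !innerZr (innerC h) (innerC z); ring.
Qed.

Lemma adjointE h z : inner (A z) h = inner z (adjoint A h).
Proof. by move: z; exact: (xgetPex 0 (adjoint_ex h)). Qed.

(** The variance of [<h, y_j>] in singular coordinates. *)
Lemma covariance_series h :
  series (fun i => (sigma i * inner (u i) h) ^+ 2) @ \oo --> inner ((A \o adjoint A) h) h.
Proof.
have := @inner_series _ _ h _ _ (@Aser (adjoint A h)); rewrite innerC.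
rewrite (_ : (fun i => inner h _) = fun i => (sigma i * inner (u i) h) ^+ 2)//.
by apply/funext => i; rewrite innerZr -adjointE svd_v (innerC h); ring.
Qed.

Lemma covariance0 h : (forall i, inner (u i) h = 0) -> inner ((A \o adjoint A) h) h = 0.
Proof.
move=> h0; apply: cvg_unique (@covariance_series h) _ => //; apply: cvg_near_cst.
by apply: nearW => n; rewrite /series/= big1// => i _; rewrite h0 mulr0 expr0n.
Qed.

Lemma covariance_sum K (a : nat -> R) :
  inner ((A \o adjoint A) (\sum_(0 <= i < K) a i *: u i)) (\sum_(0 <= i < K) a i *: u i) =
  \sum_(0 <= i < K) (sigma i * a i) ^+ 2.
Proof.
apply: cvg_unique (@covariance_series _) _ => //; apply: cvg_near_cst; near=> n.
have Kn : (K <= n)%N by near: n; exact: nbhs_infty_ge.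
rewrite /series/= (@big_cat_nat _ _ _ K)//= [X in _ + X]big_nat [X in _ + X]big1 ?addr0.
  by apply: eq_big_nat => i /andP[_ iK]; rewrite inner_orth_sum// iK mul1r.
by move=> i /andP[Ki _]; rewrite inner_orth_sum// ltnNge Ki mul0r mulr0 expr0n.
Unshelve. all: by end_near. Qed.

Variables (n : nat) (y : 'I_n -> H2) (g : nat -> 'I_n -> R).
Hypothesis yser : forall j, series (fun i => inner (u i) (y j) *: u i) @ \oo --> y j.
Hypothesis yg : forall i j, inner (u i) (y j) = sigma i * g i j.

Lemma cvg_fsum_ord (f : 'I_n -> nat -> H2) (l : 'I_n -> H2) :
  (forall j, f j @ \oo --> l j) -> (\sum_j f j m) @[m --> \oo] --> \sum_j l j.
Proof.
move=> fl; elim: (index_enum _) => [|j s IH].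
  by rewrite big_nil; under eq_fun do rewrite big_nil; exact: cvg_cst.
by rewrite big_cons; under eq_fun do rewrite big_cons; exact: cvgD.
Qed.

(** Both [A x] and the columns of [y] are sums of their series along [u], so the squared norm is the
    sum of the squared coefficients. *)
Lemma residual_series x (xi : 'cV[R]_n) :
  (\sum_(0 <= i <oo) ((sigma i * (inner (v i) x - \sum_j xi j 0 * g i j)) ^+ 2)%:E =
   (`|A x - qmx y xi| ^+ 2)%:E)%E.
Proof.
apply: (orth_series_sqrE ou).
have h1 : \sum_j (xi j 0 *: series (fun i => inner (u i) (y j) *: u i) m) @[m --> \oo] --> qmx y xi.
  by apply: cvg_fsum_ord => j; apply: cvgZr; exact: yser.
rewrite (_ : series _ = fun m => series (fun i => (sigma i * inner (v i) x) *: u i) m -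
  \sum_j (xi j 0 *: series (fun i => inner (u i) (y j) *: u i) m)).
  exact: cvgB (@Aser x) h1.
apply/funext => m; rewrite /series/=; under [X in _ = _ - X]eq_bigr do rewrite scaler_sumr.
rewrite exchange_big/= -sumrB; apply: eq_bigr => i _.
rewrite mulrBr scalerBl; congr (_ - _); rewrite mulr_sumr scaler_suml.
by apply: eq_bigr => j _; rewrite scalerA yg mulrCA.
Qed.

Definition grows k : 'M[R]_(k, n) := \matrix_(i, j) g i j.
Definition grow i : 'rV[R]_n := \row_j g i j.

Variables (k : nat) (N : 'M[R]_(n, k)).
Hypothesis GN : grows k *m N = 1%:M.

(** If [xi = N c] with [c_a = <v_a, x>], the coefficient of the residual along [u_i] is
    [sigma_i <zvec i, x>]. The vector [zvec i] does not depend on [x], so summing over a basis of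
    [x] is Parseval's identity. *)
Definition zvec i : H1 := v i - \sum_(a < k) (grow i *m N) 0 a *: v a.

Lemma zvec_low i : (i < k)%N -> zvec i = 0.
Proof.
move=> ik; rewrite /zvec (_ : grow i *m N = delta_mx 0 (Ordinal ik)).
  rewrite (bigD1 (Ordinal ik))//= mxE !eqxx scale1r big1 ?addr0 ?subrr// => a ai.
  by rewrite mxE (negbTE ai) andbF scale0r.
have -> : grow i = row (Ordinal ik) (grows k) by apply/rowP => j; rewrite !mxE.
by rewrite -row_mul GN row1.
Qed.

Lemma zvec_norm i : (k <= i)%N -> `|zvec i| ^+ 2 = 1 + sqn (grow i *m N).
Proof.
move=> ki; rewrite sqr_normB -inner_norm ov eqxx inner_sumr big1 ?mulr0 ?subr0.
  (* The coefficients are extended by 0 from ordinals to [nat], the index type of [v]. *)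
  congr (_ + _); pose a i' := if insub i' is Some j then (grow i *m N) 0 (j : 'I_k) else 0.
  have -> : \sum_(j < k) (grow i *m N) 0 j *: v j = \sum_(0 <= j < k) a j *: v j.
    by rewrite big_mkord; apply: eq_bigr => j _; rewrite /a valK.
  rewrite (sqr_norm_orth_sum ov) /sqn big_ord1 big_mkord.
  by apply: eq_bigr => j _; rewrite /a valK.
by move=> a _; rewrite innerZr ov gtn_eqF ?mulr0// (leq_trans _ ki).
Qed.

Lemma residual_zvec i x :
  inner (v i) x - \sum_j (N *m (\col_a inner (v (a : 'I_k)) x)) j 0 * g i j = inner (zvec i) x.
Proof.
rewrite /zvec innerBl inner_suml; congr (_ - _).
transitivity ((grow i *m (N *m (\col_a inner (v (a : 'I_k)) x))) 0 0).
  by rewrite [RHS]mxE; apply: eq_bigr => j _; rewrite [grow i 0 j]mxE mulrC.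
rewrite mulmxA mxE; apply: eq_bigr => a _; rewrite innerZl; congr (_ * _).
by rewrite mxE.
Qed.

Variables (e : nat -> H1) (e_basis : orthonormal_basis e).
Variables (r : nat) (Q : 'I_r -> H2) (oQ : orthonormal_family Q).
Hypothesis rQ : range (qmx Q) = range (qmx y).

Lemma proj_residual_le x xi : `|x - qmx Q (qmx_adj Q x)| <= `|x - qmx y xi|.
Proof.
have : range (qmx Q) (qmx y xi) by rewrite rQ; exists xi.
by move=> [zeta _ <-]; exact: qmx_proj_min.
Qed.

(** After the comparison with [xi = N c] for each [e l], the two sums are exchanged and Parseval
    leaves [sigma_i^2 |zvec i|^2]; the terms with [i < k] vanish because [G N = 1]. *)
Lemma error_le :
  (\sum_(0 <= l <oo) (`|A (e l) - (qmx Q \o qmx_adj Q \o A) (e l)| ^+ 2)%:E <=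
   \sum_(k <= i <oo) (sigma i ^+ 2 * (1 + sqn (grow i *m N)))%:E)%E.
Proof.
apply: (@le_trans _ _ (\sum_(0 <= l <oo) \sum_(0 <= i <oo) ((sigma i * inner (zvec i) (e l)) ^+ 2)%:E)%E).
  apply: lee_nneseries => [l _ _|l _]; first by rewrite lee_fin sqr_ge0.
  under eq_eseriesr do rewrite -residual_zvec.
  rewrite residual_series lee_fin lerXn2r ?nnegrE//.
  exact: proj_residual_le.
rewrite nneseries_interchange; last by move=> i j; rewrite lee_fin sqr_ge0.
have E i : (\sum_(0 <= l <oo) ((sigma i * inner (zvec i) (e l)) ^+ 2)%:E = (sigma i ^+ 2 * `|zvec i| ^+ 2)%:E)%E.
  under eq_eseriesr do rewrite exprMn EFinM (innerC (zvec i)).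
  rewrite nneseriesZl; last by move=> l _; rewrite lee_fin sqr_ge0.
  by case: e_basis => oe /(_ (zvec i)) /(orth_series_sqrE oe) ->.
rewrite (eq_eseriesr (fun i _ => E i)).
rewrite (nneseries_split 0 k)//; last by move=> i _; rewrite lee_fin mulr_ge0// sqr_ge0.
rewrite add0n big_nat big1 ?add0e.
  rewrite le_eqVlt; apply/orP; left; apply/eqP.
  rewrite [LHS]eseries_cond [RHS]eseries_cond; apply: eq_eseriesr => i ki.
  by rewrite zvec_norm.
by move=> i /andP[_ ik]; rewrite zvec_low// normr0 expr0n mulr0.
Qed.

End svd.

(** * Measurability of random vectors and of the projection error *)

Section hilbert_random_vectors.
Context {R : realType} {H : hilbertType R}.
Hypothesis sepH : separable H.

Lemma dense_sequence : exists s : nat -> H, forall O : set H, O !=set0 -> open O -> exists n, O (s n).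
Proof.
have [S /pfcard_geP[->|[f]] dS] := sepH.
  by have [|x [_ []]] := dS setT _ openT; exists 0.
exists f => O O0 oO; have [x [Ox Sx]] := dS O O0 oO.
by have [n _ fn] := @surj _ _ _ _ f x Sx; exists n; rewrite fn.
Qed.

Lemma measurable_borel_continuous (f : H -> R) : continuous f ->
  measurable_fun setT (f : borel H -> R).
Proof.
move=> cf; apply: (measurability _ (RGenOInfty.measurableE R)) => // _ [_ [c ->] <-].
rewrite setTI; apply: sub_sigma_algebra; apply: open_comp => [x _|]; first exact: cf.
exact: interval_open.
Qed.

Context d (T : measurableType d) (P : probability T R).
Implicit Types Z : {RV P >-> borel H}.

Lemma measurable_RV_continuous Z (f : H -> R) : continuous f ->
  measurable_fun setT (fun w => f (Z w)).
Proof.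
by move=> cf; exact: (measurableT_comp (measurable_borel_continuous cf) (measurable_funPT Z)).
Qed.

Lemma continuous_dist (x : H) : continuous (fun z : H => `|x - z|).
Proof.
move=> z; apply: (@cvg_norm _ H); apply: cvgB; [exact: cvg_cst|exact: cvg_id].
Qed.

(** Separability enters here: [|Z - Z'| < c] exactly when [|s_n - Z| + |s_n - Z'| < c] for some [n],
    and each of these two distances involves a single random vector. *)
Lemma measurable_dist_RV Z Z' : measurable_fun setT (fun w => `|(Z w : H) - Z' w|).
Proof.
have [s sd] := dense_sequence.
apply: (measurability _ (RGenInftyO.measurableE R)) => // _ [_ [c ->] <-].
rewrite setTI (_ : _ @^-1` _ = \bigcup_n [set w | `|s n - (Z w : H)| + `|s n - (Z' w : H)| < c]).
  apply: bigcupT_measurable => n.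
  apply: measurable_true; apply: measurable_fun_ltr => //.
  have mdist (W : {RV P >-> borel H}) : measurable_fun setT (fun w => `|s n - (W w : H)|).
    by have := @measurable_RV_continuous W _ (@continuous_dist (s n)).
  exact: measurable_funD.
apply/seteqP; split => w /=; rewrite in_itv/=.
  move=> wc; have e0 : 0 < c - `|(Z w : H) - Z' w| by rewrite subr_gt0.
  have [|//|n] := sd (ball (Z w : H) ((c - `|(Z w : H) - Z' w|) / 2)).
  - by exists (Z w); apply: ballxx; rewrite divr_gt0.
  - exact: ball_open.
  rewrite -ball_normE /= => bn; exists n => //=.
  have : `|s n - (Z' w : H)| <= `|(Z w : H) - s n| + `|(Z w : H) - Z' w|.
    by rewrite -[`|Z w - s n|]normrN opprB (le_trans _ (ler_normD _ _))// addrA subrK.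
  by rewrite -[`|s n - Z w|]normrN opprB; lra.
move=> [n _] /=; apply: le_lt_trans.
by rewrite -[`|s n - Z w|]normrN opprB (le_trans _ (ler_normD _ _))// addrA subrK.
Qed.

Lemma measurable_inner_RV Z Z' : measurable_fun setT (fun w => inner (Z w : H) (Z' w)).
Proof.
rewrite (_ : (fun w => _) = fun w =>
   (`|(Z w : H)| ^+ 2 + `|(Z' w : H)| ^+ 2 - `|(Z w : H) - Z' w| ^+ 2) / 2).
  apply: measurable_funM => //; apply: measurable_funB; last first.
    by apply: measurable_funX; exact: measurable_dist_RV.
  by apply: measurable_funD; apply: measurable_funX; apply: measurable_RV_continuous; exact: norm_continuous.
by apply/funext => w; rewrite sqr_normB; field.
Qed.

Section projection_error.
Variables (n : nat) (y : 'I_n -> {RV P >-> borel H}).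
Let Y w j : H := y j w.

Lemma measurable_qmx_dist x xi : measurable_fun setT (fun w => `|x - qmx (Y w) xi|).
Proof.
rewrite (_ : (fun w => _) = fun w => Num.sqrt (`|x| ^+ 2 - 2 * (\sum_j xi j 0 * inner x (Y w j)) +
  \sum_j \sum_l xi j 0 * xi l 0 * inner (Y w j) (Y w l))); last first.
  apply/funext => w; rewrite -[LHS]ger0_norm// -sqrtr_sqr sqr_normB; congr (Num.sqrt (_ - _ * _ + _)).
    by rewrite /qmx inner_sumr; apply: eq_bigr => j _; rewrite innerZr.
  rewrite -inner_norm /qmx inner_suml; apply: eq_bigr => j _; rewrite inner_sumr.
  by apply: eq_bigr => l _; rewrite innerZl innerZr mulrA.
apply: measurableT_comp; first exact: measurable_sqrt.
apply: measurable_funD.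
  apply: measurable_funB => //; apply: measurable_funM => //.
  apply: measurable_sum => j; apply: measurable_funM => //.
  by apply: measurable_RV_continuous; exact: inner_continuous.
apply: measurable_sum => j; apply: measurable_sum => l; apply: measurable_funM => //.
exact: measurable_inner_RV.
Qed.

Variables (r : T -> nat) (Q : forall w, 'I_(r w) -> H).
Hypothesis oQ : forall w, orthonormal_family (@Q w).
Hypothesis rQ : forall w, range (qmx (@Q w)) = range (qmx (Y w)).

(** [Q] may depend on [w] in any way. But the residual is the distance from [x] to the range of
    [Y w], and rational combinations of the columns suffice to approach it. *)
Lemma measurable_proj_residual x :
  measurable_fun setT (fun w => `|x - qmx (@Q w) (qmx_adj (@Q w) x)|).
Proof.
apply: (measurability _ (RGenInftyO.measurableE R)) => // _ [_ [c ->] <-].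
pose S (q : {ffun 'I_n -> rat}) := [set w | `|x - qmx (Y w) (\col_j ratr (q j))| < c].
rewrite setTI (_ : _ @^-1` _ = \bigcup_m (if unpickle m is Some q then S q else set0)).
  apply: bigcupT_measurable => m; case: (unpickle m) => // q.
  apply: measurable_true.
  by apply: measurable_fun_ltr => //; exact: measurable_qmx_dist.
apply/seteqP; split => w /=; rewrite in_itv/=; last first.
  move=> [m _]; case: (unpickle m) => // q; apply: le_lt_trans.
  exact: (proj_residual_le (@oQ w) (rQ w)).
set D := `|_| => Dc.
have [xi _ xiE] : range (qmx (Y w)) (qmx (@Q w) (qmx_adj (@Q w) x)).
  by rewrite -rQ; exists (qmx_adj (@Q w) x).
pose M := \sum_j `|Y w j| + 1.
have M0 : 0 < M by rewrite ltr_wpDl// sumr_ge0.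
(* Coefficients within [del] of those of the projection move the combination by less than
   [c - D]. *)
pose del := (c - D) / M; have del0 : 0 < del by rewrite divr_gt0// subr_gt0.
have qex j : exists q : rat, `|xi j 0 - ratr q| < del.
  have [|q] := @rat_in_itvoo R (xi j 0 - del) (xi j 0 + del); first lra.
  by rewrite in_itv/= => /andP[q1 q2]; exists q; rewrite ltr_norml; lra.
pose q := [ffun j => xchoose (qex j)].
exists (pickle q) => //; rewrite pickleK /S/=.
have -> : x - qmx (Y w) (\col_j ratr (q j)) =
    (x - qmx (@Q w) (qmx_adj (@Q w) x)) + \sum_j (xi j 0 - ratr (q j)) *: Y w j.
  have -> : \sum_j (xi j 0 - ratr (q j)) *: Y w j = qmx (Y w) xi - qmx (Y w) (\col_j ratr (q j)).
    by rewrite /qmx -sumrB; apply: eq_bigr => j _; rewrite scalerBl mxE.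
  by rewrite -xiE addrA subrK.
apply: le_lt_trans (ler_normD _ _) _; rewrite -/D -ltrBrDl.
apply: (@le_lt_trans _ _ (del * \sum_j `|Y w j|)).
  apply: le_trans (ler_norm_sum _ _ _) _; rewrite mulr_sumr; apply: ler_sum => j _.
  by rewrite normrZ ler_wpM2r// ffunE ltW// (xchooseP (qex j)).
have -> : c - D = del * M by rewrite /del divfK// lt0r_neq0.
by rewrite ltr_pM2l// /M ltrDl.
Qed.

Lemma measurable_proj_error (x : nat -> H) :
  measurable_fun setT (fun w => \sum_(0 <= l <oo) (`|x l - qmx (@Q w) (qmx_adj (@Q w) (x l))| ^+ 2)%:E)%E.
Proof.
apply: (@ge0_emeasurable_sum _ _ _ setT _ xpredT) => [l w _ _|l _].
  by rewrite lee_fin sqr_ge0.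
by apply/measurable_EFinP; apply: measurable_funX; exact: measurable_proj_residual.
Qed.

End projection_error.

End hilbert_random_vectors.

(** * The Gaussian array behind the sketch *)

Section gaussian_sketch.
Context {R : realType} {H1 H2 : hilbertType R}.
Hypothesis sepH2 : separable H2.
Variables (A : {linear H1 -> H2}) (sigma : nat -> R) (u : nat -> H2) (v : nat -> H1).
Hypothesis A_svd : is_svd A sigma u v.
Context d (Omega : measurableType d) (P : probability Omega R).
Variables (n : nat) (y : 'I_n -> {RV P >-> borel H2}).
Hypothesis y_indep : mutually_independent y.
Hypothesis y_law : forall j, centered_gaussian (A \o adjoint A) (distribution P (y j)).

Let V h := inner ((A \o adjoint A) h) h.
Let ou : orthonormal_family u. Proof. by case: A_svd. Qed.

Lemma measurable_inner_y h j : measurable_fun setT (fun w => inner h (y j w : H2)).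
Proof. by apply: measurable_RV_continuous; exact: inner_continuous. Qed.

Lemma inner_y_law h j (B : set R) : measurable B ->
  P [set w | B (inner h (y j w : H2))] = normal_law (V h) B.
Proof. by move=> mB; rewrite -(y_law j h mB). Qed.

Lemma inner_y_ae0 h j : V h = 0 -> {ae P, forall w, inner h (y j w : H2) = 0}.
Proof.
move=> V0; exists [set w | (~` [set (0 : R)]) (inner h (y j w : H2))]; split => //.
- have mC : measurable (~` [set (0 : R)]) by exact: measurableC.
  by have := @measurable_inner_y h j measurableT _ mC; rewrite setTI.
- rewrite inner_y_law; last exact: measurableC.
  by rewrite V0 /normal_law eqxx diracE memNset//= => /(_ erefl).
Qed.

(** [pr] projects to the closed span of [u]. For a dense sequence [s], the functionals of the
    vectors [s m - pr (s m)] have variance 0, so almost surely all of these vectors are orthogonal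
    to [y j]. As [pr] is self-adjoint, [y j - pr (y j)] is then orthogonal to every [s m], hence
    0. *)
Lemma y_expansion_ae :
  {ae P, forall w, forall j, series (fun i => inner (u i) (y j w : H2) *: u i) @ \oo --> (y j w : H2)}.
Proof.
have [s sd] := dense_sequence sepH2.
pose pr (x : H2) : H2 := xget 0 [set z | series (fun i => inner (u i) x *: u i) @ \oo --> z].
have prE x : series (fun i => inner (u i) x *: u i) @ \oo --> pr x.
  exact: (xgetPex 0 (orth_proj ou x)).
have urho x i : inner (u i) (x - pr x) = 0.
  by rewrite innerBr (@orth_series_coef _ _ u ou _ _ i (@prE x)) subrr.
have prC x z : inner (pr x) z = inner x (pr z).
  have h1 := @inner_series _ _ z _ _ (@prE x); have h2 := @inner_series _ _ x _ _ (@prE z).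
  rewrite innerC; apply: cvg_unique h1 _ => //; apply: cvg_trans h2.
  rewrite (_ : (fun i => inner x _) = fun i => inner z (inner (u i) x *: u i))//.
  by apply/funext => i; rewrite !innerZr (innerC x) (innerC z) mulrC.
have h j : {ae P, forall w, forall m, inner (s m - pr (s m)) (y j w : H2) = 0}.
  apply: ae_foralln => m; apply: inner_y_ae0; apply: (covariance0 A_svd) => i; exact: urho.
(* The quantifier over ordinals is rephrased over [nat], to intersect countably many almost sure
   events. *)
have hall : {ae P, forall w, forall i, (fun i w => forall j : 'I_n, i = j :> nat -> forall m, inner (s m - pr (s m)) (y j w : H2) = 0) i w}.
  apply: ae_foralln => i; have [ilt|ige] := ltnP i n; last first.
    by apply: aeW => w j ij; move: ige; rewrite ij leqNgt ltn_ord.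
  have := h (Ordinal ilt); apply: filterS => w hw j ij.
  by rewrite (_ : j = Ordinal ilt)//; exact/val_inj.
apply: filterS hall => w hw j; have {}hw m := hw j j erefl m.
pose x : H2 := y j w; pose rho := x - pr x.
suff rho0 : rho = 0.
  have xE : x = pr x by apply/eqP; rewrite -subr_eq0; apply/eqP.
  by rewrite -/x [X in _ --> X]xE; exact: prE.
have srho m : inner (s m) rho = 0.
  by rewrite /rho innerBr -prC -innerBl; exact: hw.
apply/eqP; apply: contraT => rN.
have [||m /=] := sd ((fun z => inner rho z) @^-1` [set t | t != 0]).
- by exists rho; rewrite /= inner_norm expf_neq0// normr_eq0.
- by apply: open_comp => [z _|]; [exact: inner_continuous|exact: open_neq].
by rewrite innerC srho eqxx.
Qed.

Lemma y_null_ae : {ae P, forall w, forall i j, sigma i = 0 -> inner (u i) (y j w : H2) = 0}.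
Proof.
apply: ae_foralln => i; have [s0|sN] := eqVneq (sigma i) 0; last first.
  by apply: aeW => w j s0; rewrite s0 eqxx in sN.
have Vu : V (u i) = 0.
  apply: cvg_unique (@covariance_series _ _ _ _ _ _ _ A_svd (u i)) _ => //; apply: cvg_near_cst.
  apply: nearW => m; rewrite /series/= big1// => l _; rewrite ou.
  by case: eqVneq => [->|_]; rewrite ?s0 ?mul0r ?mulr0 expr0n.
have h : {ae P, forall w, forall j : 'I_n, inner (u i) (y j w : H2) = 0}.
  have hm : {ae P, forall w, forall m, (fun m w => forall j : 'I_n, m = j :> nat -> inner (u i) (y j w : H2) = 0) m w}.
    apply: ae_foralln => m; have [ilt|ige] := ltnP m n; last first.
      by apply: aeW => w j ij; move: ige; rewrite ij leqNgt ltn_ord.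
    have := @inner_y_ae0 (u i) (Ordinal ilt) Vu; apply: filterS => w hw j ij.
    by rewrite (_ : j = Ordinal ilt)//; exact/val_inj.
  by apply: filterS hm => w hw j; exact: (hw j j erefl).
by apply: filterS h => w hw j _; exact: hw.
Qed.

(* Junk value: [coefs w i j = 0] when [sigma i = 0]. *)
Definition coefs (w : Omega) (i : nat) (j : 'I_n) : R := inner (u i) (y j w : H2) / sigma i.

(** In a linear form [a] of the entries, column [j] contributes [sqrt (S j) <h j, y j>] with [h j]
    scaled to variance 1. This suits [centered_gaussian], which speaks of one functional at a time;
    independence over [j] and [sum_j S j = |a|^2] do the rest. *)
Lemma coefs_gaussian_mx K : 0 < sigma K -> gaussian_mx P (fun w => \matrix_(i < K.+1, j < n) coefs w i j).
Proof.
move=> sK; have sp i : (i <= K)%N -> 0 < sigma i.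
  by move=> iK; apply: lt_le_trans sK _; case: A_svd => + _ _ _ _; apply.
split=> [[i j]|a th] /=.
  rewrite (_ : (fun w => _) = fun w => coefs w i j); last by apply/funext => w; rewrite mxE.
  by apply: measurable_funM => //; exact: measurable_inner_y.
pose aa i j := a (inord i, j).
pose S j := \sum_(0 <= i < K.+1) aa i j ^+ 2.
have S0 j : 0 <= S j by apply: sumr_ge0 => i _; exact: sqr_ge0.
(* If column [j] of [a] is zero, any [h j] of variance 1 serves, here [u_0 / sigma_0]. *)
pose b j i := if S j == 0 then (i == 0)%N%:R / sigma 0%N else aa i j / sigma i / Num.sqrt (S j).
pose h j := \sum_(0 <= i < K.+1) b j i *: u i.
have Vh j : V (h j) = 1.
  rewrite /V (covariance_sum A_svd) /b; case: eqVneq => [Sj|Sj].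
    rewrite big_nat_recl//= mul1r divff ?lt0r_neq0 ?sp// expr1n.
    by rewrite big1 ?addr0// => i _; rewrite mul0r mulr0 expr0n.
  have Sp : 0 < S j by rewrite lt_neqAle eq_sym Sj S0.
  rewrite (eq_big_nat _ _ (F2 := fun i => aa i j ^+ 2 / S j)).
    by rewrite -mulr_suml divff.
  move=> i /andP[_ iK]; rewrite mulrA mulrCA divff ?mulr1 ?lt0r_neq0 ?sp//.
  by rewrite exprMn exprVn sqr_sqrtr.
pose X j w := inner (h j) (y j w : H2).
have gX : gaussian P X.
  apply: independent_gaussian => [j|j B mB|B mB].
  - exact: measurable_inner_y.
  - by rewrite [LHS](inner_y_law (h j) j mB) Vh /normal_law oner_eq0 sqrtr1.
  pose C j : set (borel H2) := inner (h j) @^-1` B j.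
  have mC j : measurable (C j).
    have := @measurable_borel_continuous _ H2 _ (@inner_continuous _ _ (h j)) measurableT _ (mB j).
    by rewrite setTI.
  have := y_indep [set: 'I_n]%SET mC.
  rewrite (_ : [set` [set: 'I_n]%SET] = setT); last by apply/seteqP; split => j //= _; rewrite inE.
  by move=> ->; apply: eq_bigl => j; rewrite inE.
have E w : \sum_ij a ij * (\matrix_(i < K.+1, j < n) coefs w i j) ij.1 ij.2 = \sum_j Num.sqrt (S j) * X j w.
  rewrite (eq_bigr (fun ij => a (ij.1, ij.2) * coefs w ij.1 ij.2)); last first.
    by move=> [i j] _; rewrite mxE.
  rewrite -(pair_bigA _ (fun i j => a (i, j) * coefs w i j))/= exchange_big/=.
  apply: eq_bigr => j _.
  rewrite /X /h inner_suml big_mkord mulr_sumr; apply: eq_bigr => i _.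
  rewrite innerZl /coefs /b; case: eqVneq => [Sj|Sj].
    have /psumr_eq0P : forall i : 'I_K.+1, true -> 0 <= aa i j ^+ 2 by move=> ? _; exact: sqr_ge0.
    move=> h0; have /eqP := h0 (etrans (esym (big_mkord _ _)) Sj) i isT.
    by rewrite sqrf_eq0 /aa inord_val => /eqP ->; rewrite Sj sqrtr0 !mul0r.
  have Sp : 0 < S j by rewrite lt_neqAle eq_sym Sj S0.
  rewrite /aa inord_val; field.
  by rewrite !lt0r_neq0 ?sqrtr_gt0// sp// -ltnS.
have SE : \sum_j Num.sqrt (S j) ^+ 2 = \sum_ij a ij ^+ 2.
  rewrite [RHS](eq_bigr (fun ij => a (ij.1, ij.2) ^+ 2)); last by move=> [i j].
  rewrite -(pair_bigA _ (fun i j => a (i, j) ^+ 2))/= exchange_big/=.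
  apply: eq_bigr => j _; rewrite sqr_sqrtr// /S big_mkord.
  by apply: eq_bigr => i _; rewrite /aa inord_val.
under eq_integral do rewrite E.
by have [_ gE] := gX; rewrite gE SE.
Qed.

End gaussian_sketch.

(** * The error of the randomized singular value decomposition *)

Section randomized_svd.
Context {R : realType} {H1 H2 : hilbertType R}.
Hypothesis sepH2 : separable H2.
Variables (e : nat -> H1) (e_basis : orthonormal_basis e).
Variables (A : {linear H1 -> H2}) (sigma : nat -> R) (u : nat -> H2) (v : nat -> H1).
Hypothesis A_svd : is_svd A sigma u v.
Context d (Omega : measurableType d) (P : probability Omega R).
Variables (n : nat) (y : 'I_n -> {RV P >-> borel H2}).
Hypothesis y_indep : mutually_independent y.
Hypothesis y_law : forall j, centered_gaussian (A \o adjoint A) (distribution P (y j)).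
Variables (r : Omega -> nat) (Q : forall w, 'I_(r w) -> H2).
Hypothesis oQ : forall w, orthonormal_family (@Q w).
Hypothesis rQ : forall w, range (qmx (@Q w)) = range (qmx (fun j => y j w : H2)).

Let sg0 i : 0 <= sigma i. Proof. by case: A_svd. Qed.
Let sgS i j : (i <= j)%N -> sigma j <= sigma i.
Proof. by move=> ij; case: A_svd => + _ _ _ _; apply. Qed.

Definition sqerr w : \bar R :=
  (\sum_(0 <= l <oo) (`|A (e l) - (qmx (@Q w) \o qmx_adj (@Q w) \o A) (e l)| ^+ 2)%:E)%E.

Lemma sqerr_ge0 w : (0 <= sqerr w)%E.
Proof. by apply: nneseries_ge0 => l _ _; rewrite lee_fin sqr_ge0. Qed.

Lemma measurable_sqerr : measurable_fun setT sqerr.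
Proof. exact: (@measurable_proj_error _ _ sepH2 _ _ _ n y r Q oQ rQ (fun l => A (e l))). Qed.

Notation cf := (coefs sigma u y).
Notation sketch k := (fun w => \matrix_(i < k, j < n) cf w i j).

Definition pinvn k w : 'M[R]_(n, k) := rinv (\matrix_(i < k, j < n) cf w i j).

(** The contribution of direction [i] to the bound for the squared error beyond [sigma i ^+ 2]. *)
Definition lev k w i : R := sigma i ^+ 2 * sqn ((\row_j cf w i j) *m pinvn k w).

Lemma lev_ge0 k w i : 0 <= lev k w i.
Proof. by rewrite mulr_ge0 ?sqr_ge0 ?sqn_ge0. Qed.

Lemma sqerr_le_ae k : {ae P, forall w, \det ((sketch k w) *m (sketch k w)^T) != 0 ->
  (sqerr w <= \sum_(k <= i <oo) (sigma i ^+ 2 + lev k w i)%:E)%E}.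
Proof.
apply: filterS2 (y_expansion_ae sepH2 A_svd y_law) (y_null_ae A_svd y_law) => w yser ynull d0.
have yg i j : inner (u i) (y j w : H2) = sigma i * cf w i j.
  rewrite /coefs; have [s0|sN] := eqVneq (sigma i) 0; first by rewrite s0 mul0r ynull.
  by rewrite mulrC divfK.
have GN : grows (cf w) k *m pinvn k w = 1%:M by exact: mul_rinv d0.
have := error_le A_svd yser yg GN e_basis (oQ (w := w)) (rQ w).
by under [in X in (_ <= X)%E -> _]eq_eseriesr do rewrite mulrDr mulr1.
Qed.

Lemma sketch_det_ae k : (k <= n)%N -> (forall i, (i < k)%N -> 0 < sigma i) ->
  {ae P, forall w, \det ((sketch k w) *m (sketch k w)^T) != 0}.
Proof.
case: k => [|k] kn sp; first by apply: aeW => w; rewrite det_mx00 oner_eq0.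
have gG := coefs_gaussian_mx A_svd y_indep y_law (sp k (ltnSn k)).
have P0 := gaussian_mx_det gG kn.
exists [set w | \det ((sketch k.+1 w) *m (sketch k.+1 w)^T) == 0]; split => //.
  apply: measurable_true; apply: measurable_fun_eqr => //.
  exact: measurable_gram_det (gaussian_mx_mmx gG).
by move=> w /= /negP; rewrite negbK.
Qed.

(* [A] has rank at most [k < n], and almost surely the sketch spans its range. *)
Lemma sqerr_null_ae k : (k < n)%N -> sigma k = 0 -> {ae P, forall w, sqerr w = 0%E}.
Proof.
move=> kn sk0; have ex0 : exists i, sigma i == 0 by exists k; rewrite sk0.
(* The index of the first vanishing singular value: the rows before it are Gaussian, as
   [sketch_det_ae] requires, and all terms from it on are 0. *)
pose k' := ex_minn ex0.
have [sk' kmin] : sigma k' = 0 /\ forall i, sigma i == 0 -> (k' <= i)%N.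
  by rewrite /k'; case: ex_minnP => m /eqP.
have k'k : (k' <= k)%N by apply: kmin; rewrite sk0.
have sp i : (i < k')%N -> 0 < sigma i.
  move=> ik; rewrite lt_neqAle sg0 andbT eq_sym; apply/negP => /kmin.
  by rewrite leqNgt ik.
apply: filterS2 (sqerr_le_ae k') (sketch_det_ae (ltnW (leq_ltn_trans k'k kn)) sp) => w h /h.
move=> le; apply/eqP; rewrite eq_le sqerr_ge0 andbT (le_trans le)//.
rewrite eseries_cond eseries0// => i _ /andP[_ k'i].
have si0 : sigma i = 0 by apply/eqP; rewrite eq_le sg0 andbT -sk' sgS.
by rewrite /lev si0 expr0n mul0r addr0.
Qed.

End randomized_svd.

Section randomized_svd_bounds.
Context {R : realType} {H1 H2 : hilbertType R}.
Variables (A : {linear H1 -> H2}) (sigma : nat -> R) (u : nat -> H2) (v : nat -> H1).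
Hypothesis A_svd : is_svd A sigma u v.
Context d (Omega : measurableType d) (P : probability Omega R).
Variables (k p : nat) (y : 'I_(k.+1 + p) -> {RV P >-> borel H2}).
Hypothesis y_indep : mutually_independent y.
Hypothesis y_law : forall j, centered_gaussian (A \o adjoint A) (distribution P (y j)).
Hypothesis sk0 : 0 < sigma k.

Let sg0 i : 0 <= sigma i. Proof. by case: A_svd. Qed.
Let sgS i j : (i <= j)%N -> sigma j <= sigma i.
Proof. by move=> ij; case: A_svd => + _ _ _ _; apply. Qed.

Notation cf := (coefs sigma u y).
Notation lv := (lev sigma u y k.+1).
Notation sketch L := (fun w => \matrix_(i < k.+1 + L, j < k.+1 + p) cf w i j).

Lemma sketch_gaussian_mx L : 0 < sigma (k + L)%N -> gaussian_mx P (sketch L).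
Proof. by move=> sL; exact: (coefs_gaussian_mx A_svd y_indep y_law (K := k + L) sL). Qed.

Lemma weighted_sketch L (s : 'I_L -> R) w :
  weighted s (sketch L w) = \sum_i s i ^+ 2 * sqn ((\row_j cf w (k.+1 + i) j) *m pinvn sigma u y k.+1 w).
Proof.
apply: eq_bigr => i _; congr (_ * sqn (_ *m _)); first by apply/rowP => j; rewrite !mxE.
by rewrite /pinvn; congr rinv; apply/matrixP => a b; rewrite !mxE.
Qed.

Lemma measurable_lev i : measurable_fun setT (fun w => lv w i).
Proof.
apply: measurable_funM => //; apply: measurable_sqn; apply: measurable_mx_mul.
  move=> a b; rewrite (_ : (fun t => _) = fun t => cf t i b); last by apply/funext => t; rewrite mxE.
  by apply: measurable_funM => //; exact: measurable_inner_y.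
by apply: measurable_mx_rinv; apply: gaussian_mx_mmx (coefs_gaussian_mx A_svd y_indep y_law sk0).
Qed.

Lemma lev_mean m : (2 <= p)%N ->
  (\int[P]_w (lv w (k.+1 + m))%:E <= (sigma (k.+1 + m) ^+ 2 * (k.+1%:R / (p%:R - 1)))%:E)%E.
Proof.
move=> p2; have [s0|sN] := eqVneq (sigma (k.+1 + m)%N) 0.
  by rewrite /lev s0 expr0n/= mul0r; under eq_integral do rewrite mul0r; rewrite integral0.
have sp : 0 < sigma (k + m.+1)%N by rewrite -addSnnS lt_neqAle eq_sym sN sg0.
(* Weights concentrated on the last row extract a single term from [weighted]. *)
pose s (a : 'I_m.+1) := (a == ord_max)%:R * sigma (k.+1 + m)%N.
have sE (f : 'I_m.+1 -> R) : \sum_a s a ^+ 2 * f a = sigma (k.+1 + m)%N ^+ 2 * f ord_max.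
  rewrite (bigD1 ord_max)//= /s eqxx mul1r big1 ?addr0// => a /negbTE ->.
  by rewrite mul0r expr0n mul0r.
have := weighted_mean s (sketch_gaussian_mx sp) p2.
under eq_integral do rewrite weighted_sketch sE.
have -> : \sum_a s a ^+ 2 = sigma (k.+1 + m)%N ^+ 2.
  by rewrite -[RHS]mulr1 -(sE (fun=> 1)); apply: eq_bigr => a _; rewrite mulr1.
by [].
Qed.

Definition levsum L w : R := \sum_(0 <= a < L) lv w (k.+1 + a).

Lemma measurable_levsum L : measurable_fun setT (levsum L).
Proof. by apply: measurable_sum => i; exact: measurable_lev. Qed.

(** The bound is the same for all [L], which permits the limit. The induction serves only for a
    vanishing singular value, when the new term is 0; otherwise all the rows involved are Gaussian
    and [weighted_tail] applies directly. *)
Lemma levsum_tail L (tau t x : R) : (4 <= p)%N -> 0 < t -> 0 < x -> 0 <= tau ->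
  (forall L, \sum_(0 <= a < L) sigma (k.+1 + a) ^+ 2 <= tau ^+ 2) ->
  (P [set w | ((tau * (t * Num.sqrt (3 * k.+1%:R / p.+1%:R)) +
      x * (sigma k.+1 * (t * (expR 1 * Num.sqrt (k + p.+1)%:R / p.+1%:R)))) ^+ 2 < levsum L w)%R] <=
   (t ^- p + t ^- p.+1 + expR (- (x ^+ 2 / 2)))%:E)%E.
Proof.
move=> p4 t0 x0 tau0 stau; set c := (_ + _) ^+ 2.
elim: L => [|L IH].
  rewrite (_ : [set w | _] = set0) ?measure0.
    by rewrite lee_fin !addr_ge0 ?expR_ge0// invr_ge0 exprn_ge0// ltW.
  by apply/seteqP; split => w //=; rewrite /levsum big_geq// ltNge sqr_ge0.
have [s0|sN] := eqVneq (sigma (k.+1 + L)%N) 0.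
  rewrite (_ : levsum L.+1 = levsum L)//; apply/funext => w.
  by rewrite /levsum big_nat_recr//= /lev s0 expr0n mul0r addr0.
have sp : 0 < sigma (k + L.+1)%N by rewrite -addSnnS lt_neqAle eq_sym sN sg0.
pose s (a : 'I_L.+1) := sigma (k.+1 + a)%N.
have := @weighted_tail _ _ _ P k p _ s _ (sigma k.+1) tau t x (sketch_gaussian_mx sp) p4 t0 x0.
rewrite -/c; under eq_set do rewrite weighted_sketch.
have lE w : levsum L.+1 w =
    \sum_i s i ^+ 2 * sqn ((\row_j cf w (k.+1 + i) j) *m pinvn sigma u y k.+1 w).
  by rewrite /levsum big_mkord.
under [X in _ -> (P X <= _)%E]eq_set do rewrite lE.
apply => //.
- by move=> i; rewrite sg0 sgS// leq_addr.
- by have := stau L.+1; rewrite big_mkord.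
Qed.

Lemma lev_series w c : (forall L, levsum L w <= c) -> (\sum_(k.+1 <= i <oo) (lv w i)%:E <= c%:E)%E.
Proof.
move=> Lc; rewrite -nneseries_addn; last by move=> i; rewrite lee_fin lev_ge0.
apply: lime_le; first by apply: is_cvg_nneseries => i _ _; rewrite lee_fin lev_ge0.
apply: nearW => L; rewrite sumEFin lee_fin; apply: le_trans (Lc L).
by rewrite le_eqVlt; apply/orP; left; apply/eqP; apply: eq_bigr => i _; rewrite (addnC i).
Qed.

End randomized_svd_bounds.

Section main_bounds.
Context {R : realType} {H1 H2 : hilbertType R}.
Hypothesis sepH2 : separable H2.
Variables (e : nat -> H1) (e_basis : orthonormal_basis e).
Variables (A : {linear H1 -> H2}) (sigma : nat -> R) (u : nat -> H2) (v : nat -> H1).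
Hypothesis A_svd : is_svd A sigma u v.
Context d (Omega : measurableType d) (P : probability Omega R).
Variables (k p : nat) (y : 'I_(k.+1 + p) -> {RV P >-> borel H2}).
Hypothesis y_indep : mutually_independent y.
Hypothesis y_law : forall j, centered_gaussian (A \o adjoint A) (distribution P (y j)).
Variables (r : Omega -> nat) (Q : forall w, 'I_(r w) -> H2).
Hypothesis oQ : forall w, orthonormal_family (@Q w).
Hypothesis rQ : forall w, range (qmx (@Q w)) = range (qmx (fun j => y j w : H2)).

Let sg0 i : 0 <= sigma i. Proof. by case: A_svd. Qed.
Let sgS i j : (i <= j)%N -> sigma j <= sigma i.
Proof. by move=> ij; case: A_svd => + _ _ _ _; apply. Qed.

Notation cf := (coefs sigma u y).
Notation lv := (lev sigma u y k.+1).
Notation err := (sqerr e A Q).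
Notation tail := (\sum_(k.+1 <= i <oo) (sigma i ^+ 2)%:E)%E.

Let sq0 i : (0 <= (sigma i ^+ 2)%:E)%E. Proof. by rewrite lee_fin sqr_ge0. Qed.

Lemma err_le_ae : 0 < sigma k ->
  {ae P, forall w, (err w <= \sum_(k.+1 <= i <oo) (sigma i ^+ 2 + lv w i)%:E)%E}.
Proof.
move=> sk; have sp i : (i < k.+1)%N -> 0 < sigma i by move=> ik; apply: lt_le_trans sk _; exact: sgS.
apply: filterS2 (sqerr_le_ae sepH2 e_basis A_svd y_law oQ rQ k.+1)
  (sketch_det_ae A_svd y_indep y_law (leq_addr p k.+1) sp) => w h; exact: h.
Qed.

Lemma err_null_ae : sigma k = 0 -> {ae P, forall w, err w = 0%E}.
Proof.
exact: (sqerr_null_ae sepH2 e_basis A_svd y_indep y_law oQ rQ (leq_addr p k.+1)).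
Qed.

Lemma err_mean : (2 <= p)%N -> (\int[P]_w err w <= (1 + k.+1%:R / (p%:R - 1))%:E * tail)%E.
Proof.
move=> p2; have merr := measurable_sqerr sepH2 e A oQ rQ.
have err0 w := sqerr_ge0 e A Q w.
have c0 : 0 <= 1 + k.+1%:R / (p%:R - 1) :> R.
  by rewrite addr_ge0// divr_ge0// subr_ge0 ler1n ltnW.
have tail0 : (0 <= tail)%E by exact: nneseries_ge0.
(* [sigma k] is the last singular value retained by the rank [k.+1]. If it is positive, the first
   [k.+1] rows of the array are Gaussian and the right inverse exists almost surely. *)
have [sk|skN] := eqVneq (sigma k) 0.
  apply: (@le_trans _ _ (\int[P]_w 0)%E); last by rewrite integral0 mule_ge0.
  apply: ae_ge0_le_integral => //.
  by apply: filterS (err_null_ae sk) => w -> _.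
have sk : 0 < sigma k by rewrite lt_neqAle eq_sym skN sg0.
pose F m w := (sigma (m + k.+1)%N ^+ 2 + lv w (m + k.+1)%N)%:E.
have F0 m w : (0 <= F m w)%E by rewrite lee_fin addr_ge0 ?sqr_ge0 ?lev_ge0.
have mF m : measurable_fun setT (F m).
  by apply/measurable_EFinP; apply: measurable_funD => //; exact: (measurable_lev A_svd y_indep y_law sk).
have BE w : (\sum_(k.+1 <= i <oo) (sigma i ^+ 2 + lv w i)%:E = \sum_(m <oo) F m w)%E.
  have := @nneseries_addn R (fun i => (sigma i ^+ 2 + lv w i)%:E) k.+1 => <- // i.
  by rewrite lee_fin addr_ge0 ?sqr_ge0 ?lev_ge0.
have mB : measurable_fun setT (fun w => \sum_(m <oo) F m w)%E.
  by apply: (@ge0_emeasurable_sum _ _ _ setT _ xpredT) => [m w _ _|m _].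
apply: (@le_trans _ _ (\int[P]_w \sum_(m <oo) F m w)%E).
  apply: ae_ge0_le_integral => //.
    by move=> w _; exact: nneseries_ge0.
  by apply: filterS (err_le_ae sk) => w + _; rewrite BE.
rewrite integral_nneseries//.
apply: (@le_trans _ _ (\sum_(m <oo) ((1 + k.+1%:R / (p%:R - 1))%:E * (sigma (m + k.+1)%N ^+ 2)%:E))%E).
  apply: lee_nneseries => [m _ _|m _]; first exact: integral_ge0.
  rewrite /F; under eq_integral do rewrite EFinD.
  rewrite ge0_integralD//; last 2 first.
  - by move=> w _; rewrite lee_fin lev_ge0.
  - by apply/measurable_EFinP; exact: (measurable_lev A_svd y_indep y_law sk).
  rewrite prob_cst// -EFinM mulrDl mul1r EFinD leeD2l// (addnC m) mulrC.
  exact: (lev_mean A_svd y_indep y_law m p2).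
rewrite nneseriesZl; last by move=> i _; exact: sq0.
by rewrite (@nneseries_addn R (fun i => (sigma i ^+ 2)%:E) k.+1).
Qed.

(** The events [E L] increase, so their union still has probability at most [beta]. Outside it and
    the null set [Z] the squared error is at most [tau^2 + c^2 <= (tau + c)^2]. *)
Lemma err_tail (tau t x c : R) : (4 <= p)%N -> 0 < t -> 0 < x -> 0 <= tau -> tail = (tau ^+ 2)%:E ->
  c = tau * (t * Num.sqrt (3 * k.+1%:R / p.+1%:R)) +
      x * (sigma k.+1 * (t * (expR 1 * Num.sqrt (k + p.+1)%:R / p.+1%:R))) ->
  ((1 - (t ^- p + t ^- p.+1 + expR (- (x ^+ 2 / 2))))%:E <=
   P [set w | (err w <= ((tau + c) ^+ 2)%:E)%E])%E.
Proof.
move=> p4 t0 x0 tau0 tailE cE; set beta := t ^- p + _ + _; set D := [set w | _].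
have beta0 : 0 <= beta.
  by rewrite !addr_ge0 ?expR_ge0// invr_ge0 exprn_ge0// ltW.
have c0 : 0 <= c.
  rewrite cE addr_ge0// mulr_ge0 ?(ltW x0)//; first by rewrite mulr_ge0// ltW.
  by rewrite mulr_ge0// mulr_ge0 ?(ltW t0)// divr_ge0// mulr_ge0// expR_ge0.
have merr := measurable_sqerr sepH2 e A oQ rQ.
have mD : measurable D.
  rewrite /D (_ : [set w | _] = [set w | ~~ (((tau + c) ^+ 2)%:E < err w)%E]).
    by apply: measurable_true; apply: measurable_neg; apply: measurable_fun_lte.
  by apply/funext => w /=; rewrite -leNgt.
suff PD : (P (~` D) <= beta%:E)%E.
  have -> : P D = (1 - P (~` D))%E by rewrite -probability_setC ?setCK//; exact: measurableC.
  by rewrite EFinB leeB.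
have [sk|skN] := eqVneq (sigma k) 0.
  rewrite measure_negligible ?lee_fin//; first exact: measurableC.
  have h : {ae P, forall w, D w}.
    by apply: filterS (err_null_ae sk) => w h; rewrite /D/= h lee_fin sqr_ge0.
  exact: h.
have sk : 0 < sigma k by rewrite lt_neqAle eq_sym skN sg0.
have [Z [mZ PZ0 goodZ]] := err_le_ae sk.
pose E L := [set w | c ^+ 2 < levsum sigma u y L w].
have mlev L : measurable_fun setT (levsum sigma u y L) by exact: (measurable_levsum A_svd y_indep y_law sk).
have mE L : measurable (E L) by apply: measurable_true; apply: measurable_fun_ltr.
have mUE : measurable (\bigcup_L E L) by exact: bigcupT_measurable.
have stau L : \sum_(0 <= a < L) sigma (k.+1 + a) ^+ 2 <= tau ^+ 2.
  rewrite -lee_fin -tailE -(@nneseries_addn R (fun i => (sigma i ^+ 2)%:E) k.+1)// -sumEFin.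
  apply: le_trans (nneseries_lim_ge L _) => [|i _ _]; last exact: sq0.
  by rewrite le_eqVlt; apply/orP; left; apply/eqP; apply: eq_bigr => i _; rewrite addnC.
have PE L : (P (E L) <= beta%:E)%E.
  by have := levsum_tail A_svd y_indep y_law L p4 t0 x0 tau0 stau; rewrite -cE.
have PUE : (P (\bigcup_L E L) <= beta%:E)%E.
  have ndE : nondecreasing_seq E.
    move=> a b ab; apply/subsetPset => w; rewrite /E/= => /lt_le_trans; apply.
    rewrite /levsum (@big_cat_nat _ _ _ a 0 b)//= lerDl.
    by apply: sumr_ge0 => i _; exact: lev_ge0.
  have := nondecreasing_cvg_mu (mu := P) mE mUE ndE => /cvg_lim <-//.
  apply: lime_le; last by apply: nearW => L; exact: PE.
  by apply/cvg_ex; exists (P (\bigcup_L E L)); exact: nondecreasing_cvg_mu.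
apply: (@le_trans _ _ (P ((\bigcup_L E L) `|` Z))).
  apply: le_measure; rewrite ?inE; [exact: measurableC|exact: measurableU|].
  move=> w; rewrite /D/= => Dw; have [Zw|nZ] := pselect (Z w); [by right|left].
  apply: contrapT => nE; apply: Dw.
  have good : (err w <= \sum_(k.+1 <= i <oo) (sigma i ^+ 2 + lv w i)%:E)%E.
    by apply: contrapT => h; apply: nZ; exact: goodZ.
  apply: (le_trans good); under eq_eseriesr do rewrite EFinD.
  rewrite nneseriesD => [|i _ _|i _ _]; [|exact: sq0|by rewrite lee_fin lev_ge0].
  apply: (@le_trans _ _ ((tau ^+ 2)%:E + (c ^+ 2)%:E)%E); last first.
    by rewrite -EFinD lee_fin sqrrD lerD2r lerDl mulrn_wge0// mulr_ge0.
  rewrite tailE leeD2l//; apply: lev_series => L; rewrite leNgt; apply/negP => h.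
  by apply: nE; exists L.
have PEZ : (P (\bigcup_L E L) + P Z <= beta%:E)%E by rewrite PZ0 adde0.
exact: le_trans (measureU2 P mUE mZ) PEZ.
Qed.

End main_bounds.

Local Open Scope ereal_scope.

Theorem theorem2 (R : realType) (H1 H2 : hilbertType R)
    (sepH1 : separable H1) (sepH2 : separable H2)
    (infH1 : infinite_dimensional H1) (infH2 : infinite_dimensional H2)
    (e : nat -> H1) (e_basis : orthonormal_basis e)
    (A : {linear H1 -> H2}) (A_HS : hilbert_schmidt e A)
    (sigma : nat -> R) (u_ : nat -> H2) (v_ : nat -> H1)
    (A_svd : is_svd A sigma u_ v_)
    (k p : nat) (k1 : (1 <= k)%N)
    (d : measure_display) (Omega : measurableType d) (P : probability Omega R)
    (y : 'I_(k + p) -> {RV P >-> borel H2})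
    (y_indep : mutually_independent y)
    (y_law : forall j, centered_gaussian (A \o adjoint A) (distribution P (y j)))
    (r : Omega -> nat) (Q : forall w, 'I_(r w) -> H2)
    (Q_orthonormal : forall w, orthonormal_family (Q w))
    (Q_range : forall w, range (qmx (Q w)) = range (qmx (fun j => y j w : H2))) :
  let Ahat w := qmx (Q w) \o qmx_adj (Q w) \o A in
  let error w := hs_norm e (fun x => (A x - Ahat w x)%R) in
  let tail := \sum_(k <= i <oo) (sigma i ^+ 2)%:E in
  ((2 <= p)%N ->
     \int[P]_w (error w ^+ 2) <= (1 + k%:R / (p%:R - 1))%:E * tail) /\
  ((2 <= k)%N -> (4 <= p)%N -> forall u t : R, (1 <= u)%R -> (1 <= t)%R ->
     let eta :=
       (t * Num.sqrt (3 * k%:R / (p%:R + 1)))%:E * sqrte tail +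
       (u * t * (expR 1 * Num.sqrt (k + p)%:R / (p%:R + 1)) * sigma k)%:E in
     (1 - 2 * t ^- p - expR (- (u ^+ 2 / 2)))%:E <=
       P [set w | error w <= sqrte tail + eta]).
Proof.
move=> Ahat error tail.
have tail0 : 0 <= tail by apply: nneseries_ge0 => i _ _; rewrite lee_fin sqr_ge0.
(* From here on the target rank is [k.+1]: the last retained singular value is [sigma k], the first
   discarded one [sigma k.+1]. *)
case: k k1 y y_indep y_law Q_range @tail tail0 @Ahat @error => [//|k] _ y y_indep y_law Q_range tail tail0 Ahat error.
have errE w : error w = sqrte (sqerr e A Q w) by [].
split=> [p2|k2 p4 x t x1 t1].
  under eq_integral do rewrite errE sqr_sqrte ?sqerr_ge0//.
  exact: (err_mean sepH2 e_basis A_svd y_indep y_law Q_orthonormal Q_range p2).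
set eta := _ + _; lazy zeta.
have t0 : (0 < t)%R by exact: lt_le_trans t1.
have x0 : (0 < x)%R by exact: lt_le_trans x1.
have sg0 i : (0 <= sigma i)%R by case: A_svd.
(* As [t >= 1], the cost of a large operator norm is at most that of a large Frobenius norm, whence
   the coefficient 2. *)
have tp : (t ^- p.+1 <= t ^- p)%R.
  by rewrite lef_pV2 ?posrE ?exprn_gt0// exprS ler_peMl// exprn_ge0// ltW.
have le1 : ((1 - 2 * t ^- p - expR (- (x ^+ 2 / 2)))%R%:E <=
    (1 - (t ^- p + t ^- p.+1 + expR (- (x ^+ 2 / 2))))%R%:E).
  by rewrite lee_fin; move: (expR _) (t ^- p) (t ^- p.+1)%R tp => a b c bc; lra.
have a0 : (0 < t * Num.sqrt (3 * k.+1%:R / (p%:R + 1)))%R.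
  by rewrite mulr_gt0// sqrtr_gt0 divr_gt0// mulr_gt0.
(* An infinite tail makes the bound infinite and the event certain; [a0] rules out the product of 0
   and [+oo] in [eta]. *)
have [tl|] := eqVneq tail +oo.
  have -> : [set w | error w <= sqrte tail + eta] = setT.
    apply/seteqP; split => w //= _.
    by rewrite /eta tl /= gt0_muley ?lte_fin// !addye// leey.
  apply: le_trans le1 _; rewrite probability_setT lee_fin lerBlDr lerDl.
  by rewrite !addr_ge0 ?expR_ge0// invr_ge0 exprn_ge0// ltW.
move: tail0; rewrite /eta; case tailE : tail => [tl| |] // tl0 _.
pose tau := Num.sqrt tl.
have tau2 : (tau ^+ 2 = tl)%R by rewrite sqr_sqrtr// -lee_fin.
apply: le_trans le1 _.
have tE : tail = (tau ^+ 2)%R%:E by rewrite tau2.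
pose c := (tau * (t * Num.sqrt (3 * k.+1%:R / p.+1%:R)) +
  x * (sigma k.+1 * (t * (expR 1 * Num.sqrt (k + p.+1)%:R / p.+1%:R))))%R.
have h := err_tail sepH2 e_basis A_svd y_indep y_law Q_orthonormal Q_range
  p4 t0 x0 (sqrtr_ge0 tl) tE (erefl c).
apply: le_trans h _.
have c0 : (0 <= tau + c)%R.
  rewrite !addr_ge0 ?sqrtr_ge0// mulr_ge0 ?sqrtr_ge0 ?(ltW x0)//; first by rewrite mulr_ge0// ltW.
  by rewrite mulr_ge0// mulr_ge0 ?(ltW t0)// divr_ge0// mulr_ge0// expR_ge0.
have -> : sqrte tl%:E + ((t * Num.sqrt (3 * k.+1%:R / (p%:R + 1)))%R%:E * sqrte tl%:E +
    (x * t * (expR 1 * Num.sqrt (k.+1 + p)%:R / (p%:R + 1)) * sigma k.+1)%R%:E) = (tau + c)%R%:E.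
  rewrite /= -EFinM -!EFinD; congr EFin; rewrite /c -/tau natr1 addnS addSn.
  by congr (_ + _)%R; congr (_ + _)%R; [rewrite mulrC|ring].
have -> : [set w | error w <= (tau + c)%R%:E] = [set w | sqerr e A Q w <= ((tau + c) ^+ 2)%R%:E].
  apply/funext => w /=; rewrite errE.
  have -> : (tau + c)%R%:E = sqrte ((tau + c) ^+ 2)%R%:E by rewrite /= sqrtr_sqr ger0_norm.
  by rewrite lee_sqrt// lee_fin sqr_ge0.
by [].
Qed.
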